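(* Let $n>1$ and let $\Phi$ be an admissible very badly approximable $n\times n$ matrix function, and let $1\le k\le n$. The following statements are equivalent: (1) $k$ is the smallest number for which there exists $\Psi\in\mathcal{A}_{k}^{n}$ such that \[\int_{\mathbb{T}}\operatorname{trace}(\Phi(\zeta)\Psi(\zeta))\,d\boldsymbol{m}(\zeta)=t_{0}(\Phi)+\ldots+t_{n-1}(\Phi);\] (2) $\Phi$ has order $k$, $t_{j}(\Phi)=0$ for $j\geq k$, and $\sigma_{k}(\Phi)=t_{0}(\Phi)+\ldots+t_{k-1}(\Phi)$.
   Context: $\mathbb{T}$ is the unit circle, $\boldsymbol{m}$ normalized Lebesgue measure. $\mathbb{M}_{n,k}$: complex $n\times k$ matrices with operator norm, $\mathbb{M}_n=\mathbb{M}_{n,n}$. For a matrix $A$, $s_j(A)=\inf\{\|A-B\|:\operatorname{rank}B\le j\}$ ($j\ge0$); $\boldsymbol{S}_1^{n,k}$ is $\mathbb{M}_{n,k}$ with trace norm $\sum_j s_j(A)$. For a function space $X$ on $\mathbb{T}$ ($L^p,H^p,H^p_0=\{f\in H^p:\hat f(0)=0\}$), $X(\mathbb{M}_{n,k})$ (resp. $X(\boldsymbol{S}_1^{n,k})$) consists of matrix functions with entries in $X$, normed by the $X$-norm of the pointwise operator (resp. trace) norm. For $1\le k\le n$: $\mathcal{A}_k^{n}=\{\Psi\in H^1_0(\mathbb{M}_{n}):\|\Psi\|_{L^1(\mathbb{M}_{n})}\le1,\ \operatorname{rank}\Psi\le k\text{ a.e.}\}$, $\sigma_k(\Phi)=\sup_{\Psi\in\mathcal{A}_k^{n}}|\int_{\mathbb{T}}\operatorname{trace}(\Phi\Psi)\,d\boldsymbol{m}|$;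 $H_\Phi^{\{k\}}:H^2(\mathbb{M}_{n,k})\to L^2(\boldsymbol{S}_1^{n,k})/H^2(\boldsymbol{S}_1^{n,k})$ maps $F$ to the coset of $\Phi F$ (quotient norm); a maximizing vector of $T$ is a nonzero $x$ with $\|Tx\|=\|T\|\|x\|$. $\Phi$ has order $\ell$ if $\ell$ is the smallest number such that $H_\Phi^{\{\ell\}}$ has a maximizing vector and $\sigma_\ell(\Phi)=\inf_{F\in H^\infty(\mathbb{M}_n)}\|\Phi-F\|_{L^\infty(\boldsymbol{S}_1^n)}$. Superoptimal approximation: $\Omega_0(\Phi)$ is the set of $F\in H^\infty(\mathbb{M}_n)$ minimizing $\operatorname{ess\,sup}_\zeta\|\Phi(\zeta)-F(\zeta)\|$, $\Omega_j(\Phi)$ the set of $F\in\Omega_{j-1}(\Phi)$ minimizing $\operatorname{ess\,sup}_\zeta s_j(\Phi(\zeta)-F(\zeta))$; for $F\in\Omega_{n-1}(\Phi)$, $t_j(\Phi)=\operatorname{ess\,sup}_\zeta s_j((\Phi-F)(\zeta))$; $\Phi$ is very badly approximable if $0\in\Omega_{n-1}(\Phi)$. The Hankel operator is $H_\Phi f=\mathbb{P}_-(\Phi f)$ on $H^2(\mathbb{C}^n)$; $\Phi$ is admissible if $\|H_\Phi\|_{\rm e}$ (distance to compact operators) is strictly less than the smallest nonzero superoptimal singular value of $\Phi$. *)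

(* Defs.v *)
From HB Require Import structures.
From mathcomp Require Import all_boot all_order all_algebra.
From mathcomp Require Import all_classical all_reals all_analysis.
From mathcomp Require Import complex.

Set Implicit Arguments.
Unset Strict Implicit.
Unset Printing Implicit Defensive.

Import Order.TTheory GRing.Theory Num.Theory.
Import numFieldNormedType.Exports.

Local Open Scope classical_set_scope.
Local Open Scope ring_scope.

(*  - A function on the unit circle T is a function f : R[i] -> X; only its *)
(*    values f (expi t), t in [0, 2 pi], matter.  The normalized Lebesgue   *)
(*    measure m on T is (1/2pi) dt on [0, 2 pi] (parametrisation zeta =    *)
(*    e^{it}).                                                              *)

Section Defs.
Context {R : realType}.
Local Notation C := (R[i]).

Definition normc (z : C) : R := Num.sqrt (complex.Re z ^+ 2 + complex.Im z ^+ 2).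

Definition expi (t : R) : C := Complex (cos t) (sin t).

Definition mu := (@lebesgue_measure R).
Definition I02 : set R := `[0%R, (2 * pi)%R].

Definition vnorm m (x : 'cV[C]_m) : R := Num.sqrt (\sum_i normc (x i 0) ^+ 2).

Definition opnorm m k (A : 'M[C]_(m, k)) : R :=
  sup [set vnorm (A *m x) | x in [set x : 'cV[C]_k | vnorm x <= 1]].

Definition sing m k (j : nat) (A : 'M[C]_(m, k)) : R :=
  inf [set opnorm (A - B) | B in [set B : 'M[C]_(m, k) | (\rank B <= j)%N]].

(* trace norm : sum_j s_j(A)  (s_j(A) = 0 for j >= min(m,k)) *)
Definition trnorm m k (A : 'M[C]_(m, k)) : R := \sum_(j < minn m k) sing j A.

Definition Tint_e (g : R -> \bar R) : \bar R :=
  (((2 * pi)^-1)%:E * \int[mu]_(t in I02) g t)%E.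

Definition Tint (f : C -> C) : C :=
  Complex ((2 * pi)^-1 * Rintegral mu I02 (fun t => complex.Re (f (expi t))))
          ((2 * pi)^-1 * Rintegral mu I02 (fun t => complex.Im (f (expi t)))).

Definition esssup (g : C -> R) : \bar R :=
  ereal_inf [set y : \bar R | {ae mu, forall t, I02 t -> ((g (expi t))%:E <= y)%E}].

Definition fourier (f : C -> C) (m : int) : C := Tint (fun z => f z * z ^ (- m)).

Definition Tmeasurable (f : C -> C) : Prop :=
  measurable_fun setT (fun t => complex.Re (f (expi t))) /\
  measurable_fun setT (fun t => complex.Im (f (expi t))).

Definition inLp (p : R) (f : C -> C) : Prop :=
  Tmeasurable f /\ (Tint_e (fun t => (normc (f (expi t)) `^ p)%:E) < +oo)%E.

Definition inLinf (f : C -> C) : Prop :=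
  Tmeasurable f /\ (esssup (fun z => normc (f z)) < +oo)%E.

Definition mxfun m k := C -> 'M[C]_(m, k).

Definition entry m k (F : mxfun m k) (i : 'I_m) (j : 'I_k) : C -> C :=
  fun z => F z i j.

Definition mfadd m k (F G : mxfun m k) : mxfun m k := fun z => F z + G z.
Definition mfsub m k (F G : mxfun m k) : mxfun m k := fun z => F z - G z.
Definition mfmul m p k (F : mxfun m p) (G : mxfun p k) : mxfun m k :=
  fun z => F z *m G z.
Definition mfscale m k (a : C) (F : mxfun m k) : mxfun m k := fun z => a *: F z.
Definition mf0 m k : mxfun m k := fun _ => 0.

Definition LpM (p : R) m k (F : mxfun m k) := forall i j, inLp p (entry F i j).
Definition LinfM m k (F : mxfun m k) := forall i j, inLinf (entry F i j).
Definition analytic m k (F : mxfun m k) :=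
  forall i j (s : int), s < 0 -> fourier (entry F i j) s = 0.
Definition antianalytic m k (F : mxfun m k) :=
  forall i j (s : int), 0 <= s -> fourier (entry F i j) s = 0.
Definition HpM (p : R) m k (F : mxfun m k) := LpM p F /\ analytic F.
Definition HinfM m k (F : mxfun m k) := LinfM F /\ analytic F.
Definition Hp0M (p : R) m k (F : mxfun m k) :=
  HpM p F /\ forall i j, fourier (entry F i j) 0 = 0.

Definition LpNorm (p : R) m k (nrm : 'M[C]_(m, k) -> R) (F : mxfun m k) : \bar R :=
  ((Tint_e (fun t => (nrm (F (expi t)) `^ p)%:E)) `^ p^-1)%E.

Definition LinfNorm m k (nrm : 'M[C]_(m, k) -> R) (F : mxfun m k) : \bar R :=
  esssup (fun z => nrm (F z)).

Definition calA (n k : nat) : set (mxfun n n) :=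
  [set Psi | Hp0M 1 Psi /\ (LpNorm 1 (@opnorm n n) Psi <= 1)%E /\
             {ae mu, forall t, I02 t -> (\rank (Psi (expi t)) <= k)%N}].

Definition sigma_k (n k : nat) (Phi : mxfun n n) : \bar R :=
  ereal_sup [set (normc (Tint (fun z => \tr (Phi z *m Psi z))))%:E
            | Psi in @calA n k].

Definition distS1 (n : nat) (Phi : mxfun n n) : \bar R :=
  ereal_inf [set LinfNorm (@trnorm n n) (mfsub Phi F) | F in @HinfM n n].

(* quotient norm in L^2(S_1^{n,k}) / H^2(S_1^{n,k}) of the coset of G *)
Definition qnorm (n k : nat) (G : mxfun n k) : \bar R :=
  ereal_inf [set LpNorm 2 (@trnorm n k) (mfsub G H) | H in @HpM 2 n k].

Definition Hk_norm (n k : nat) (Phi : mxfun n n) : \bar R :=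
  ereal_sup [set @qnorm n k (mfmul Phi F)
            | F in [set F : mxfun n k | HpM 2 F /\ (LpNorm 2 (@opnorm n k) F <= 1)%E]].

Definition Hk_has_maxvec (n k : nat) (Phi : mxfun n n) : Prop :=
  exists F : mxfun n k, HpM 2 F /\ LpNorm 2 (@opnorm n k) F != 0%E /\
    @qnorm n k (mfmul Phi F) = (@Hk_norm n k Phi * LpNorm 2 (@opnorm n k) F)%E.

Definition order_cond (n l : nat) (Phi : mxfun n n) : Prop :=
  @Hk_has_maxvec n l Phi /\ @sigma_k n l Phi = @distS1 n Phi.

Definition has_order (n k : nat) (Phi : mxfun n n) : Prop :=
  [/\ (1 <= k <= n)%N, @order_cond n k Phi &
      forall l, (1 <= l < k)%N -> ~ @order_cond n l Phi].

Fixpoint Omega (n : nat) (Phi : mxfun n n) (j : nat) : set (mxfun n n) :=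
  match j with
  | 0 => [set F | HinfM F /\ forall G, HinfM G ->
           (LinfNorm (@opnorm n n) (mfsub Phi F)
              <= LinfNorm (@opnorm n n) (mfsub Phi G))%E]
  | j'.+1 => [set F | @Omega n Phi j' F /\ forall G, @Omega n Phi j' G ->
           (LinfNorm (sing j) (mfsub Phi F) <= LinfNorm (sing j) (mfsub Phi G))%E]
  end.

Definition tsv (n : nat) (Phi : mxfun n n) (j : nat) : \bar R :=
  LinfNorm (sing j) (mfsub Phi (xget (@mf0 n n) (@Omega n Phi n.-1))).

Definition very_badly_approximable (n : nat) (Phi : mxfun n n) : Prop :=
  @Omega n Phi n.-1 (@mf0 n n).

(* P_- g : the component of g in H^2_- = L^2 (-) H^2 *)
Definition Pminus (n : nat) (g : mxfun n 1) : mxfun n 1 :=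
  xget (@mf0 n 1) [set h | LpM 2 h /\ antianalytic h /\ HpM 2 (mfsub g h)].

Definition L2vnorm (n : nat) (f : mxfun n 1) : \bar R :=
  LpNorm 2 (fun x : 'cV[C]_n => vnorm x) f.

Definition compact_op (n : nat) (K : mxfun n 1 -> mxfun n 1) : Prop :=
  [/\ (forall f, HpM 2 f -> LpM 2 (K f) /\ antianalytic (K f)),
      (forall (a : C) f g, HpM 2 f -> HpM 2 g ->
         @L2vnorm n (mfsub (K (mfadd (mfscale a f) g)) (mfadd (mfscale a (K f)) (K g)))
           = 0%E) &
      (forall (u : nat -> mxfun n 1) (M : R),
         (forall i, HpM 2 (u i) /\ (@L2vnorm n (u i) <= M%:E)%E) ->
         exists phi : nat -> nat, (forall i, (phi i < phi i.+1)%N) /\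
           forall eps : R, 0 < eps -> exists N, forall a b, (N <= a)%N -> (N <= b)%N ->
             (@L2vnorm n (mfsub (K (u (phi a))) (K (u (phi b)))) < eps%:E)%E)].

Definition hankel_minus_norm (n : nat) (Phi : mxfun n n) (K : mxfun n 1 -> mxfun n 1)
  : \bar R :=
  ereal_sup [set @L2vnorm n (mfsub (@Pminus n (mfmul Phi f)) (K f))
            | f in [set f : mxfun n 1 | HpM 2 f /\ (@L2vnorm n f <= 1)%E]].

Definition hankel_essnorm (n : nat) (Phi : mxfun n n) : \bar R :=
  ereal_inf [set @hankel_minus_norm n Phi K | K in @compact_op n].

Definition admissible (n : nat) (Phi : mxfun n n) : Prop :=
  forall j, (j < n)%N -> @tsv n Phi j != 0%E -> (@hankel_essnorm n Phi < @tsv n Phi j)%E.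

Definition attains_sum (n l : nat) (Phi : mxfun n n) : Prop :=
  exists Psi, @calA n l Psi /\
    let I := Tint (fun z => \tr (Phi z *m Psi z)) in
    complex.Im I = 0 /\ (complex.Re I)%:E = (\sum_(j < n) @tsv n Phi j)%E.

End Defs.

Arguments calA : clear implicits.
Arguments calA {R}.
Arguments sigma_k : clear implicits.
Arguments sigma_k {R}.
Arguments distS1 : clear implicits.
Arguments distS1 {R}.
Arguments qnorm : clear implicits.
Arguments qnorm {R}.
Arguments Hk_norm : clear implicits.
Arguments Hk_norm {R}.
Arguments Hk_has_maxvec : clear implicits.
Arguments Hk_has_maxvec {R}.
Arguments order_cond : clear implicits.
Arguments order_cond {R}.
Arguments has_order : clear implicits.
Arguments has_order {R}.
Arguments Omega : clear implicits.
Arguments Omega {R}.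
Arguments tsv : clear implicits.
Arguments tsv {R}.
Arguments very_badly_approximable : clear implicits.
Arguments very_badly_approximable {R}.
Arguments Pminus : clear implicits.
Arguments Pminus {R}.
Arguments L2vnorm : clear implicits.
Arguments L2vnorm {R}.
Arguments compact_op : clear implicits.
Arguments compact_op {R}.
Arguments hankel_minus_norm : clear implicits.
Arguments hankel_minus_norm {R}.
Arguments hankel_essnorm : clear implicits.
Arguments hankel_essnorm {R}.
Arguments admissible : clear implicits.
Arguments admissible {R}.
Arguments attains_sum : clear implicits.
Arguments attains_sum {R}.

(* Main.v *)
(* Put S = t_0 + ... + t_{n-1}; since 0 is superoptimal, t_j bounds s_j(Phi) almost
   everywhere.  If Psi in A_l attains S, then |trace(Phi Psi)| <= (sum_{j<l} s_j(Phi)) |Psi|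
   forces t_j = 0 for j >= l and sigma_l = S; as sigma_l <= dist(Phi, H^infty) <= S, the
   distance is S too.  Factoring Psi = F G with F in H^2(M_{n,l}), G in H^2_0(M_{l,n}) and
   |F|^2, |G|^2 <= |Psi| makes F a maximizing vector of H_Phi^{l}.  Conversely, if
   sigma_l = S and F is a maximizing vector, duality between L^2(S_1)/H^2(S_1) and H^2_0
   provides G in H^2_0 with Re int trace(Phi F G) = S |F| |G|, and the normalized F G lies
   in A_l and attains S.  So the smallest l for which A_l attains S is the order of Phi.

   The factorization comes from the Beurling-Lax structure of the smallest shift-invariant
   subspace containing the columns of |Psi|^{-1/2} Psi/z: it has an almost everywhere
   orthonormal family of at most rank(Psi) wandering vectors. *)

Require Import Defs.
From HB Require Import structures.
From mathcomp Require Import all_boot all_order all_algebra.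
From mathcomp Require Import all_classical all_reals all_analysis.
From mathcomp Require Import measurable_realfun complex ring lra.

Set Implicit Arguments.
Unset Strict Implicit.
Unset Printing Implicit Defensive.

Import Order.TTheory GRing.Theory Num.Theory.
Import numFieldNormedType.Exports.
Local Open Scope classical_set_scope.
Local Open Scope ring_scope.

(** * Operator norm, singular values and trace norm *)

Section Scalars.
Context {R : realType}.
Local Notation C := (R[i]).
Implicit Types z w : C.

(** Two demands shape the proof. The sum S has to be attained exactly, whereas duality by itself
    gives near-attainment. On matrices of fixed size the operator, trace and Frobenius norms are
    equivalent, so the L^2 norms involved live on one Hilbert space, where near-minimal elements of
    nested convex sets converge; this takes the place of weak compactness. Moreover the two factors
    of Psi must have inner dimension l. With V the matrix of wandering vectors and U = |Psi|^{-1/2}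
    Psi/z, they are F = |Psi|^{1/2} V and G = z V^* U, so the weight divides the size of Psi evenly.
    F is analytic because |Psi|^{1/2} U = Psi/z is, a property that passes from the columns of U to
    the whole invariant subspace; G is analytic because wandering vectors are orthogonal to z times
    the subspace. Hardy spaces enter through Fourier coefficients only, without extension to the
    disc; the facts needed about products follow from one statement: a closed shift-invariant
    subspace of scalar L^2 that contains 1 contains H^2. *)

Lemma normcC z : (normc z)%:C%C = `|z|.
Proof. by rewrite normc_def. Qed.

Lemma normc_ge0 z : 0 <= normc z. Proof. exact: sqrtr_ge0. Qed.

Lemma normcM z w : normc (z * w) = normc z * normc w.
Proof. by apply: (@complexI R); rewrite rmorphM /= !normcC normrM. Qed.

Lemma normcD z w : normc (z + w) <= normc z + normc w.
Proof. by rewrite -lecR rmorphD /= !normcC ler_normD. Qed.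

Lemma normcN z : normc (- z) = normc z.
Proof. by apply: (@complexI R); rewrite !normcC normrN. Qed.

Lemma normcJ z : normc (conjc z) = normc z.
Proof. by apply: (@complexI R); rewrite !normcC normcJ. Qed.

Lemma normcV z : normc z^-1 = (normc z)^-1.
Proof. by apply: (@complexI R); rewrite fmorphV /= !normcC normfV. Qed.

Lemma normc0 : normc (0 : C) = 0.
Proof. by apply: (@complexI R); rewrite !normcC normr0. Qed.

Lemma normc1 : normc (1 : C) = 1.
Proof. by apply: (@complexI R); rewrite !normcC normr1. Qed.

Lemma normc_eq0 z : (normc z == 0) = (z == 0).
Proof. by rewrite -(inj_eq (@complexI R)) normcC normr_eq0. Qed.

Lemma normc_sum (J : Type) (r : seq J) (P : pred J) (f : J -> C) :
  normc (\sum_(i <- r | P i) f i) <= \sum_(i <- r | P i) normc (f i).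
Proof.
elim/big_ind2 : _ => [|x y z w xy zw|//]; first by rewrite normc0.
by rewrite (le_trans (normcD _ _))// lerD.
Qed.

Lemma normcR (x : R) : normc (x%:C%C) = `|x|.
Proof. by rewrite /normc /= expr0n addr0 sqrtr_sqr. Qed.

Lemma normc_sq z : normc z ^+ 2 = complex.Re z ^+ 2 + complex.Im z ^+ 2.
Proof. by rewrite sqr_sqrtr// addr_ge0 ?sqr_ge0. Qed.

Lemma ler_Re_normc z : `|complex.Re z| <= normc z.
Proof. by rewrite -[leLHS]sqrtr_sqr ler_wsqrtr// lerDl sqr_ge0. Qed.

Lemma ler_Im_normc z : `|complex.Im z| <= normc z.
Proof. by rewrite -[leLHS]sqrtr_sqr ler_wsqrtr// lerDr sqr_ge0. Qed.

Lemma normc_le_ReIm z : normc z <= `|complex.Re z| + `|complex.Im z|.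
Proof.
rewrite -(@ler_pXn2r _ 2) ?nnegrE ?normc_ge0 ?addr_ge0//.
rewrite normc_sq sqrrD !real_normK ?num_real// addrAC lerDl.
by rewrite mulrn_wge0// mulr_ge0.
Qed.

Lemma mulcJ z : z * conjc z = (normc z ^+ 2)%:C%C.
Proof. by rewrite -sqr_normc -normcC rmorphXn. Qed.

Lemma normc_expi (t : R) : normc (expi t) = 1.
Proof. by rewrite /normc /= cos2Dsin2 sqrtr1. Qed.

End Scalars.

Section Vectors.
Local Open Scope sesquilinear_scope.
Context {R : realType}.
Local Notation C := (R[i]).

Definition vdot m (x y : 'cV[C]_m) : C := \sum_i x i 0 * conjc (y i 0).

Lemma vdotE m (x y : 'cV[C]_m) : vdot x y = (y ^t* *m x) 0 0.
Proof. by rewrite mxE; apply: eq_bigr => i _; rewrite !mxE mulrC. Qed.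

Lemma vdotDl m (x y z : 'cV[C]_m) : vdot (x + y) z = vdot x z + vdot y z.
Proof.
by rewrite /vdot -big_split; apply: eq_bigr => i _; rewrite mxE mulrDl.
Qed.

Lemma vdotZl m (a : C) (x z : 'cV[C]_m) : vdot (a *: x) z = a * vdot x z.
Proof.
by rewrite /vdot mulr_sumr; apply: eq_bigr => i _; rewrite mxE mulrA.
Qed.

Lemma vdotJ m (x y : 'cV[C]_m) : conjc (vdot x y) = vdot y x.
Proof.
rewrite /vdot rmorph_sum; apply: eq_bigr => i _ /=.
by rewrite rmorphM /= conjcK mulrC.
Qed.

Lemma vdotDr m (x y z : 'cV[C]_m) : vdot z (x + y) = vdot z x + vdot z y.
Proof. by rewrite -vdotJ vdotDl rmorphD /= !vdotJ. Qed.

Lemma vdotZr m (a : C) (x z : 'cV[C]_m) :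
  vdot z (a *: x) = conjc a * vdot z x.
Proof. by rewrite -vdotJ vdotZl rmorphM /= !vdotJ. Qed.

Lemma vdot0l m (x : 'cV[C]_m) : vdot 0 x = 0.
Proof. by rewrite -(scale0r 0) vdotZl mul0r. Qed.

Lemma vdot0r m (x : 'cV[C]_m) : vdot x 0 = 0.
Proof. by rewrite -vdotJ vdot0l conjc0. Qed.

Lemma vdot_adj m k (A : 'M[C]_(m, k)) x y : vdot (A *m x) y = vdot x (A ^t* *m y).
Proof. by rewrite !vdotE trmx_mul map_mxM /= mulmxA trmxCK. Qed.

Lemma vnorm_ge0 m (x : 'cV[C]_m) : 0 <= vnorm x. Proof. exact: sqrtr_ge0. Qed.

Lemma vnorm_sq m (x : 'cV[C]_m) : vnorm x ^+ 2 = \sum_i normc (x i 0) ^+ 2.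
Proof. by rewrite sqr_sqrtr// sumr_ge0// => i _; rewrite sqr_ge0. Qed.

Lemma vdotxx m (x : 'cV[C]_m) : vdot x x = (vnorm x ^+ 2)%:C%C.
Proof.
rewrite vnorm_sq rmorph_sum; apply: eq_bigr => i _ /=; exact: mulcJ.
Qed.

Lemma vnorm_eq0 m (x : 'cV[C]_m) : (vnorm x == 0) = (x == 0).
Proof.
apply/idP/idP => [x0|/eqP->]; last first.
  rewrite /vnorm big1 ?sqrtr0// => i _; by rewrite mxE normc0 expr0n.
apply/eqP/matrixP => i j; rewrite ord1 mxE; apply/eqP; rewrite -normc_eq0.
have : \sum_i normc (x i 0) ^+ 2 == 0 by rewrite -vnorm_sq (eqP x0) expr0n.
rewrite psumr_eq0 => [/allP/(_ i (mem_index_enum _))|k _]; last exact: sqr_ge0.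
by rewrite /= expf_eq0.
Qed.

Lemma vnormZ m (a : C) (x : 'cV[C]_m) : vnorm (a *: x) = normc a * vnorm x.
Proof.
apply/eqP; rewrite -(@eqrXn2 _ 2) ?mulr_ge0 ?normc_ge0 ?vnorm_ge0//.
rewrite exprMn !vnorm_sq mulr_sumr; apply/eqP; apply: eq_bigr => i _.
by rewrite mxE normcM exprMn.
Qed.

Lemma vnorm0 m : vnorm (0 : 'cV[C]_m) = 0.
Proof. by apply/eqP; rewrite vnorm_eq0. Qed.

Lemma vnorm_sqD m (x y : 'cV[C]_m) :
  vnorm (x + y) ^+ 2 = vnorm x ^+ 2 + vnorm y ^+ 2 + 2 * complex.Re (vdot x y).
Proof.
apply: (@complexI R).
rewrite -vdotxx vdotDl !vdotDr !vdotxx -(vdotJ x y) !rmorphD !rmorphM /=.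
rewrite -!addrA; congr (_ + _); rewrite addrA [RHS]addrC; congr (_ + _).
by rewrite addcJ rmorph_nat.
Qed.

Lemma CauchySchwarz_vdot m (x y : 'cV[C]_m) : normc (vdot x y) <= vnorm x * vnorm y.
Proof.
have [->|y0] := eqVneq y 0; first by rewrite vdot0r normc0 vnorm0 mulr0.
have vy : 0 < vnorm y ^+ 2.
  by rewrite exprn_gt0// lt_neqAle vnorm_ge0 andbT eq_sym vnorm_eq0.
set a := vdot x y.
have : 0 <= vnorm ((vnorm y ^+ 2)%:C%C *: x + (- a) *: y) ^+ 2 by exact: sqr_ge0.
rewrite vnorm_sqD !vnormZ vdotZl vdotZr normcR normcN rmorphN /= -/a.
rewrite !mulNr mulrN (mulrC (conjc a)) mulcJ -rmorphM /=.
rewrite ger0_norm ?sqr_ge0// => H.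
rewrite -(@ler_pXn2r _ 2) ?nnegrE ?normc_ge0 ?mulr_ge0 ?vnorm_ge0//.
rewrite -(ler_pM2l vy) exprMn.
move: H; set u := vnorm x; set v := vnorm y; set b := normc a.
rewrite -subr_ge0 => H; rewrite -subr_ge0.
by apply: le_trans H _; rewrite le_eqVlt; apply/orP; left; apply/eqP; ring.
Qed.

Lemma vnormD m (x y : 'cV[C]_m) : vnorm (x + y) <= vnorm x + vnorm y.
Proof.
rewrite -(@ler_pXn2r _ 2) ?nnegrE ?addr_ge0 ?vnorm_ge0//.
rewrite vnorm_sqD sqrrD -addrA -[leRHS]addrA lerD2l addrC lerD2r -(mulr_natl (vnorm x * vnorm y)).
rewrite ler_pM2l// (le_trans _ (CauchySchwarz_vdot x y))//.
exact: le_trans (ler_norm _) (ler_Re_normc _).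
Qed.

Lemma normc_le_vnorm m (x : 'cV[C]_m) i : normc (x i 0) <= vnorm x.
Proof.
rewrite -(@ler_pXn2r _ 2) ?nnegrE ?normc_ge0 ?vnorm_ge0// vnorm_sq (bigD1 i)//=.
by rewrite lerDl sumr_ge0// => j _; exact: sqr_ge0.
Qed.

Lemma vnorm_delta m (i : 'I_m) : vnorm (delta_mx i 0 : 'cV[C]_m) = 1.
Proof.
rewrite /vnorm (bigD1 i)//= big1 => [|j ji]; rewrite mxE ?eqxx ?normc1 ?expr1n ?addr0 ?sqrtr1//.
by rewrite (negbTE ji) normc0 expr0n.
Qed.

End Vectors.

Section MatrixNorms.
Local Open Scope sesquilinear_scope.
Context {R : realType}.
Local Notation C := (R[i]).

Lemma opnorm_has_sup m k (A : 'M[C]_(m, k)) :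
  has_sup [set vnorm (A *m x) | x in [set x : 'cV[C]_k | vnorm x <= 1]].
Proof.
split; first by exists (vnorm (A *m 0)); exists 0 => //=; rewrite vnorm0.
exists (\sum_j vnorm (col j A)) => _ [x /= x1 <-].
have -> : A *m x = \sum_j x j 0 *: col j A.
  apply/matrixP => i j; rewrite ord1 mxE summxE; apply: eq_bigr => k' _.
  by rewrite !mxE mulrC.
elim/big_ind2 : _ => [|a b c d ab cd|j _]; first by rewrite vnorm0.
  by rewrite (le_trans (vnormD _ _))// lerD.
by rewrite vnormZ ler_piMl ?vnorm_ge0// (le_trans (normc_le_vnorm _ _)).
Qed.

Lemma opnorm_ge0 m k (A : 'M[C]_(m, k)) : 0 <= opnorm A.
Proof.
apply: (@le_trans _ _ (vnorm (A *m 0))); first exact: vnorm_ge0.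
by apply: (ub_le_sup (opnorm_has_sup A).2); exists 0 => //=; rewrite vnorm0.
Qed.

Lemma opnorm_le m k (A : 'M[C]_(m, k)) (M : R) : 0 <= M ->
  (forall x, vnorm (A *m x) <= M * vnorm x) -> opnorm A <= M.
Proof.
move=> M0 H; apply: ge_sup; first exact: (opnorm_has_sup A).1.
by move=> _ [x /= x1 <-]; rewrite (le_trans (H x))// ler_piMr.
Qed.

Lemma vnorm_mulmx m k (A : 'M[C]_(m, k)) x :
  vnorm (A *m x) <= opnorm A * vnorm x.
Proof.
have [->|x0] := eqVneq x 0; first by rewrite mulmx0 !vnorm0 mulr0.
have vx : 0 < vnorm x by rewrite lt_neqAle vnorm_ge0 andbT eq_sym vnorm_eq0.
rewrite -ler_pdivrMr//.
apply: (ub_le_sup (opnorm_has_sup A).2); exists ((vnorm x)^-1%:C%C *: x) => /=.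
  by rewrite vnormZ normcR ger0_norm ?invr_ge0 ?vnorm_ge0// mulVf ?gt_eqF.
rewrite -scalemxAr vnormZ normcR ger0_norm ?invr_ge0 ?vnorm_ge0//.
by rewrite mulrC.
Qed.

Lemma opnormD m k (A B : 'M[C]_(m, k)) : opnorm (A + B) <= opnorm A + opnorm B.
Proof.
apply: opnorm_le => [|x]; first by rewrite addr_ge0 ?opnorm_ge0.
by rewrite mulmxDl mulrDl (le_trans (vnormD _ _))// lerD ?vnorm_mulmx.
Qed.

Lemma opnormZ_le m k (a : C) (A : 'M[C]_(m, k)) :
  opnorm (a *: A) <= normc a * opnorm A.
Proof.
apply: opnorm_le => [|x]; first by rewrite mulr_ge0 ?opnorm_ge0 ?normc_ge0.
by rewrite -scalemxAl vnormZ -mulrA ler_wpM2l ?normc_ge0 ?vnorm_mulmx.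
Qed.

Lemma opnormZ m k (a : C) (A : 'M[C]_(m, k)) :
  opnorm (a *: A) = normc a * opnorm A.
Proof.
apply/eqP; rewrite eq_le opnormZ_le/=.
have [->|a0] := eqVneq a 0; first by rewrite normc0 mul0r opnorm_ge0.
rewrite mulrC -ler_pdivlMr; last first.
  by rewrite lt_neqAle normc_ge0 eq_sym normc_eq0 a0.
rewrite -normcV mulrC -{1}(scale1r A) -(mulVf a0) -scalerA.
exact: opnormZ_le.
Qed.

Lemma opnormN m k (A : 'M[C]_(m, k)) : opnorm (- A) = opnorm A.
Proof. by rewrite -scaleN1r opnormZ normcN normc1 mul1r. Qed.

Lemma opnormM m p k (A : 'M[C]_(m, p)) (B : 'M[C]_(p, k)) :
  opnorm (A *m B) <= opnorm A * opnorm B.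
Proof.
apply: opnorm_le => [|x]; first by rewrite mulr_ge0 ?opnorm_ge0.
rewrite -mulmxA (le_trans (vnorm_mulmx _ _))// -mulrA.
by rewrite ler_wpM2l ?opnorm_ge0 ?vnorm_mulmx.
Qed.

Lemma opnorm0 m k : opnorm (0 : 'M[C]_(m, k)) = 0.
Proof. by rewrite -(scale0r 0) opnormZ normc0 mul0r. Qed.

Lemma opnorm_adj_le m k (A : 'M[C]_(m, k)) : opnorm (A ^t*) <= opnorm A.
Proof.
apply: opnorm_le => [|x]; first exact: opnorm_ge0.
have [->|Ax0] := eqVneq (A^t* *m x) 0.
  by rewrite vnorm0 mulr_ge0 ?opnorm_ge0 ?vnorm_ge0.
have vx : 0 < vnorm (A^t* *m x).
  by rewrite lt_neqAle vnorm_ge0 andbT eq_sym vnorm_eq0.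
rewrite -(ler_pM2r vx) -expr2 -lecR -vdotxx -vdot_adj.
have := CauchySchwarz_vdot (A *m (A^t* *m x)) x.
have -> : vdot (A *m (A^t* *m x)) x = (vnorm (A^t* *m x) ^+ 2)%:C%C.
  by rewrite vdot_adj vdotxx.
rewrite normcR ger0_norm ?sqr_ge0// lecR => /le_trans; apply.
by rewrite mulrAC ler_wpM2r ?vnorm_ge0 ?vnorm_mulmx.
Qed.

Lemma opnorm_adj m k (A : 'M[C]_(m, k)) : opnorm (A ^t*) = opnorm A.
Proof.
by apply/eqP; rewrite eq_le opnorm_adj_le/= -{1}(trmxCK A) opnorm_adj_le.
Qed.

Lemma normc_le_opnorm m k (A : 'M[C]_(m, k)) i j : normc (A i j) <= opnorm A.
Proof.
have := vnorm_mulmx A (delta_mx j 0); rewrite vnorm_delta mulr1.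
by apply: le_trans; rewrite -colE (le_trans _ (normc_le_vnorm _ i))// mxE.
Qed.

Definition frob2 m k (A : 'M[C]_(m, k)) : R := \sum_i \sum_j normc (A i j) ^+ 2.

Lemma frob2_ge0 m k (A : 'M[C]_(m, k)) : 0 <= frob2 A.
Proof. by apply: sumr_ge0 => i _; apply: sumr_ge0 => j _; exact: sqr_ge0. Qed.

Lemma frob2_le m k (A : 'M[C]_(m, k)) : frob2 A <= (m * k)%:R * opnorm A ^+ 2.
Proof.
apply: (@le_trans _ _ (\sum_(i < m) \sum_(j < k) opnorm A ^+ 2)).
  apply: ler_sum => i _; apply: ler_sum => j _.
  by rewrite ler_pXn2r ?nnegrE ?normc_ge0 ?opnorm_ge0 ?normc_le_opnorm.
by rewrite !sumr_const !card_ord -mulrnA mulnC mulr_natl.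
Qed.

Lemma opnorm_le_frob2 m k (A : 'M[C]_(m, k)) : opnorm A ^+ 2 <= frob2 A.
Proof.
suff H : opnorm A <= Num.sqrt (frob2 A).
  rewrite -[leRHS]sqr_sqrtr ?frob2_ge0//.
  by rewrite ler_pXn2r ?nnegrE ?opnorm_ge0 ?sqrtr_ge0.
apply: opnorm_le => [|x]; first exact: sqrtr_ge0.
rewrite -(@ler_pXn2r _ 2) ?nnegrE ?mulr_ge0 ?sqrtr_ge0 ?vnorm_ge0//.
rewrite exprMn (sqr_sqrtr (frob2_ge0 A)) vnorm_sq /frob2 mulr_suml.
apply: ler_sum => i _.
have -> : (A *m x) i 0 = vdot x ((row i A)^t*).
  by rewrite mxE; apply: eq_bigr => j _; rewrite !mxE mulrC; congr (_ * _); exact/esym/conjcK.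
have -> : \sum_j normc (A i j) ^+ 2 = vnorm ((row i A)^t*) ^+ 2.
  by rewrite vnorm_sq; apply: eq_bigr => j _; rewrite !mxE normcJ.
rewrite mulrC -exprMn ler_pXn2r ?nnegrE ?mulr_ge0 ?vnorm_ge0 ?normc_ge0//.
exact: CauchySchwarz_vdot.
Qed.

(** The adjoint of S is isometric, hence |S x|^2 = <x, S^* S x> <= |x| |S x|. *)
Lemma opnorm_coisometry r n (S : 'M[C]_(r, n)) : S *m S^t* = 1%:M -> opnorm S <= 1.
Proof.
move=> S1; apply: opnorm_le => // x; rewrite mul1r.
have [->|Sx0] := eqVneq (S *m x) 0; first by rewrite vnorm0 vnorm_ge0.
have vx : 0 < vnorm (S *m x) by rewrite lt_neqAle vnorm_ge0 andbT eq_sym vnorm_eq0.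
have E y : vnorm (S^t* *m y) = vnorm y.
  apply/eqP; rewrite -(@eqrXn2 _ 2) ?vnorm_ge0// -(inj_eq (@complexI R)) -!vdotxx.
  by rewrite vdot_adj trmxCK mulmxA S1 mul1mx.
rewrite -(ler_pM2r vx) -expr2 -lecR -vdotxx vdot_adj.
rewrite (le_trans (_ : _ <= (normc (vdot x (S^t* *m (S *m x))))%:C%C))//.
  by rewrite -vdot_adj vdotxx normcR ger0_norm ?sqr_ge0.
by rewrite lecR -(E (S *m x)) CauchySchwarz_vdot.
Qed.

Lemma rank_lt_kernel m k (A : 'M[C]_(m, k)) : (\rank A < k)%N ->
  exists2 y : 'cV[C]_k, y != 0 & A *m y = 0.
Proof.
move=> rA; have : kermx A^T != 0 by rewrite -mxrank_eq0 mxrank_ker mxrank_tr -lt0n subn_gt0.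
move=> /rowV0Pn[y /sub_kermxP yA y0]; exists y^T.
  by rewrite -(inj_eq (@trmx_inj _ _ _)) trmxK trmx0.
by apply: trmx_inj; rewrite trmx_mul trmxK yA trmx0.
Qed.

Lemma sing_has_inf m k j (A : 'M[C]_(m, k)) :
  has_inf [set opnorm (A - B) | B in [set B : 'M[C]_(m, k) | (\rank B <= j)%N]].
Proof.
split; first by exists (opnorm (A - 0)); exists 0 => //=; rewrite mxrank0.
by exists 0 => _ [B _ <-]; exact: opnorm_ge0.
Qed.

Lemma sing_ge0 m k j (A : 'M[C]_(m, k)) : 0 <= sing j A.
Proof.
by apply: lb_le_inf (sing_has_inf j A).1 _ => _ [B _ <-]; exact: opnorm_ge0.
Qed.

Lemma sing_le m k j (A B : 'M[C]_(m, k)) : (\rank B <= j)%N ->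
  sing j A <= opnorm (A - B).
Proof. by move=> rB; apply: (ge_inf (sing_has_inf j A).2); exists B. Qed.

Lemma le_sing m k j (A : 'M[C]_(m, k)) (c : R) :
  (forall B : 'M[C]_(m, k), (\rank B <= j)%N -> c <= opnorm (A - B)) ->
  c <= sing j A.
Proof.
move=> H; apply: lb_le_inf (sing_has_inf j A).1 _ => _ [B /= rB <-].
exact: H.
Qed.

Lemma sing_mulmxl p m k j (P : 'M[C]_(p, m)) (A : 'M[C]_(m, k)) :
  opnorm P <= 1 -> sing j (P *m A) <= sing j A.
Proof.
move=> P1; apply: le_sing => B rB.
apply: (@le_trans _ _ (opnorm (P *m A - P *m B))).
  by apply: sing_le; rewrite (leq_trans (mxrankM_maxr _ _)).
by rewrite -mulmxBr (le_trans (opnormM _ _))// ler_piMl ?opnorm_ge0.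
Qed.

Lemma sing_rank m k j (A : 'M[C]_(m, k)) : (\rank A <= j)%N -> sing j A = 0.
Proof.
move=> rA; apply/eqP; rewrite eq_le sing_ge0 andbT.
by rewrite (le_trans (sing_le A rA))// subrr opnorm0.
Qed.

Lemma sing_lip m k j (A B : 'M[C]_(m, k)) : sing j A <= sing j B + opnorm (A - B).
Proof.
rewrite -lerBlDr; apply: le_sing => D rD; rewrite lerBlDr.
apply: le_trans (sing_le A rD) _.
have -> : A - D = (B - D) + (A - B) by rewrite [RHS]addrC addrA subrK.
exact: opnormD.
Qed.

End MatrixNorms.

(** * Singular value decomposition and the trace pairing *)

Section SVD.
Local Open Scope sesquilinear_scope.
Context {R : realType}.
Local Notation C := (R[i]).

(** Diagonalizing the positive matrix A^* A gives the right singular vectors V. No left factor is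
    recorded: that the columns of A V are orthogonal with lengths a_i serves every later use and is
    indifferent to the shape of A. *)
Lemma svd_unsorted m k (A : 'M[C]_(m, k)) : exists (V : 'M[C]_k) (a : 'I_k -> R),
  [/\ V^t* *m V = 1%:M, forall i, 0 <= a i &
      (A *m V)^t* *m (A *m V) = \matrix_(i, j) ((a i ^+ 2)%:C%C *+ (i == j))].
Proof.
pose H := A^t* *m A.
have Hn : H \is normalmx.
  apply/hermitian_normalmx/is_hermitianmxP; rewrite expr0 scale1r.
  by rewrite /H trmx_mul map_mxM /= trmxCK.
have /unitarymxP PP := spectral_unitarymx H.
set P := spectralmx H in PP; set D := spectral_diag H.
have /orthomx_spectralP HE := Hn; rewrite -/P -/D in HE.
have PH : P *m H *m P^t* = diag_mx D.
  rewrite HE invmx_unitary; last exact: spectral_unitarymx.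
  by rewrite !mulmxA PP mul1mx -mulmxA PP mulmx1.
exists (P^t*), (fun i => vnorm (col i (A *m P^t*))); split => //.
- by rewrite trmxCK.
- by move=> i; exact: vnorm_ge0.
have E : (A *m P^t*)^t* *m (A *m P^t*) = diag_mx D.
  rewrite -PH /H trmx_mul map_mxM /= trmxCK.
  by rewrite !mulmxA.
apply/matrixP => i j; rewrite [RHS]mxE; have [<-|ij] := eqVneq i j; last first.
  by rewrite E mxE (negbTE ij).
rewrite mulr1n -vdotxx vdotE !mxE; apply: eq_bigr => t _.
by rewrite !mxE.
Qed.

(** Sorting is needed because [sing] numbers the singular values in decreasing order; selecting
    columns along an injective map keeps V unitary. *)
Lemma svd m k (A : 'M[C]_(m, k)) : exists (V : 'M[C]_k) (a : 'I_k -> R),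
  [/\ V^t* *m V = 1%:M, forall i, 0 <= a i,
      forall i j : 'I_k, (i <= j)%N -> a j <= a i &
      (A *m V)^t* *m (A *m V) = \matrix_(i, j) ((a i ^+ 2)%:C%C *+ (i == j))].
Proof.
have [V [a [VV a0 VA]]] := svd_unsorted A.
pose r := relpre a (fun x y : R => y <= x).
pose s := sort r (enum 'I_k).
have ss : size s = k by rewrite size_sort size_enum_ord.
have rt : transitive r by move=> x y z /= xy yz; exact: le_trans yz xy.
have rr : reflexive r by move=> x /=.
have us : uniq s by rewrite sort_uniq enum_uniq.
pose f (i : 'I_k) := nth i s i.
have fi : injective f.
  move=> i j; rewrite /f (set_nth_default j) ?ss// => /eqP.
  by rewrite nth_uniq ?ss// => /eqP/val_inj.
have rtot : total r by move=> x y; rewrite /r /=; exact: le_total.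
exists (colsub f V), (a \o f); split => //=.
- apply/matrixP => i j; have := congr1 (fun M : 'M[C]_k => M (f i) (f j)) VV.
  rewrite /= !mxE (inj_eq fi) => <-.
  by apply: eq_bigr => t _; rewrite !mxE.
- move=> i j ij.
  have := sorted_leq_nth rt rr i (sort_sorted rtot (enum 'I_k)) i j _ _ ij.
  rewrite !inE -/s ss !ltn_ord => /(_ isT isT).
  by rewrite /f (set_nth_default i j) ?ss.
- apply/matrixP => i j; rewrite [RHS]mxE -(inj_eq fi).
  have := congr1 (fun M : 'M[C]_k => M (f i) (f j)) VA.
  rewrite /= [X in _ = X -> _]mxE /= => <-; rewrite !mxE.
  by apply: eq_bigr => t _; rewrite !mxE; congr (Num.conj _ * _);
    apply: eq_bigr => u _; rewrite !mxE.
Qed.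

Section WithSvd.
Variables (m k : nat) (A : 'M[C]_(m, k)) (V : 'M[C]_k) (a : 'I_k -> R).
Hypothesis VV : V^t* *m V = 1%:M.
Hypothesis a0 : forall i, 0 <= a i.
Hypothesis anc : forall i j : 'I_k, (i <= j)%N -> a j <= a i.
Hypothesis VA :
  (A *m V)^t* *m (A *m V) = \matrix_(i, j) ((a i ^+ 2)%:C%C *+ (i == j)).

Lemma svd_VVadj : V *m V^t* = 1%:M. Proof. exact: mulmx1C. Qed.

Lemma svd_vnormV y : vnorm (V *m y) = vnorm y.
Proof.
apply/eqP; rewrite -(@eqrXn2 _ 2) ?vnorm_ge0// -(inj_eq (@complexI R)) -!vdotxx.
by rewrite vdot_adj mulmxA VV mul1mx.
Qed.

Lemma svd_vnormVadj y : vnorm (V^t* *m y) = vnorm y.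
Proof. by rewrite -svd_vnormV mulmxA svd_VVadj mul1mx. Qed.

Lemma svd_vnormAV y :
  vnorm (A *m V *m y) ^+ 2 = \sum_i a i ^+ 2 * normc (y i 0) ^+ 2.
Proof.
apply: (@complexI R); rewrite -vdotxx vdot_adj mulmxA VA rmorph_sum /=.
apply: eq_bigr => i _; rewrite mxE (bigD1 i)//= big1 => [|j ji]; last first.
  by rewrite mxE eq_sym (negbTE ji) mulr0n mul0r.
have cE (b : R) z : conjc (b%:C%C * z) = b%:C%C * conjc z.
  by case: z => u v; simpc.
by rewrite addr0 mxE eqxx mulr1n cE mulrCA mulcJ -rmorphM.
Qed.

(** Courant-Fischer argument: B of rank at most j annihilates a nonzero vector in the span of the
    first j+1 right singular vectors, and A stretches every vector of that span by at least a_j. *)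
Lemma svd_le_sing (j : 'I_k) : a j <= sing j A.
Proof.
apply: le_sing => B rB.
(* [E] embeds the first j+1 coordinates, so that a kernel vector of [B *m V *m E] provides a vector
   of that span annihilated by B. *)
pose E : 'M[C]_(k, j.+1) := \matrix_(i, t) ((i == t :> nat)%:R).
have rBE : (\rank (B *m V *m E) < j.+1)%N.
  by rewrite -mulmxA (leq_trans _ (_ : \rank B < j.+1)%N)// ltnS mxrankM_maxl.
have [y y0 By] := rank_lt_kernel rBE.
have vy : 0 < vnorm y by rewrite lt_neqAle vnorm_ge0 andbT eq_sym vnorm_eq0.
have Ey (t : 'I_k) (tj : (t < j.+1)%N) : (E *m y) t 0 = y (Ordinal tj) 0.
  rewrite mxE (bigD1 (Ordinal tj))//= mxE eqxx mul1r big1 ?addr0// => u ut.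
  rewrite mxE; case: eqP => [tu|]; last by rewrite mul0r.
  by move/eqP: ut; case; exact/val_inj.
have Ey0 (t : 'I_k) : (j < t)%N -> (E *m y) t 0 = 0.
  move=> jt; rewrite mxE big1// => u _; rewrite mxE; case: eqP => [tu|].
    by have := ltn_ord u; rewrite -tu ltnS leqNgt jt.
  by rewrite mul0r.
have EyE (g : 'I_k -> R) : \sum_i g i * normc ((E *m y) i 0) ^+ 2 =
    \sum_(u < j.+1) g (widen_ord (ltn_ord j) u) * normc (y u 0) ^+ 2.
  rewrite (bigID (fun i : 'I_k => (i < j.+1)%N))/= [X in _ + X]big1 ?addr0.
    rewrite (big_ord_narrow (ltn_ord j)).
    apply: eq_bigr => u _; have uj : (widen_ord (ltn_ord j) u < j.+1)%N := ltn_ord u.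
    by rewrite (Ey _ uj); congr (_ * normc (y _ 0) ^+ 2); exact: val_inj.
  by move=> i; rewrite -leqNgt => ji; rewrite Ey0// normc0 expr0n mulr0.
have vEy : vnorm (E *m y) = vnorm y.
  apply/eqP; rewrite -(@eqrXn2 _ 2) ?vnorm_ge0// !vnorm_sq.
  under eq_bigr do rewrite -[_ ^+ 2]mul1r.
  by rewrite (EyE (fun=> 1)); apply/eqP/eq_bigr => u _; rewrite mul1r.
have H := vnorm_mulmx (A - B) (V *m (E *m y)).
rewrite mulmxBl !mulmxA By subr0 -!mulmxA svd_vnormV vEy in H.
rewrite -(ler_pM2r vy); apply: le_trans H.
rewrite -(@ler_pXn2r _ 2) ?nnegrE ?mulr_ge0 ?vnorm_ge0 ?a0// mulmxA svd_vnormAV.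
rewrite EyE exprMn vnorm_sq mulr_sumr; apply: ler_sum => u _.
rewrite ler_wpM2r ?sqr_ge0// ler_pXn2r ?nnegrE ?a0// anc//= -ltnS.
exact: ltn_ord.
Qed.

(** The competitor of rank j is A cut down to the first j right singular vectors. *)
Lemma svd_sing_le (j : 'I_k) : sing j A <= a j.
Proof.
pose D : 'M[C]_k := \matrix_(i, t) (((i == t) && (i < j)%N)%:R).
have rD : (\rank D <= j)%N.
  pose D1 : 'M[C]_(k, j) := \matrix_(i, t) ((i == t :> nat)%:R).
  pose D2 : 'M[C]_(j, k) := \matrix_(i, t) ((i == t :> nat)%:R).
  have -> : D = D1 *m D2.
    apply/matrixP => i t; rewrite !mxE.
    have [ij|ij] := boolP (i < j)%N; last first.
      rewrite andbF big1// => u _; rewrite !mxE; case: eqP => [iu|]; last by rewrite mul0r.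
      by have := ltn_ord u; rewrite -iu (negbTE ij).
    rewrite andbT (bigD1 (Ordinal ij))//= big1 ?addr0; last first.
      move=> u ui; rewrite !mxE; case: eqP => [iu|]; last by rewrite mul0r.
      by move/eqP: ui; case; exact/val_inj.
    by rewrite !mxE eqxx mul1r.
  by rewrite (leq_trans (mxrankM_maxr _ _))// rank_leq_row.
apply: (@le_trans _ _ (opnorm (A - A *m V *m D *m V^t*))).
  apply: sing_le; rewrite (leq_trans (mxrankM_maxl _ _))//.
  by rewrite (leq_trans (mxrankM_maxr _ _)).
apply: opnorm_le => // x; rewrite -(@ler_pXn2r _ 2) ?nnegrE ?mulr_ge0 ?vnorm_ge0//.
have -> : (A - A *m V *m D *m V^t*) *m x = A *m V *m (V^t* *m x - D *m (V^t* *m x)).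
  by rewrite mulmxBl mulmxBr !mulmxA -(mulmxA A V (V^t*)) svd_VVadj mulmx1.
rewrite svd_vnormAV exprMn -(svd_vnormVadj x) vnorm_sq mulr_sumr.
apply: ler_sum => i _; set y := V^t* *m x.
have -> : (y - D *m y) i 0 = if (i < j)%N then 0 else y i 0.
  rewrite mxE [X in _ + X]mxE [X in _ - X]mxE (bigD1 i)//= big1 ?addr0; last first.
    by move=> t ti; rewrite [D i t]mxE eq_sym (negbTE ti) mul0r.
  by rewrite [D i i]mxE eqxx/=; case: ifP; rewrite ?mul1r ?subrr ?mul0r ?subr0.
case: ltnP => ij; first by rewrite normc0 expr0n mulr0 mulr_ge0 ?sqr_ge0.
by rewrite ler_wpM2r ?sqr_ge0// ler_pXn2r ?nnegrE// anc.
Qed.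

Lemma svd_trnorm : trnorm A = \sum_i a i.
Proof.
have singE (j : 'I_k) : sing j A = a j.
  by apply/eqP; rewrite eq_le svd_sing_le svd_le_sing.
rewrite (bigID (fun i : 'I_k => (i < minn m k)%N))/= [X in _ + X]big1 ?addr0.
  rewrite (eq_bigr (fun i : 'I_k => sing i A)); last by move=> i _; rewrite singE.
  by rewrite (big_ord_narrow (geq_minr m k)).
move=> i; rewrite -leqNgt => mi; rewrite -singE sing_rank//.
apply: leq_trans mi; rewrite leq_min rank_leq_row; exact: rank_leq_col.
Qed.

(** Written in the basis V, the trace has diagonal entries of modulus at most |B| |A v_i| = a_i
    |B|. *)
Lemma svd_trace_le (B : 'M[C]_(k, m)) : normc (\tr (A *m B)) <= (\sum_i a i) * opnorm B.
Proof.
have -> : \tr (A *m B) = \sum_i (V^t* *m (B *m (A *m V))) i i.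
  by rewrite -{1}(mulmx1 A) -svd_VVadj mxtrace_mulC !mulmxA mxtrace_mulC !mulmxA.
rewrite (le_trans (normc_sum _ _ _))// mulr_suml; apply: ler_sum => i _.
apply: (@le_trans _ _ (vnorm (col i (V^t* *m (B *m (A *m V)))))).
  by apply: le_trans (normc_le_vnorm _ i); rewrite [X in _ <= normc X]mxE.
rewrite !colE -mulmxA svd_vnormVadj -mulmxA (le_trans (vnorm_mulmx _ _))//.
rewrite mulrC ler_wpM2r ?opnorm_ge0//.
rewrite -(@ler_pXn2r _ 2) ?nnegrE ?vnorm_ge0//.
rewrite svd_vnormAV (bigD1 i)//= big1 => [|j ji].
  by rewrite mxE !eqxx normc1 expr1n mulr1 addr0.
by rewrite mxE (negbTE ji) normc0 expr0n mulr0.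
Qed.

Lemma svd_trace_attained :
  exists2 W : 'M[C]_(k, m), opnorm W <= 1 & \tr (A *m W) = (\sum_i a i)%:C%C.
Proof.
(* [D] inverts the singular values, so the witness is the adjoint of the partial isometry in the
   polar decomposition of A. Since 0^-1 = 0, zero singular values contribute nothing. *)
pose D : 'M[C]_k := \matrix_(i, j) (((a i)^-1)%:C%C *+ (i == j)).
exists (V *m D *m (A *m V)^t*).
  rewrite -opnorm_adj; apply: opnorm_le => // x; rewrite mul1r.
  rewrite -(@ler_pXn2r _ 2) ?nnegrE ?vnorm_ge0//.
  rewrite trmx_mul map_mxM /= trmxCK trmx_mul map_mxM /= -!mulmxA.
  rewrite mulmxA svd_vnormAV -(svd_vnormVadj x) vnorm_sq.
  apply: ler_sum => i _; set y := V^t* *m x.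
  have -> : (D^t* *m y) i 0 = ((a i)^-1)%:C%C * y i 0.
    rewrite mxE (bigD1 i)//= big1 ?addr0; last first.
      by move=> t ti; rewrite !mxE (negbTE ti) mulr0n conjC0 mul0r.
    by rewrite !mxE eqxx mulr1n; congr (_ * _); exact: conjc_real.
  rewrite normcM exprMn normcR ger0_norm ?invr_ge0// mulrA -exprMn.
  have [->|ai0] := eqVneq (a i) 0; last by rewrite mulfV// expr1n mul1r.
  by rewrite mul0r expr0n mul0r sqr_ge0.
rewrite !mulmxA -(mulmxA _ D) mxtrace_mulC -mulmxA VA rmorph_sum /=.
apply: eq_bigr => i _; rewrite mxE (bigD1 i)//= big1 ?addr0; last first.
  by move=> t ti; rewrite [D i t]mxE eq_sym (negbTE ti) mulr0n mul0r.
rewrite !mxE eqxx !mulr1n -rmorphM /=; congr (_%:C)%C.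
have [->|ai0] := eqVneq (a i) 0; first by rewrite expr0n mulr0.
by rewrite expr2 mulKf.
Qed.

End WithSvd.

Lemma trace_le_trnorm m k (A : 'M[C]_(m, k)) (B : 'M[C]_(k, m)) :
  normc (\tr (A *m B)) <= trnorm A * opnorm B.
Proof.
have [V [a [VV a0 anc VA]]] := svd A.
by rewrite (svd_trnorm VV a0 anc VA) (svd_trace_le VV a0 VA).
Qed.

Lemma trnorm_attained m k (A : 'M[C]_(m, k)) :
  exists2 W : 'M[C]_(k, m), opnorm W <= 1 & \tr (A *m W) = (trnorm A)%:C%C.
Proof.
have [V [a [VV a0 anc VA]]] := svd A.
by rewrite (svd_trnorm VV a0 anc VA); exact: (svd_trace_attained VV a0 VA).
Qed.

Lemma trnorm_ge0 m k (A : 'M[C]_(m, k)) : 0 <= trnorm A.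
Proof. by apply: sumr_ge0 => j _; exact: sing_ge0. Qed.

(** The trace norm is a maximum of traces against contractions, so a bound on these traces bounds
    it; the triangle inequality and the product estimates below are read off from this. *)
Lemma trnorm_le m k (A : 'M[C]_(m, k)) (c : R) :
  (forall W : 'M[C]_(k, m), opnorm W <= 1 -> complex.Re (\tr (A *m W)) <= c) ->
  trnorm A <= c.
Proof. by move=> H; have [W W1 WE] := trnorm_attained A; have := H _ W1; rewrite WE. Qed.

Lemma Re_trace_le m k (A : 'M[C]_(m, k)) (B : 'M[C]_(k, m)) :
  complex.Re (\tr (A *m B)) <= trnorm A * opnorm B.
Proof.
apply: le_trans (trace_le_trnorm A B).
exact: le_trans (ler_norm _) (ler_Re_normc _).
Qed.

Lemma trnormD m k (A B : 'M[C]_(m, k)) : trnorm (A + B) <= trnorm A + trnorm B.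
Proof.
apply: trnorm_le => W W1; rewrite mulmxDl raddfD /= raddfD /=.
by rewrite lerD// (le_trans (Re_trace_le _ _))// ler_piMr// trnorm_ge0.
Qed.

Lemma trnormZ_le m k (a : C) (A : 'M[C]_(m, k)) :
  trnorm (a *: A) <= normc a * trnorm A.
Proof.
apply: trnorm_le => W W1; rewrite -scalemxAl scalemxAr (le_trans (Re_trace_le _ _))//.
rewrite mulrC opnormZ ler_wpM2r ?trnorm_ge0// -[leRHS]mulr1.
by rewrite ler_wpM2l ?normc_ge0.
Qed.

Lemma trnorm_mulmxr m p k (A : 'M[C]_(m, p)) (F : 'M[C]_(p, k)) :
  trnorm (A *m F) <= trnorm A * opnorm F.
Proof.
apply: trnorm_le => W W1; rewrite -mulmxA (le_trans (Re_trace_le _ _))//.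
rewrite ler_wpM2l ?trnorm_ge0// (le_trans (opnormM _ _))//.
by rewrite ler_piMr ?opnorm_ge0.
Qed.

Lemma trnorm_le_opnorm m k (A : 'M[C]_(m, k)) : trnorm A <= (minn m k)%:R * opnorm A.
Proof.
rewrite -[leRHS]mulrC mulr_natr -[X in _ *+ X]card_ord -sumr_const.
apply: ler_sum => j _; rewrite -[X in opnorm X]subr0; apply: sing_le.
by rewrite mxrank0.
Qed.

Lemma opnorm_le_trnorm m k (A : 'M[C]_(m, k)) : opnorm A <= trnorm A.
Proof.
have [mk|mk] := posnP (minn m k).
  rewrite (_ : A = 0) ?opnorm0 ?trnorm_ge0//; apply/eqP; rewrite -mxrank_eq0 -leqn0.
  by rewrite -mk leq_min rank_leq_row; exact: rank_leq_col.
rewrite /trnorm (bigD1 (Ordinal mk))//= ler_wpDr//.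
  by apply: sumr_ge0 => i _; exact: sing_ge0.
apply: le_sing => B; rewrite leqn0 mxrank_eq0 => /eqP ->.
by rewrite subr0.
Qed.

(** Compressing to r rows leaves at most r singular values, none larger than that of A with the same
    index because S is a contraction. *)
Lemma trnorm_row_unitary n r m (S : 'M[C]_(r, n)) (A : 'M[C]_(n, m)) :
  S *m S^t* = 1%:M -> trnorm (S *m A) <= \sum_(j < r) sing j A.
Proof.
move=> S1; rewrite /trnorm.
apply: (@le_trans _ _ (\sum_(j < minn r m) sing j A)).
  by apply: ler_sum => j _; exact/sing_mulmxl/opnorm_coisometry.
rewrite -(big_mkord xpredT (fun j => sing j A)).
rewrite -[leRHS](big_mkord xpredT (fun j => sing j A)).
rewrite [leRHS](big_cat_nat _ (geq_minl r m))//= lerDl sumr_ge0// => j _.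
exact: sing_ge0.
Qed.

(** With S an orthonormal basis of the row space of B one has B S^* S = B, so the trace is that of S
    A against B S^*, and S A has at most l rows. *)
Lemma trace_le_sing n (A B : 'M[C]_n) l : (\rank B <= l)%N ->
  normc (\tr (A *m B)) <= (\sum_(j < l) sing j A) * opnorm B.
Proof.
move=> rB.
pose S := schmidt (row_base B).
have /unitarymxP SS : S \is unitarymx by rewrite schmidt_unitarymx// rank_leq_row.
have /submxP[D BD] : (B <= S)%MS.
  by rewrite (submx_trans _ (schmidt_sub _))// eq_row_base.
have -> : \tr (A *m B) = \tr (S *m A *m (B *m S^t*)).
  have BS : B *m S^t* *m S = B.
    by rewrite [X in X *m _ *m _]BD -!mulmxA [S *m (S^t* *m S)]mulmxA SS mul1mx -BD.
  by rewrite [RHS]mxtrace_mulC mulmxA BS mxtrace_mulC.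
rewrite (le_trans (trace_le_trnorm _ _))// ler_pM ?trnorm_ge0 ?opnorm_ge0//.
  rewrite (le_trans (trnorm_row_unitary _ SS))//.
  rewrite -(big_mkord xpredT (fun j => sing j A)).
  rewrite -[leRHS](big_mkord xpredT (fun j => sing j A)).
  rewrite [leRHS](big_cat_nat _ rB)//= lerDl sumr_ge0// => j _.
  exact: sing_ge0.
rewrite (le_trans (opnormM _ _))// ler_piMr ?opnorm_ge0// opnorm_adj.
exact: opnorm_coisometry.
Qed.

End SVD.

(** * Integration on the circle *)

Section CircleIntegral.
Context {R : realType}.
Local Notation C := (R[i]).
Implicit Types (f g h : C -> R).

Lemma ae_mu_filter : Filter (almost_everywhere (@mu R)).
Proof. exact: ae_filter_ringOfSetsType. Qed.

Lemma ae_muS (A B : R -> Prop) : (forall t, A t -> B t) ->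
  {ae @mu R, forall t, A t} -> {ae @mu R, forall t, B t}.
Proof. exact: (@filterS _ _ ae_mu_filter). Qed.

Lemma ae_muI (A B : R -> Prop) : {ae @mu R, forall t, A t} ->
  {ae @mu R, forall t, B t} -> {ae @mu R, forall t, A t /\ B t}.
Proof. exact: (@filterI _ _ ae_mu_filter). Qed.

Definition aeT (P : C -> Prop) := {ae @mu R, forall t, @I02 R t -> P (expi t)}.

(** Values off the circle are arbitrary; the hypothesis |z| = 1 supplied here is what allows z to be
    inverted in later almost everywhere arguments. *)
Lemma aeT_mono (P Q : C -> Prop) :
  (forall z, normc z = 1 -> P z -> Q z) -> aeT P -> aeT Q.
Proof.
by move=> PQ p; apply: (ae_muS _ p) => t H tI; apply: PQ (H tI); exact: normc_expi.
Qed.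

Lemma aeTW (P : C -> Prop) : (forall z, normc z = 1 -> P z) -> aeT P.
Proof. by move=> H; apply: aeW => t _; apply: H; exact: normc_expi. Qed.

Lemma aeT_and (P Q : C -> Prop) : aeT P -> aeT Q -> aeT (fun z => P z /\ Q z).
Proof.
move=> p q; apply: (ae_muS _ (ae_muI p q)) => t [HP HQ] tI.
by split; [exact: HP|exact: HQ].
Qed.

Lemma aeT2 (P Q S : C -> Prop) :
  (forall z, normc z = 1 -> P z -> Q z -> S z) -> aeT P -> aeT Q -> aeT S.
Proof.
by move=> H p q; apply: aeT_mono (aeT_and p q) => z z1 [? ?]; exact: H.
Qed.

Lemma aeT3 (P Q S V : C -> Prop) :
  (forall z, normc z = 1 -> P z -> Q z -> S z -> V z) ->
  aeT P -> aeT Q -> aeT S -> aeT V.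
Proof.
by move=> H p q; apply: aeT2 (aeT_and p q) => z z1 [? ?]; exact: H.
Qed.

Lemma aeT_foralln (P : nat -> C -> Prop) :
  (forall n, aeT (P n)) -> aeT (fun z => forall n, P n z).
Proof.
move=> H; have /ae_foralln p : forall n, {ae @mu R, forall t, @I02 R t -> P n (expi t)} by [].
by apply: (ae_muS _ p) => t tP tI n; exact: tP.
Qed.

Lemma aeT_forall (J : finType) (P : J -> C -> Prop) :
  (forall j, aeT (P j)) -> aeT (fun z => forall j, P j z).
Proof.
move=> H.
have : aeT (fun z => forall n, forall j : J, enum_rank j = n :> nat -> P j z).
  apply: aeT_foralln => n; have [nJ|nJ] := ltnP n #|J|.
    apply: aeT_mono (H (enum_val (Ordinal nJ))) => z _ Pz j jn.
    by move: Pz; rewrite (_ : Ordinal nJ = enum_rank j) ?enum_rankK//; exact/val_inj.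
  apply: aeTW => z _ j jn; have := ltn_ord (enum_rank j).
  by rewrite jn ltnNge nJ.
by apply: aeT_mono => z _ + j => /(_ _ j erefl).
Qed.

Definition Tm f := measurable_fun [set: R] (fun t : R => f (expi t)).

Lemma mI02 : measurable (@I02 R : set (measurableTypeR R)).
Proof. exact: measurable_itv. Qed.

Lemma pi2_gt0 : 0 < 2 * pi :> R. Proof. by rewrite mulr_gt0 ?pi_gt0. Qed.

Lemma mu_I02 : @mu R (@I02 R) = (2 * pi)%:E.
Proof. by rewrite /mu /I02 lebesgue_measure_itv/= lte_fin pi2_gt0 oppr0 adde0. Qed.

Lemma Tm_cst (c : R) : Tm (fun=> c). Proof. exact: measurable_cst. Qed.
Lemma TmD f g : Tm f -> Tm g -> Tm (fun z => f z + g z).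
Proof. exact: measurable_funD. Qed.
Lemma TmB f g : Tm f -> Tm g -> Tm (fun z => f z - g z).
Proof. exact: measurable_funB. Qed.
Lemma TmM f g : Tm f -> Tm g -> Tm (fun z => f z * g z).
Proof. exact: measurable_funM. Qed.
Lemma TmN f : Tm f -> Tm (fun z => - f z).
Proof. exact: measurable_funN. Qed.
Lemma TmX f k : Tm f -> Tm (fun z => f z ^+ k).
Proof. exact: measurable_funX. Qed.
Lemma Tm_comp (k : R -> R) f : measurable_fun setT k -> Tm f -> Tm (fun z => k (f z)).
Proof. by move=> mk mf; exact: (measurableT_comp mk mf). Qed.
Lemma Tm_norm f : Tm f -> Tm (fun z => `|f z|).
Proof. exact: (Tm_comp (@normr_measurable R setT)). Qed.
Lemma Tm_sqrt f : Tm f -> Tm (fun z => Num.sqrt (f z)).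
Proof.
by apply: Tm_comp; apply: continuous_measurable_fun; exact: sqrt_continuous.
Qed.
Lemma Tm_inv f : (forall z, 0 <= f z) -> Tm f -> Tm (fun z => (f z)^-1).
Proof.
move=> f0 mf; rewrite (_ : (fun z => _) = (fun z => f z `^ (-1))).
  by apply: (Tm_comp (k := fun x => x `^ (-1))) => //; exact: measurable_powR.
by apply/funext => z; rewrite powR_inv1.
Qed.
Lemma Tm_sum (J : Type) (r : seq J) (P : pred J) (F : J -> C -> R) :
  (forall j, Tm (F j)) -> Tm (fun z => \sum_(j <- r | P j) F j z).
Proof.
move=> mF; elim: r => [|j r IH].
  by rewrite (_ : (fun z => _) = (fun=> 0)); [exact: Tm_cst|apply/funext => z; rewrite big_nil].
rewrite (_ : (fun z => _) = (fun z => (if P j then F j z else 0) + \sum_(j <- r | P j) F j z)).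
  by apply: TmD => //; case: (P j) => //; exact: Tm_cst.
by apply/funext => z; rewrite big_cons; case: ifP; rewrite ?add0r.
Qed.

(** As in [Tmeasurable], measurability concerns the whole parameter line, while integrability
    concerns one period. *)
Definition L1 f := Tm f /\ (@mu R).-integrable (@I02 R) (fun t => (f (expi t))%:E).
Definition mean f : R := (2 * pi)^-1 * Rintegral (@mu R) (@I02 R) (fun t => f (expi t)).

Lemma L1m f : L1 f -> Tm f. Proof. by case. Qed.

Lemma Tm_R f : Tm f ->
  measurable_fun [set: measurableTypeR R] (fun t : measurableTypeR R => f (expi t)).
Proof. by move=> mf; exact: mf. Qed.

Lemma Tm_E f : Tm f -> measurable_fun (@I02 R : set (measurableTypeR R))
  (fun t : measurableTypeR R => (f (expi t))%:E).
Proof.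
by move=> /Tm_R mf; apply: measurable_funTS; exact: (measurableT_comp (@EFin_measurable R setT) mf).
Qed.

Lemma L1D f g : L1 f -> L1 g -> L1 (fun z => f z + g z).
Proof.
move=> [mf If] [mg Ig]; split; first exact: TmD.
by have := integrableD mI02 If Ig; apply: (eq_integrable mI02) => t _.
Qed.

Lemma L1Z (c : R) f : L1 f -> L1 (fun z => c * f z).
Proof.
move=> [mf If]; split; first by apply: TmM => //; exact: Tm_cst.
by have := integrableZl mI02 c If; apply: (eq_integrable mI02) => t _.
Qed.

Lemma L1N f : L1 f -> L1 (fun z => - f z).
Proof. by move=> /(L1Z (-1)); rewrite (_ : (fun z => _) = (fun z => - f z))//; apply/funext => z; rewrite mulN1r. Qed.

Lemma L1B f g : L1 f -> L1 g -> L1 (fun z => f z - g z).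
Proof. by move=> ? ?; apply: L1D => //; exact: L1N. Qed.

Lemma L1_norm f : L1 f -> L1 (fun z => `|f z|).
Proof.
move=> [mf If]; split; first exact: Tm_norm.
by have := integrable_abse If; apply: (eq_integrable mI02) => t _.
Qed.

Lemma L1_cst (c : R) : L1 (fun=> c).
Proof.
split; first exact: Tm_cst.
apply/integrableP; split; first exact: Tm_E (Tm_cst c).
apply: (@le_lt_trans _ _ (`|c| * (2 * pi))%:E); last exact: ltry.
by rewrite EFinM -mu_I02 le_eqVlt; apply/orP; left; apply/eqP; exact: (integral_cst (@mu R) mI02 (`|c|%:E)).
Qed.

Lemma L1_sum (J : Type) (r : seq J) (P : pred J) (F : J -> C -> R) :
  (forall j, L1 (F j)) -> L1 (fun z => \sum_(j <- r | P j) F j z).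
Proof.
move=> mF; elim: r => [|j r IH].
  by rewrite (_ : (fun z => _) = (fun=> 0)); [exact: L1_cst|apply/funext => z; rewrite big_nil].
rewrite (_ : (fun z => _) = (fun z => (if P j then F j z else 0) + \sum_(j <- r | P j) F j z)).
  by apply: L1D => //; case: (P j) => //; exact: L1_cst.
by apply/funext => z; rewrite big_cons; case: ifP; rewrite ?add0r.
Qed.

Lemma L1_le f g : Tm f -> aeT (fun z => `|f z| <= g z) -> L1 g -> L1 f.
Proof.
move=> mf fg [mg /integrableP[_ Ig]]; split => //; apply/integrableP.
split; first exact: Tm_E.
apply: le_lt_trans Ig; apply: ae_ge0_le_integral => //.
- exact: mI02.
- by apply: measurableT_comp => //; exact: Tm_E.
- by apply: measurableT_comp => //; exact: Tm_E.
- apply: (ae_muS _ fg) => t H tI; rewrite !abse_EFin lee_fin.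
  by apply: le_trans (H tI) _; exact: ler_norm.
Qed.

Lemma mean_D f g : L1 f -> L1 g -> mean (fun z => f z + g z) = mean f + mean g.
Proof. by move=> [_ If] [_ Ig]; rewrite /mean RintegralD ?mulrDr//; exact: mI02. Qed.

Lemma mean_Z (c : R) f : L1 f -> mean (fun z => c * f z) = c * mean f.
Proof. by move=> [_ If]; rewrite /mean RintegralZl 1?mulrCA//; exact: mI02. Qed.

Lemma mean_N f : L1 f -> mean (fun z => - f z) = - mean f.
Proof.
move=> /(mean_Z (-1)); rewrite mulN1r => <-; congr mean.
by apply/funext => z; rewrite mulN1r.
Qed.

Lemma mean_B f g : L1 f -> L1 g -> mean (fun z => f z - g z) = mean f - mean g.
Proof. by move=> fL gL; rewrite mean_D ?mean_N//; exact: L1N. Qed.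

Lemma mean_cst (c : R) : mean (fun=> c) = c.
Proof.
have E : Rintegral (@mu R) (@I02 R) (fun=> c) = c * (2 * pi).
  rewrite -[X in c * X]/(fine (2 * pi)%:E) -mu_I02.
  exact: (Rintegral_cst (@mu R) mI02).
by rewrite /mean E mulrCA mulVf ?mulr1// gt_eqF ?pi2_gt0.
Qed.

Lemma mean_sum (J : Type) (r : seq J) (P : pred J) (F : J -> C -> R) :
  (forall j, L1 (F j)) ->
  mean (fun z => \sum_(j <- r | P j) F j z) = \sum_(j <- r | P j) mean (F j).
Proof.
move=> mF; elim: r => [|j r IH].
  by rewrite big_nil -[RHS](mean_cst 0); congr mean; apply/funext => z; rewrite big_nil.
rewrite big_cons -IH.
case: (boolP (P j)) => Pj; last first.
  by congr mean; apply/funext => z; rewrite big_cons (negbTE Pj).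
rewrite -mean_D//; last exact: L1_sum.
by congr mean; apply/funext => z; rewrite big_cons Pj.
Qed.

Lemma mean_ge0 f : (forall z, 0 <= f z) -> 0 <= mean f.
Proof.
move=> f0; rewrite mulr_ge0 ?invr_ge0 ?(ltW pi2_gt0)//.
by apply: Rintegral_ge0 => t _.
Qed.

Lemma mean_ae_eq f g : Tm f -> Tm g -> aeT (fun z => f z = g z) -> mean f = mean g.
Proof.
move=> mf mg fg; rewrite /mean /Rintegral; congr (_ * fine _).
apply: ae_eq_integral; [exact: mI02|exact: Tm_E|exact: Tm_E|].
by apply: (ae_muS _ fg) => t H /H ->.
Qed.

Lemma mean_le f g : L1 f -> L1 g -> aeT (fun z => f z <= g z) -> mean f <= mean g.
Proof.
move=> fL gL fg.
(* [mean_ge0] wants a function that is nonnegative everywhere; the positive part of g - f is one and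
   agrees with g - f almost everywhere. *)
pose h z := Num.max (g z - f z) 0.
have E : aeT (fun z => h z = g z - f z).
  by apply: aeT_mono fg => z _ H; rewrite /h max_l// subr_ge0.
rewrite -subr_ge0 -mean_B// -(@mean_ae_eq h).
- by apply: mean_ge0 => z; rewrite /h le_max lexx orbT.
- by apply: measurable_maxr; [exact: TmB (L1m gL) (L1m fL)|exact: measurable_cst].
- exact: TmB (L1m gL) (L1m fL).
- exact: E.
Qed.

Lemma mean_eq0 f : L1 f -> (forall z, 0 <= f z) -> mean f = 0 -> aeT (fun z => f z = 0).
Proof.
move=> [mf If] f0 /eqP; rewrite /mean mulf_eq0 gt_eqF ?invr_gt0 ?pi2_gt0//= => /eqP H.
have : (\int[@mu R]_(x in @I02 R) `|(f (expi x))%:E| = 0)%E.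
  rewrite (eq_integral (fun x : measurableTypeR R => (f (expi x))%:E)); last first.
    by move=> x _; rewrite abse_EFin ger0_norm.
  by have := fineK (integrable_fin_num mI02 If); move: H; rewrite /Rintegral => -> <-.
move=> /(ae_eq_integral_abs _ mI02 (Tm_E mf)) p.
by apply: (ae_muS _ p) => t H' /H' [].
Qed.

Lemma Tint_e_L1 f : (forall z, 0 <= f z) -> L1 f ->
  Tint_e (fun t => (f (expi t))%:E) = (mean f)%:E.
Proof.
move=> f0 [_ If]; rewrite /Tint_e EFinM; congr (_ * _)%E.
by rewrite /Rintegral; exact/esym/fineK/(integrable_fin_num mI02 If).
Qed.

Lemma L1_Tint_e f : (forall z, 0 <= f z) -> Tm f ->
  (Tint_e (fun t => (f (expi t))%:E) < +oo)%E -> L1 f.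
Proof.
move=> f0 mf H; split=> //; apply/integrableP; split; first exact: Tm_E.
rewrite (eq_integral (fun x : measurableTypeR R => (f (expi x))%:E)); last first.
  by move=> x _; rewrite abse_EFin ger0_norm.
move: H; rewrite /Tint_e; set v := (\int[_]_(_ in _) _)%E.
have v0 : (0 <= v)%E by apply: integral_ge0 => t _; rewrite lee_fin.
case: v v0 => [r| |]// _; first by move=> _; exact: ltry.
by rewrite gt0_muley ?ltxx// lte_fin invr_gt0 pi2_gt0.
Qed.

End CircleIntegral.

(** * Complex integrable and square integrable functions *)

Section ComplexIntegral.
Context {R : realType}.
Local Notation C := (R[i]).
Implicit Types (f g : C -> C).

Lemma circ_eq (T : Type) (f g : C -> T) : (forall z, normc z = 1 -> f z = g z) ->
  (fun t : R => f (expi t)) = (fun t => g (expi t)).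
Proof. by move=> H; apply/funext => t; apply: H; exact: normc_expi. Qed.

Lemma Tm_ext (f g : C -> R) : (forall z, normc z = 1 -> f z = g z) -> Tm f -> Tm g.
Proof. by move=> H; rewrite /Tm (circ_eq H). Qed.

Lemma L1_ext (f g : C -> R) : (forall z, normc z = 1 -> f z = g z) -> L1 f -> L1 g.
Proof.
move=> H [mf If]; split; first exact: Tm_ext mf.
rewrite (_ : (fun t => _) = (fun t => (f (expi t))%:E))//.
by apply/funext => t; rewrite H// normc_expi.
Qed.

Lemma mean_ext (f g : C -> R) : (forall z, normc z = 1 -> f z = g z) -> mean f = mean g.
Proof. by move=> H; rewrite /mean (circ_eq H). Qed.

Definition Cm f := Tm (fun z => complex.Re (f z)) /\ Tm (fun z => complex.Im (f z)).

Lemma Cm_ext f g : (forall z, normc z = 1 -> f z = g z) -> Cm f -> Cm g.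
Proof.
move=> H [m1 m2]; split; [apply: Tm_ext m1|apply: Tm_ext m2] => z z1 //=; by rewrite H.
Qed.

Lemma Re_D (z w : C) : complex.Re (z + w) = complex.Re z + complex.Re w.
Proof. by case: z w => [a b] [c d]. Qed.
Lemma Im_D (z w : C) : complex.Im (z + w) = complex.Im z + complex.Im w.
Proof. by case: z w => [a b] [c d]. Qed.
Lemma Re_M (z w : C) : complex.Re (z * w) =
  complex.Re z * complex.Re w - complex.Im z * complex.Im w.
Proof. by case: z w => [a b] [c d]. Qed.
Lemma Im_M (z w : C) : complex.Im (z * w) =
  complex.Re z * complex.Im w + complex.Im z * complex.Re w.
Proof. by case: z w => [a b] [c d]. Qed.
Lemma Re_J (z : C) : complex.Re (conjc z) = complex.Re z.
Proof. by case: z. Qed.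
Lemma Im_J (z : C) : complex.Im (conjc z) = - complex.Im z.
Proof. by case: z. Qed.

Lemma Cm_cst (c : C) : Cm (fun=> c).
Proof. by split; exact: Tm_cst. Qed.

Lemma CmD f g : Cm f -> Cm g -> Cm (fun z => f z + g z).
Proof.
move=> [a b] [c d]; split.
  by apply: Tm_ext (TmD a c) => z _; rewrite Re_D.
by apply: Tm_ext (TmD b d) => z _; rewrite Im_D.
Qed.

Lemma CmM f g : Cm f -> Cm g -> Cm (fun z => f z * g z).
Proof.
move=> [a b] [c d]; split.
  by apply: Tm_ext (TmB (TmM a c) (TmM b d)) => z _; rewrite Re_M.
by apply: Tm_ext (TmD (TmM a d) (TmM b c)) => z _; rewrite Im_M.
Qed.

Lemma CmJ f : Cm f -> Cm (fun z => conjc (f z)).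
Proof.
move=> [a b]; split.
  by apply: Tm_ext a => z _; rewrite Re_J.
by apply: Tm_ext (TmN b) => z _; rewrite Im_J.
Qed.

Lemma Cm_real (f : C -> R) : Tm f -> Cm (fun z => (f z)%:C%C).
Proof. by move=> mf; split => //; exact: Tm_cst. Qed.

Lemma Cm_sum (J : Type) (r : seq J) (P : pred J) (F : J -> C -> C) :
  (forall j, Cm (F j)) -> Cm (fun z => \sum_(j <- r | P j) F j z).
Proof.
move=> mF; elim: r => [|j r IH].
  by apply: Cm_ext (Cm_cst 0) => z _; rewrite big_nil.
have : Cm (fun z => (if P j then F j z else 0) + \sum_(j <- r | P j) F j z).
  by apply: CmD => //; case: (P j) => //; exact: Cm_cst.
by apply: Cm_ext => z _; rewrite big_cons; case: ifP; rewrite ?add0r.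
Qed.

Lemma Cm_id : Cm (fun z => z).
Proof.
split; rewrite /=; apply: continuous_measurable_fun.
  exact: continuous_cos.
exact: continuous_sin.
Qed.

Lemma CmX f k : Cm f -> Cm (fun z => f z ^+ k).
Proof.
move=> mf; elim: k => [|k IH]; first exact: Cm_cst.
by apply: Cm_ext (CmM mf IH) => z _; rewrite exprS.
Qed.

Lemma circ_inv (z : C) : normc z = 1 -> z^-1 = conjc z.
Proof.
move=> z1; have z0 : z != 0 by rewrite -normc_eq0 z1 oner_eq0.
by apply: (mulfI z0); rewrite mulfV// mulcJ z1 expr1n.
Qed.

Lemma circ_neq0 (z : C) : normc z = 1 -> z != 0.
Proof. by move=> z1; rewrite -normc_eq0 z1 oner_eq0. Qed.

Lemma normcX (z : C) k : normc (z ^+ k) = normc z ^+ k.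
Proof. by elim: k => [|k IH]; rewrite ?normc1// !exprS normcM IH. Qed.

Lemma normc_expz (z : C) (s : int) : normc z = 1 -> normc (z ^ s) = 1.
Proof.
move=> z1; case: s => s; first by rewrite -exprnP normcX z1 expr1n.
by rewrite NegzE -invr_expz normcV -exprnP normcX z1 expr1n invr1.
Qed.

Lemma Cm_expz (s : int) : Cm (fun z => z ^ s).
Proof.
case: s => s; first exact: CmX Cm_id.
apply: Cm_ext (CmJ (CmX s.+1 Cm_id)) => z z1.
by rewrite NegzE -invr_expz circ_inv ?normc_expz.
Qed.

Lemma Tm_normc f : Cm f -> Tm (fun z => normc (f z)).
Proof.
move=> [a b]; apply: Tm_sqrt; apply: TmD; exact: TmX.
Qed.

Definition C1 f := L1 (fun z => complex.Re (f z)) /\ L1 (fun z => complex.Im (f z)).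

Lemma C1_Cm f : C1 f -> Cm f. Proof. by move=> [[a _] [b _]]; split. Qed.

Lemma C1P f : C1 f <-> Cm f /\ L1 (fun z => normc (f z)).
Proof.
split=> [fC|[fm fn]].
  split; first exact: C1_Cm.
  have := L1D (L1_norm fC.1) (L1_norm fC.2).
  apply: L1_le; first by apply: Tm_normc; exact: C1_Cm.
  by apply: aeTW => z _; rewrite ger0_norm ?normc_ge0// normc_le_ReIm.
split; (apply: L1_le fn; [by case: fm|]).
  by apply: aeTW => z _; exact: ler_Re_normc.
by apply: aeTW => z _; exact: ler_Im_normc.
Qed.

Lemma C1n f : C1 f -> L1 (fun z => normc (f z)). Proof. by move=> /C1P[]. Qed.

Lemma C1_ext f g : (forall z, normc z = 1 -> f z = g z) -> C1 f -> C1 g.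
Proof.
move=> H [a b]; split; [apply: L1_ext a|apply: L1_ext b] => z z1; by rewrite H.
Qed.

Lemma C1_cst (c : C) : C1 (fun=> c).
Proof. by split; exact: L1_cst. Qed.

Lemma C1D f g : C1 f -> C1 g -> C1 (fun z => f z + g z).
Proof.
move=> [a b] [c d]; split.
  by apply: L1_ext (L1D a c) => z _; rewrite Re_D.
by apply: L1_ext (L1D b d) => z _; rewrite Im_D.
Qed.

Lemma C1_le f (g : C -> R) : Cm f -> aeT (fun z => normc (f z) <= g z) -> L1 g -> C1 f.
Proof.
move=> fm fg gL; apply/C1P; split => //; apply: L1_le gL; first exact: Tm_normc.
by apply: aeT_mono fg => z _; rewrite ger0_norm ?normc_ge0.
Qed.

Lemma C1_bdd f g (M : R) : Cm g -> aeT (fun z => normc (g z) <= M) -> C1 f ->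
  C1 (fun z => g z * f z).
Proof.
move=> gm gM fC; apply: C1_le (L1Z M (C1n fC)); first exact: CmM (C1_Cm fC).
by apply: aeT_mono gM => z _ H; rewrite normcM ler_wpM2r ?normc_ge0.
Qed.

Lemma C1Z (c : C) f : C1 f -> C1 (fun z => c * f z).
Proof. by apply: (@C1_bdd _ _ (normc c)); [exact: Cm_cst|exact: aeTW]. Qed.

Lemma C1_expz f (s : int) : C1 f -> C1 (fun z => f z * z ^ s).
Proof.
move=> fC; have := @C1_bdd f (fun z => z ^ s) 1 (Cm_expz s).
have H : aeT (fun z : C => normc (z ^ s) <= 1).
  by apply: aeTW => z z1; rewrite normc_expz.
by move=> /(_ H fC); apply: C1_ext => z _; rewrite mulrC.
Qed.

Lemma C1_sum (J : Type) (r : seq J) (P : pred J) (F : J -> C -> C) :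
  (forall j, C1 (F j)) -> C1 (fun z => \sum_(j <- r | P j) F j z).
Proof.
move=> mF; elim: r => [|j r IH].
  by apply: C1_ext (C1_cst 0) => z _; rewrite big_nil.
have : C1 (fun z => (if P j then F j z else 0) + \sum_(j <- r | P j) F j z).
  by apply: C1D => //; case: (P j) => //; exact: C1_cst.
by apply: C1_ext => z _; rewrite big_cons; case: ifP; rewrite ?add0r.
Qed.

Lemma TintE f : Tint f = Complex (mean (fun z => complex.Re (f z))) (mean (fun z => complex.Im (f z))).
Proof. by []. Qed.

Lemma Tint_ext f g : (forall z, normc z = 1 -> f z = g z) -> Tint f = Tint g.
Proof. by move=> H; rewrite !TintE; congr Complex; apply: mean_ext => z z1; rewrite H. Qed.

Lemma TintD f g : C1 f -> C1 g -> Tint (fun z => f z + g z) = Tint f + Tint g.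
Proof.
move=> [a b] [c d]; rewrite !TintE; apply/eqP; rewrite eq_complex /= -!mean_D//.
by apply/andP; split; apply/eqP/mean_ext => z _; rewrite (Re_D, Im_D).
Qed.

Lemma TintZ (c : C) f : C1 f -> Tint (fun z => c * f z) = c * Tint f.
Proof.
move=> [a b]; rewrite !TintE; case: c => x y; apply/eqP; rewrite eq_complex /= -!mean_Z//.
apply/andP; split; apply/eqP.
  by rewrite -mean_B; [apply: mean_ext => z _; rewrite Re_M|exact: L1Z|exact: L1Z].
rewrite -mean_D; [apply: mean_ext => z _; rewrite Im_M|exact: L1Z|exact: L1Z].
by [].
Qed.

Lemma TintJ f : C1 f -> Tint (fun z => conjc (f z)) = conjc (Tint f).
Proof.
move=> [a b]; rewrite !TintE; apply/eqP; rewrite eq_complex /= -mean_N//.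
by apply/andP; split; apply/eqP/mean_ext => z _; rewrite (Re_J, Im_J).
Qed.

Lemma Tint_cst (c : C) : Tint (fun=> c) = c.
Proof. by rewrite TintE !mean_cst; case: c. Qed.

Lemma TintB f g : C1 f -> C1 g -> Tint (fun z => f z - g z) = Tint f - Tint g.
Proof.
move=> a b; rewrite -mulN1r -TintZ// -TintD//; last exact: C1Z.
by apply: Tint_ext => z _; rewrite mulN1r.
Qed.

Lemma Tint_sum (J : Type) (r : seq J) (P : pred J) (F : J -> C -> C) :
  (forall j, C1 (F j)) ->
  Tint (fun z => \sum_(j <- r | P j) F j z) = \sum_(j <- r | P j) Tint (F j).
Proof.
move=> mF; elim: r => [|j r IH].
  by rewrite big_nil -[RHS](Tint_cst 0); apply: Tint_ext => z _; rewrite big_nil.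
rewrite big_cons -IH.
case: (boolP (P j)) => Pj; last first.
  by apply: Tint_ext => z _; rewrite big_cons (negbTE Pj).
rewrite -TintD//; last exact: C1_sum.
by apply: Tint_ext => z _; rewrite big_cons Pj.
Qed.

Lemma Tint_ae_eq f g : Cm f -> Cm g -> aeT (fun z => f z = g z) -> Tint f = Tint g.
Proof.
move=> [a b] [c d] H; rewrite !TintE; congr Complex; apply: mean_ae_eq => //.
  by apply: aeT_mono H => z _ ->.
by apply: aeT_mono H => z _ ->.
Qed.

Lemma Re_Tint f : complex.Re (Tint f) = mean (fun z => complex.Re (f z)).
Proof. by []. Qed.

Lemma unimodular_mul (w : C) : exists c : C, normc c = 1 /\ c * w = (normc w)%:C%C.
Proof.
have [->|w0] := eqVneq w 0; first by exists 1; rewrite normc1 mul1r normc0.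
have nw : normc w != 0 by rewrite normc_eq0.
exists (conjc w * ((normc w)^-1)%:C%C); split.
  by rewrite normcM normcJ normcR ger0_norm ?invr_ge0 ?normc_ge0// mulfV.
rewrite mulrAC (mulrC _ w) mulcJ -rmorphM /=; congr (_%:C)%C.
by rewrite expr2 mulfK.
Qed.

(** A unimodular factor turns the integral into its modulus, after which only real parts are
    compared. *)
Lemma normc_Tint_le f : C1 f -> normc (Tint f) <= mean (fun z => normc (f z)).
Proof.
move=> fC; have [c [c1 cE]] := unimodular_mul (Tint f).
have -> : normc (Tint f) = complex.Re (Tint (fun z => c * f z)) by rewrite TintZ// cE.
rewrite Re_Tint; apply: mean_le; first exact: (C1Z c fC).1.
  exact: C1n.
apply: aeTW => z _; apply: le_trans (ler_norm _) _.
by apply: le_trans (ler_Re_normc _) _; rewrite normcM c1 mul1r.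
Qed.

Lemma inLp1P f : inLp 1 f <-> C1 f.
Proof.
have E : (fun t : R => (normc (f (expi t)) `^ 1)%:E) = (fun t => (normc (f (expi t)))%:E).
  by apply/funext => t; rewrite powRr1 ?normc_ge0.
split=> [[fm]|/C1P[fm fn]].
  rewrite E => H; apply/C1P; split => //; apply: L1_Tint_e => //.
    by move=> z; exact: normc_ge0.
  exact: Tm_normc.
split=> //; rewrite E (@Tint_e_L1 _ (fun z => normc (f z))) ?ltry// => z; exact: normc_ge0.
Qed.

Definition C2 f := Cm f /\ L1 (fun z => normc (f z) ^+ 2).

Lemma inLp2P f : inLp 2 f <-> C2 f.
Proof.
have E : (fun t : R => (normc (f (expi t)) `^ 2)%:E) = (fun t => (normc (f (expi t)) ^+ 2)%:E).
  by apply/funext => t; rewrite powR_mulrn ?normc_ge0.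
split=> [[fm]|[fm fn]].
  rewrite E => H; split => //.
  apply: (@L1_Tint_e _ (fun z => normc (f z) ^+ 2)) => //.
    by move=> z; exact: sqr_ge0.
  by apply: TmX; exact: Tm_normc.
split=> //; rewrite E (@Tint_e_L1 _ (fun z => normc (f z) ^+ 2)) ?ltry// => z; exact: sqr_ge0.
Qed.

Lemma C2_ext f g : (forall z, normc z = 1 -> f z = g z) -> C2 f -> C2 g.
Proof.
move=> H [a b]; split; [apply: Cm_ext a|apply: L1_ext b] => z z1; by rewrite H.
Qed.

Lemma C2M f g : C2 f -> C2 g -> C1 (fun z => f z * g z).
Proof.
move=> [fm fn] [gm gn]; apply: C1_le (L1D fn gn); first exact: CmM.
apply: aeTW => z _; rewrite normcM.
by nra.
Qed.

Lemma C2_le f (g : C -> R) : Cm f -> aeT (fun z => normc (f z) ^+ 2 <= g z) ->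
  L1 g -> C2 f.
Proof.
move=> fm fg gL; split => //; apply: L1_le gL; first by apply: TmX; exact: Tm_normc.
by apply: aeT_mono fg => z _; rewrite ger0_norm ?sqr_ge0.
Qed.

Lemma C2D f g : C2 f -> C2 g -> C2 (fun z => f z + g z).
Proof.
move=> [fm fn] [gm gn]; apply: C2_le (L1Z 2 (L1D fn gn)); first exact: CmD.
apply: aeTW => z _; apply: (@le_trans _ _ ((normc (f z) + normc (g z)) ^+ 2)).
  by rewrite ler_pXn2r ?nnegrE ?addr_ge0 ?normc_ge0 ?normcD.
have := sqr_ge0 (normc (f z) - normc (g z)); set a := normc (f z); set b := normc (g z) => H.
by rewrite -subr_ge0; apply: le_trans H _; rewrite le_eqVlt; apply/orP; left; apply/eqP; ring.
Qed.

Lemma C2_bdd f g (M : R) : Cm g -> aeT (fun z => normc (g z) <= M) -> C2 f ->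
  C2 (fun z => g z * f z).
Proof.
move=> gm gM [fm fn]; apply: C2_le (L1Z (M ^+ 2) fn); first exact: CmM.
apply: aeT_mono gM => z _ H; rewrite normcM exprMn ler_wpM2r ?sqr_ge0//.
by rewrite ler_pXn2r ?nnegrE ?normc_ge0// (le_trans (normc_ge0 _) H).
Qed.

Lemma C2Z (c : C) f : C2 f -> C2 (fun z => c * f z).
Proof. by apply: (@C2_bdd _ _ (normc c)); [exact: Cm_cst|exact: aeTW]. Qed.

Lemma C2_expz f (s : int) : C2 f -> C2 (fun z => z ^ s * f z).
Proof.
apply: (@C2_bdd _ _ 1); first exact: Cm_expz.
by apply: aeTW => z z1; rewrite normc_expz.
Qed.

Lemma C2_cst (c : C) : C2 (fun=> c).
Proof. by split; [exact: Cm_cst|exact: L1_cst]. Qed.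

Lemma C2J f : C2 f -> C2 (fun z => conjc (f z)).
Proof.
move=> [fm fn]; split; first exact: CmJ.
by apply: L1_ext fn => z _; rewrite normcJ.
Qed.

Lemma C2_C1 f : C2 f -> C1 f.
Proof. by move=> /C2M /(_ (C2_cst 1)); apply: C1_ext => z _; rewrite mulr1. Qed.

Lemma C2_sum (J : Type) (r : seq J) (P : pred J) (F : J -> C -> C) :
  (forall j, C2 (F j)) -> C2 (fun z => \sum_(j <- r | P j) F j z).
Proof.
move=> mF; elim: r => [|j r IH].
  by apply: C2_ext (C2_cst 0) => z _; rewrite big_nil.
have : C2 (fun z => (if P j then F j z else 0) + \sum_(j <- r | P j) F j z).
  by apply: C2D => //; case: (P j) => //; exact: C2_cst.
by apply: C2_ext => z _; rewrite big_cons; case: ifP; rewrite ?add0r.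
Qed.

End ComplexIntegral.

(** * Minimal elements of convex sets in Hilbert spaces *)

Section PreHilbert.
Context {R : realType} (V : lmodType R[i]).
Variables (D : V -> Prop) (ip : V -> V -> R).

Definition hnorm (x : V) : R := Num.sqrt (ip x x).

Definition hlim (u : nat -> V) (x : V) :=
  (fun n => hnorm (u n - x)) @ \oo --> (0 : R).

Definition hcauchy (u : nat -> V) := forall e : R, 0 < e ->
  exists N, forall a b, (N <= a)%N -> (N <= b)%N -> hnorm (u a - u b) < e.

(* [V] is a space of functions, not of classes modulo almost everywhere equality: [ip] is
   only semi-definite on the carrier [D] and takes junk values outside.  Over the complex
   scalars, [ip] is the real part of the Hermitian product. *)
Record hilbert : Prop := Hilbert {
  h_D0 : D 0;
  h_DD : forall x y, D x -> D y -> D (x + y);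
  h_DZ : forall c x, D x -> D (c *: x);
  h_ipDl : forall x y z, D x -> D y -> D z -> ip (x + y) z = ip x z + ip y z;
  h_ipZl : forall (a : R) x z, D x -> D z -> ip (a%:C%C *: x) z = a * ip x z;
  h_ipC : forall x y, D x -> D y -> ip x y = ip y x;
  h_ip_ge0 : forall x, D x -> 0 <= ip x x;
  h_complete : forall u, (forall n, D (u n)) -> hcauchy u ->
    exists2 x, D x & hlim u x }.

Hypothesis H : hilbert.
Let D0 := h_D0 H.
Let DD := h_DD H.
Let DZ := h_DZ H.

Lemma h_DN x : D x -> D (- x).
Proof. by move=> Dx; rewrite -scaleN1r; apply: DZ. Qed.

Lemma h_DB x y : D x -> D y -> D (x - y).
Proof. by move=> Dx Dy; apply: DD => //; exact: h_DN. Qed.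

Lemma h_ipDr x y z : D x -> D y -> D z -> ip z (x + y) = ip z x + ip z y.
Proof.
move=> Dx Dy Dz; rewrite (h_ipC H)//; last exact: DD.
by rewrite (h_ipDl H)// !(h_ipC H _ Dz).
Qed.

Lemma h_ipZr a x z : D x -> D z -> ip z (a%:C%C *: x) = a * ip z x.
Proof.
move=> Dx Dz; rewrite (h_ipC H)//; last exact: DZ.
by rewrite (h_ipZl H)// (h_ipC H).
Qed.

Lemma h_ipNl x z : D x -> D z -> ip (- x) z = - ip x z.
Proof.
move=> Dx Dz; rewrite -[RHS]mulN1r -(h_ipZl H)//; congr ip.
by rewrite rmorphN1 scaleN1r.
Qed.

Lemma h_ipNr x z : D x -> D z -> ip z (- x) = - ip z x.
Proof.
move=> Dx Dz; rewrite (h_ipC H)//; last exact: h_DN.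
by rewrite h_ipNl// (h_ipC H).
Qed.

Lemma h_ipBl x y z : D x -> D y -> D z -> ip (x - y) z = ip x z - ip y z.
Proof. by move=> *; rewrite (h_ipDl H) ?h_ipNl//; exact: h_DN. Qed.

Lemma h_ipBr x y z : D x -> D y -> D z -> ip z (x - y) = ip z x - ip z y.
Proof. by move=> *; rewrite h_ipDr ?h_ipNr//; exact: h_DN. Qed.

Lemma hnorm_ge0 x : 0 <= hnorm x. Proof. exact: sqrtr_ge0. Qed.

Lemma hnorm_sq x : D x -> hnorm x ^+ 2 = ip x x.
Proof. by move=> Dx; rewrite sqr_sqrtr// (h_ip_ge0 H). Qed.

Lemma h_ip_sqD x y : D x -> D y ->
  ip (x + y) (x + y) = ip x x + 2 * ip x y + ip y y.
Proof.
move=> Dx Dy; have Dxy := DD Dx Dy.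
by rewrite (h_ipDl H)// !h_ipDr// (h_ipC H Dy Dx); ring.
Qed.

Lemma h_CauchySchwarz x y : D x -> D y -> `|ip x y| <= hnorm x * hnorm y.
Proof.
move=> Dx Dy.
suff CS : ip x y ^+ 2 <= ip x x * ip y y.
  rewrite -(@ler_pXn2r _ 2) ?nnegrE ?mulr_ge0 ?hnorm_ge0//.
  by rewrite exprMn !hnorm_sq// real_normK ?num_real.
(* Two parameters give a homogeneous quadratic form, so nothing is divided by [ip y y], which may
   vanish for y nonzero. *)
have P (s t : R) : 0 <= s ^+ 2 * ip x x + 2 * (s * t) * ip x y + t ^+ 2 * ip y y.
  have := h_ip_ge0 H (DD (DZ s%:C%C Dx) (DZ t%:C%C Dy)).
  rewrite h_ip_sqD ?(h_ipZl H) ?h_ipZr//; do ?exact: DZ.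
  by move=> h; apply: le_trans h _; rewrite le_eqVlt; apply/orP; left; apply/eqP; ring.
have yy := h_ip_ge0 H Dy.
have xx := h_ip_ge0 H Dx.
have [y0|y0] := eqVneq (ip y y) 0.
  have [->|xy0] := eqVneq (ip x y) 0; first by rewrite expr0n/= mulr_ge0.
  (* This second parameter makes the form equal to -1. *)
  have := P 1 (- (ip x x + 1) / (2 * ip x y)); rewrite y0 mulr0 addr0.
  have -> : 1 ^+ 2 * ip x x + 2 * (1 * (- (ip x x + 1) / (2 * ip x y))) * ip x y = -1.
    by field.
  by rewrite ler0N1.
have yp : 0 < ip y y by rewrite lt_neqAle eq_sym y0.
have := P (ip y y) (- ip x y) => h.
rewrite -(ler_pM2l yp) -subr_ge0; apply: le_trans h _.
by rewrite le_eqVlt; apply/orP; left; apply/eqP; ring.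
Qed.

Lemma hnormD x y : D x -> D y -> hnorm (x + y) <= hnorm x + hnorm y.
Proof.
move=> Dx Dy; rewrite -(@ler_pXn2r _ 2) ?nnegrE ?addr_ge0 ?hnorm_ge0//.
rewrite hnorm_sq ?h_ip_sqD ?sqrrD ?hnorm_sq//; last exact: DD.
rewrite lerD2r lerD2l -(mulr_natl (hnorm x * hnorm y)) ler_pM2l//.
exact: le_trans (ler_norm _) (h_CauchySchwarz Dx Dy).
Qed.

Lemma hnormZ a x : D x -> hnorm (a%:C%C *: x) = `|a| * hnorm x.
Proof.
move=> Dx; rewrite /hnorm (h_ipZl H)// ?h_ipZr//; last exact: DZ.
by rewrite mulrA -expr2 sqrtrM ?sqr_ge0// sqrtr_sqr.
Qed.

Lemma hnormN x : D x -> hnorm (- x) = hnorm x.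
Proof. by move=> Dx; rewrite /hnorm h_ipNl ?h_ipNr ?opprK//; exact: h_DN. Qed.

Lemma hlimD u v x y : (forall n, D (u n)) -> (forall n, D (v n)) -> D x -> D y ->
  hlim u x -> hlim v y -> hlim (fun n => u n + v n) (x + y).
Proof.
move=> Du Dv Dx Dy ux vy.
apply: (@squeeze_cvgr _ _ _ _ (fun=> 0) (fun n => hnorm (u n - x) + hnorm (v n - y))).
- near=> n; rewrite hnorm_ge0/= opprD addrACA hnormD//; exact: h_DB.
- exact: cvg_cst.
- by rewrite -(addr0 0); exact: cvgD.
Unshelve. all: by end_near. Qed.

Lemma hlimZ (a : R) u x : (forall n, D (u n)) -> D x ->
  hlim u x -> hlim (fun n => a%:C%C *: u n) (a%:C%C *: x).
Proof.
move=> Du Dx ux; rewrite /hlim.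
rewrite (_ : (fun n => _) = (fun n => `|a| * hnorm (u n - x))).
  by rewrite -(mulr0 `|a|); apply: cvgM => //; exact: cvg_cst.
by apply/funext => n; rewrite -scalerBr hnormZ//; exact: h_DB.
Qed.

Lemma hnorm0 : hnorm 0 = 0.
Proof. by rewrite -(scale0r (0 : V)) -(rmorph0 (real_complex R)) hnormZ// normr0 mul0r. Qed.

Lemma hlim_cst x : hlim (fun=> x) x.
Proof. by rewrite /hlim subrr hnorm0; exact: cvg_cst. Qed.

Lemma hlim_hnorm u x : (forall n, D (u n)) -> D x -> hlim u x ->
  (fun n => hnorm (u n)) @ \oo --> hnorm x.
Proof.
move=> Du Dx ux.
apply: (@squeeze_cvgr _ _ _ _ (fun n => hnorm x - hnorm (u n - x))
  (fun n => hnorm x + hnorm (u n - x))).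
- near=> n; have Dux : D (u n - x) by exact: h_DB.
  have E : u n = x + (u n - x) by rewrite addrC subrK.
  rewrite lerBlDr {3}E hnormD// andbT.
  have E' : x = u n + - (u n - x) by rewrite opprB addrC subrK.
  by rewrite {1}E' (le_trans (hnormD _ _)) ?hnormN//; exact: h_DN.
- by rewrite -[X in _ --> X]subr0; apply: cvgB => //; exact: cvg_cst.
- by rewrite -[X in _ --> X]addr0; apply: cvgD => //; exact: cvg_cst.
Unshelve. all: by end_near. Qed.

Lemma hlim_ip u x y : (forall n, D (u n)) -> D x -> D y -> hlim u x ->
  (fun n => ip (u n) y) @ \oo --> ip x y.
Proof.
move=> Du Dx Dy ux.
suff : (fun n => ip (u n) y - ip x y) @ \oo --> (0 : R).
  move=> h; have : (fun n => (ip (u n) y - ip x y) + ip x y) @ \oo --> 0 + ip x y.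
    by apply: cvgD => //; exact: cvg_cst.
  by rewrite add0r; under eq_fun do rewrite subrK.
apply: (@squeeze_cvgr _ _ _ _ (fun n => - (hnorm (u n - x) * hnorm y))
  (fun n => hnorm (u n - x) * hnorm y)).
- near=> n; rewrite -ler_norml -h_ipBl//; apply: h_CauchySchwarz => //; exact: h_DB.
- by rewrite -oppr0 -(mul0r (hnorm y)); apply: cvgN; apply: cvgM => //; exact: cvg_cst.
- by rewrite -(mul0r (hnorm y)); apply: cvgM => //; exact: cvg_cst.
Unshelve. all: by end_near. Qed.

(* Near-minimal vectors of a decreasing sequence of convex sets are Cauchy by the
   parallelogram identity. *)
Lemma nested_convex (K : nat -> V -> Prop) (M : R) :
  (forall n x, K n x -> D x) ->
  (forall m n x, (m <= n)%N -> K n x -> K m x) ->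
  (forall n x y, K n x -> K n y -> K n ((2^-1)%:C%C *: (x + y))) ->
  (forall n, exists2 x, K n x & ip x x <= M) ->
  exists u x, [/\ forall n, K n (u n), D x, hlim u x &
    forall n y, K n y -> ip (u n) (u n) <= ip y y + n.+1%:R^-1].
Proof.
move=> KD Kd Kmid KM.
pose S n := [set ip x x | x in K n].
have S0 n : S n !=set0 by have [x Kx _] := KM n; exists (ip x x); exists x.
have Slb n : lbound (S n) 0 by move=> _ [x Kx <-]; exact: (h_ip_ge0 H (KD _ _ Kx)).
have Sinf n : has_inf (S n) by split => //; exists 0.
pose d n := inf (S n).
have dle n y : K n y -> d n <= ip y y.
  by move=> Ky; apply: (ge_inf (Sinf n).2); exists y.
have dnd m n : (m <= n)%N -> d m <= d n.
  by move=> mn; apply: lb_le_inf (S0 n) _ => _ [x Kx <-]; apply: dle; exact: Kd Kx.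
have dM n : d n <= M by have [x Kx xM] := KM n; exact: le_trans (dle _ _ Kx) xM.
have /choice[u uP] : forall n, exists x, K n x /\ ip x x <= d n + n.+1%:R^-1.
  move=> n; have n0 : 0 < n.+1%:R^-1 :> R by rewrite invr_gt0.
  have [_ [x Kx <-] ex] := inf_adherent n0 (Sinf n).
  by exists x; split => //; exact: ltW.
have Ku n : K n (u n) := (uP n).1.
have Du n : D (u n) := KD _ _ (Ku n).
have uc n m : (n <= m)%N ->
    ip (u n - u m) (u n - u m) <= 4 * n.+1%:R^-1 + 2 * (d m - d n).
  move=> nm.
  have mid := dle _ _ (Kmid n _ _ (Ku n) (Kd _ _ _ nm (Ku m))).
  have Duu : D (u n + u m) by exact: DD.
  rewrite (h_ipZl H) ?h_ipZr// in mid; last exact: DZ.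
  have pl : ip (u n - u m) (u n - u m) + ip (u n + u m) (u n + u m) =
      2 * ip (u n) (u n) + 2 * ip (u m) (u m).
    rewrite !h_ip_sqD ?h_ipNr ?h_ipNl//; do ?exact: h_DN; by ring.
  have [_ un] := uP n; have [_ um] := uP m.
  have : m.+1%:R^-1 <= n.+1%:R^-1 :> R by rewrite lef_pV2 ?posrE// ler_nat.
  move: un um pl mid; move: (n.+1%:R^-1) (m.+1%:R^-1) (ip _ _) (ip _ _) (ip _ _) (ip _ _) => p q.
  by move=> a1 a2 a3 a4; lra.
have uC : hcauchy u.
  move=> e e0.
  have supd : has_sup (range d).
    by split; [exists (d 0%N); exists 0%N|exists M => _ [n _ <-]].
  have e1 : 0 < e ^+ 2 / 8 by rewrite divr_gt0// exprn_gt0.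
  have [_ [N1 _ <-] N1P] := sup_adherent e1 supd.
  have [N2 N2P] : exists N2 : nat, N2.+1%:R^-1 < e ^+ 2 / 8.
    have [N _ NP] := near_infty_natSinv_lt (PosNum e1).
    by exists N; have /= := NP N (leqnn N).
  exists (maxn N1 N2).
  have key a b : (maxn N1 N2 <= a)%N -> (a <= b)%N -> hnorm (u a - u b) < e.
    rewrite geq_max => /andP[aN1 aN2] ab.
    rewrite -(@ltr_pXn2r _ 2) ?nnegrE ?hnorm_ge0 ?(ltW e0)//.
    rewrite hnorm_sq; last exact: h_DB.
    apply: le_lt_trans (uc _ _ ab) _.
    have dN1 := dnd _ _ aN1.
    have : d b <= sup (range d) by apply: (ub_le_sup supd.2); exists b.
    have : a.+1%:R^-1 <= N2.+1%:R^-1 :> R by rewrite lef_pV2 ?posrE// ler_nat.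
    have : 0 < e ^+ 2 by rewrite exprn_gt0.
    move: N1P N2P dN1; move: (a.+1%:R^-1) (N2.+1%:R^-1) (sup _) (e ^+ 2) => p q l e2.
    by lra.
  move=> a b aN bN; have [ab|/ltnW ba] := leqP a b; first exact: key.
  by rewrite -hnormN ?opprB; [exact: key|exact: h_DB].
have [x Dx ux] := h_complete H Du uC.
exists u, x; split => // n y Ky.
by apply: le_trans (uP n).2 _; rewrite lerD2r dle.
Qed.

(** K is not assumed closed, since it is later a translated sum of a subspace and a ball. The
    minimizer x is only a limit of points of K, but the variational inequality against points of K
    survives. *)
Lemma min_norm_variational (K : V -> Prop) :
  (forall x, K x -> D x) -> (exists x, K x) ->
  (forall (s : R) x y, 0 <= s <= 1 -> K x -> K y ->
     K ((1 - s)%:C%C *: x + s%:C%C *: y)) ->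
  exists u x, [/\ forall n, K (u n), D x, hlim u x &
    forall y, K y -> ip x x <= ip x y].
Proof.
move=> KD [x0 Kx0] Kc.
have [] := @nested_convex (fun=> K) (ip x0 x0).
- by move=> _; exact: KD.
- by [].
- move=> _ x y Kx Ky; rewrite scalerDr.
  have -> : (2^-1 : R)%:C%C *: x = (1 - 2^-1)%:C%C *: x by congr (_%:C%C *: _); field.
  by apply: Kc => //; lra.
- by move=> _; exists x0.
move=> u [x [Ku Dx ux umin]]; exists u, x; split => //.
have Du n : D (u n) := KD _ (Ku n).
have xmin y : K y -> ip x x <= ip y y.
  move=> Ky.
  have l1 : (fun n => hnorm (u n) ^+ 2) @ \oo --> hnorm x ^+ 2.
    by apply: cvgM; exact: hlim_hnorm.
  have l2 : (fun n => ip y y + n.+1%:R^-1) @ \oo --> ip y y + 0.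
    by apply: cvgD; [exact: cvg_cst|exact: cvg_harmonic].
  rewrite -hnorm_sq// -[leRHS]addr0; apply: (ler_cvg_to l1 l2).
  by near=> n; rewrite hnorm_sq//; exact: umin.
move=> y Ky; have Dy := KD _ Ky.
(* The segment from x to y need not lie in K; it is the limit of the segments from [u n] to y, which
   do. *)
have yx s : 0 <= s <= 1 -> ip x x <= ip ((1 - s)%:C%C *: x + s%:C%C *: y)
    ((1 - s)%:C%C *: x + s%:C%C *: y).
  move=> s01.
  have l : hlim (fun n => (1 - s)%:C%C *: u n + s%:C%C *: y) ((1 - s)%:C%C *: x + s%:C%C *: y).
    apply: hlimD; [by move=> n; exact: DZ|by move=> n; exact: DZ|exact: DZ|exact: DZ| |].
      exact: hlimZ.
    exact: hlim_cst.
  have l1 := hlim_hnorm _ _ l.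
  rewrite -!hnorm_sq//; last by apply: DD; exact: DZ.
  rewrite ler_pXn2r ?nnegrE ?hnorm_ge0//.
  apply: (ler_cvg_to (cvg_cst (hnorm x)) (l1 _ _)).
  - by move=> n; apply: DD; exact: DZ.
  - by apply: DD; exact: DZ.
  - near=> n; rewrite -(@ler_pXn2r _ 2) ?nnegrE ?hnorm_ge0//.
    rewrite !hnorm_sq//; last by apply: DD; exact: DZ.
    by apply: xmin; exact: Kc.
rewrite leNgt; apply/negP => h.
pose b := ip (y - x) (y - x).
have b0 : 0 <= b by apply: (h_ip_ge0 H); exact: h_DB.
have E s : ip ((1 - s)%:C%C *: x + s%:C%C *: y) ((1 - s)%:C%C *: x + s%:C%C *: y) =
    ip x x + 2 * s * (ip x y - ip x x) + s ^+ 2 * b.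
  have -> : (1 - s)%:C%C *: x + s%:C%C *: y = x + s%:C%C *: (y - x).
    by rewrite rmorphB scalerBl scale1r scalerBr addrA addrAC.
  rewrite h_ip_sqD//; do ?[exact: DZ|exact: h_DB|apply: DZ; exact: h_DB].
  rewrite (h_ipZl H) ?h_ipZr//; do ?[exact: h_DB|apply: DZ; exact: h_DB].
  rewrite (h_ipBr Dy Dx Dx).
  by rewrite -/b; ring.
pose c := ip x x - ip x y.
have c0 : 0 < c by rewrite subr_gt0.
(* Along the segment the squared norm is |x|^2 - 2 s c + s^2 b, which is below |x|^2 once s b < 2 c;
   this s satisfies s (b + 1) <= c. *)
pose s := Num.min 1 (c / (b + 1)).
have s0 : 0 < s by rewrite lt_min ltr01 divr_gt0// ltr_wpDl.
have s1 : s <= 1 by rewrite ge_min lexx.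
have sb : s * (b + 1) <= c.
  by rewrite -ler_pdivlMr ?ltr_wpDl// ge_min lexx orbT.
have := yx s; rewrite s1 (ltW s0) => /(_ isT); rewrite E.
have -> : ip x y - ip x x = - c by rewrite opprB.
move=> h2; have : s * (2 * c) <= s * (s * b) by nra.
by rewrite ler_pM2l//; nra.
Unshelve. all: by end_near. Qed.

Record closed_subspace (W : V -> Prop) : Prop := ClosedSubspace {
  cs_D : forall x, W x -> D x;
  cs_0 : W 0;
  cs_add : forall x y, W x -> W y -> W (x + y);
  cs_scale : forall c x, W x -> W (c *: x);
  cs_lim : forall u x, (forall n, W (u n)) -> D x -> hlim u x -> W x }.

(** The element of least norm in the affine set y - W is y minus its projection. *)
Lemma orthogonal_projection (W : V -> Prop) y : closed_subspace W -> D y ->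
  exists2 p, W p & forall w, W w -> ip (y - p) w = 0.
Proof.
move=> cW Dy; pose K x := W (y - x).
have WN x : W x -> W (- x) by move=> Wx; rewrite -scaleN1r; exact: (cs_scale cW).
have KD x : K x -> D x.
  by move=> /(cs_D cW) Kx; rewrite -(subKr y x); exact: h_DB.
have [] := @min_norm_variational K KD.
- by exists y; rewrite /K subrr; exact: cs_0.
- move=> s u v _ Ku Kv; rewrite /K.
  have -> : y - ((1 - s)%:C%C *: u + s%:C%C *: v) =
      (1 - s)%:C%C *: (y - u) + s%:C%C *: (y - v).
    rewrite !scalerBr addrACA -scalerDl -rmorphD subrK rmorph1 scale1r.
    by rewrite opprD.
  by apply: (cs_add cW); exact: (cs_scale cW).
move=> u [x [Ku Dx ux xv]].
have Kx : K x.
  have Ku' : forall n, W ((fun n => y - u n) n) := Ku.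
  apply: (cs_lim cW Ku'); first exact: h_DB.
  apply: hlimD; [by []|by move=> n; apply: h_DN; exact: KD|by []|exact: h_DN|exact: hlim_cst|].
  rewrite /hlim; move: ux; rewrite /hlim; apply: cvg_trans; apply: near_eq_cvg.
  by near=> n; rewrite -opprD hnormN//; apply: h_DB => //; exact: KD.
exists (y - x) => // w Ww; rewrite subKr.
have Dw := cs_D cW Ww.
(* Moving from x along w in both directions turns the variational inequality into an equality. *)
have P (t : R) : 0 <= t * ip x w.
  have : K (x + t%:C%C *: w).
    rewrite /K opprD addrA; apply: (cs_add cW) => //.
    by apply: WN; exact: (cs_scale cW).
  move=> /xv; rewrite h_ipDr//; last exact: DZ.
  by rewrite lerDl h_ipZr.
have := P 1; have := P (-1); rewrite mulN1r mul1r oppr_ge0 => a b.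
by apply/eqP; rewrite eq_le a b.
Unshelve. all: by end_near. Qed.

End PreHilbert.

(** * Square integrable matrix functions *)

Section L2Complete.
Context {R : realType}.
Local Notation C := (R[i]).

Lemma integral_E (f : C -> R) : L1 f ->
  (\int[@mu R]_(t in @I02 R) (f (expi t))%:E = (2 * pi * mean f)%:E)%E.
Proof.
move=> [_ If]; rewrite /mean mulrA mulfV ?gt_eqF ?pi2_gt0// mul1r.
exact/esym/fineK/(integrable_fin_num mI02 If).
Qed.

(** By monotone convergence the limit has a finite integral, hence is finite almost everywhere. *)
Lemma ae_bounded_monotone (S : nat -> C -> R) (c : R) :
  (forall N, L1 (S N)) -> (forall N z, 0 <= S N z) ->
  (forall N z, S N z <= S N.+1 z) -> (forall N, mean (S N) <= c) ->
  aeT (fun z => exists M, forall N, S N z <= M).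
Proof.
move=> SL S0 Snd Sc.
pose f N (t : measurableTypeR R) := (S N (expi t))%:E.
have nd t : {homo (f^~ t) : n m / (n <= m)%N >-> (n <= m)%E}.
  apply/nondecreasing_seqP => N; rewrite lee_fin; exact: Snd.
have mf N : measurable_fun (@I02 R : set (measurableTypeR R)) (f N) by exact: Tm_E (L1m (SL N)).
have E := monotone_convergence (@mu R) mI02 mf
  (fun N t _ => (S0 N (expi t) : (0 <= f N t)%E)) (fun t _ => nd t).
have Gle : (\int[@mu R]_(t in @I02 R) limn (f^~ t) <= (2 * pi * c)%:E)%E.
  rewrite E; apply: lime_le.
    apply: ereal_nondecreasing_is_cvgn; apply/nondecreasing_seqP => N.
    by rewrite !integral_E// lee_fin ler_pM2l ?pi2_gt0// mean_le//; exact: aeTW.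
  by near=> N; rewrite /f integral_E// lee_fin ler_pM2l ?pi2_gt0.
have supE t : limn (f^~ t) = ereal_sup (range (f^~ t)).
  by apply/cvg_lim => //; exact: ereal_nondecreasing_cvgn.
have fG N t : (f N t <= limn (f^~ t))%E.
  by rewrite supE; apply: ereal_sup_ubound; exists N.
have mG : measurable_fun (@I02 R : set (measurableTypeR R)) (fun t => limn (f^~ t)).
  apply: (emeasurable_fun_cvg f) => // t _; rewrite supE.
  exact: ereal_nondecreasing_cvgn.
have GI : (@mu R).-integrable (@I02 R) (fun t => limn (f^~ t)).
  apply/integrableP; split => //.
  rewrite (eq_integral (fun t : measurableTypeR R => limn (f^~ t))); last first.
    by move=> t _; rewrite gee0_abs// (le_trans _ (fG 0%N t))// lee_fin.
  by apply: le_lt_trans Gle _; rewrite ltry.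
apply: (ae_muS _ (integrable_ae mI02 GI)) => t H tI.
have := H tI => Gf; exists (fine (limn (f^~ t))) => N.
by rewrite -lee_fin fineK//; exact: fG.
Unshelve. all: by end_near. Qed.

Lemma fatou_I (f : nat -> C -> R) (g : C -> R) (c : R) :
  (forall n, L1 (f n)) -> (forall n z, 0 <= f n z) -> Tm g ->
  (forall z, 0 <= g z) -> aeT (fun z => (fun n => f n z) @ \oo --> g z) ->
  (forall n, mean (f n) <= c) -> L1 g /\ mean g <= c.
Proof.
move=> fL f0 mg g0 fg fc.
pose F n (t : measurableTypeR R) := (f n (expi t))%:E.
have mF n : measurable_fun (@I02 R : set (measurableTypeR R)) (F n) by exact: Tm_E (L1m (fL n)).
have Fa := fatou (@mu R) mI02 mF (fun n t _ => (f0 n (expi t) : (0 <= F n t)%E)).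
have mlim : measurable_fun (@I02 R : set (measurableTypeR R)) (fun t => limn_einf (F^~ t)).
  rewrite (_ : (fun t => _) = (fun t => - limn_esup (fun n => - F n t))%E).
    apply: measurableT_comp => //.
    apply: measurable_fun_limn_esup => n.
    by apply: measurableT_comp => //; exact: mF.
  by apply/funext => t; rewrite -limn_einfN; congr limn_einf; apply/funext => n; rewrite /comp oppeK.
have gE : (\int[@mu R]_(t in @I02 R) (g (expi t))%:E =
    \int[@mu R]_(t in @I02 R) limn_einf (F^~ t))%E.
  apply: ae_eq_integral; [exact: mI02|exact: Tm_E|exact: mlim|].
  apply: (ae_muS _ fg) => t H tI.
  have /cvg_limn_einf_sup[-> _]// : (F^~ t) @ \oo --> (g (expi t))%:E.
  by apply: cvg_EFin; [near=> n|exact: H tI].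
have gc : (\int[@mu R]_(t in @I02 R) (g (expi t))%:E <= (2 * pi * c)%:E)%E.
  rewrite gE; apply: le_trans Fa _.
  rewrite limn_einf_lim; apply: lime_le; first exact: is_cvg_einfs.
  near=> n; apply: (@le_trans _ _ (\int[@mu R]_(t in @I02 R) F n t)%E).
    by apply: ereal_inf_lbound; exists n => /=.
  by rewrite integral_E// lee_fin ler_pM2l ?pi2_gt0.
have gL : L1 g.
  split => //; apply/integrableP; split; first exact: Tm_E.
  rewrite (eq_integral (fun t : measurableTypeR R => (g (expi t))%:E)); last first.
    by move=> t _; rewrite abse_EFin ger0_norm.
  by apply: le_lt_trans gc _; rewrite ltry.
split => //; move: gc; rewrite integral_E// lee_fin ler_pM2l ?pi2_gt0//.
Unshelve. all: by end_near. Qed.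

Lemma geometric_increments_cvg (x : nat -> R) (c : R) :
  (forall n, `|x n.+1 - x n| <= c * 2^-1 ^+ n) -> cvgn x.
Proof.
move=> xc.
have : cvgn (series (telescope x)).
  apply: normed_cvg; apply: (@series_le_cvg _ _ (geometric c 2^-1)).
  - by move=> n; exact: normr_ge0.
  - by move=> n; exact: le_trans (xc n).
  - by move=> n; exact: xc.
  - by apply: is_cvg_geometric_series; rewrite ger0_norm// invf_lt1 ?ltr1n.
rewrite telescopeK => h.
rewrite (_ : x = (fun n => (x n - x 0%N) + x 0%N)).
  by apply: is_cvgD => //; exact: is_cvg_cst.
by apply/funext => n; rewrite subrK.
Qed.

Lemma ae_limit (x : nat -> C -> R) : (forall n, Tm (x n)) ->
  aeT (fun z => exists c, forall n, `|x n.+1 z - x n z| <= c * 2^-1 ^+ n) ->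
  exists2 g, Tm g & aeT (fun z => (fun n => x n z) @ \oo --> g z).
Proof.
(* The upper limit is measurable whether or not the sequence converges, so the exceptional null set
   needs no separate treatment. *)
move=> mx xc; exists (fun z => fine (limn_esup (fun n => (x n z)%:E))).
  apply: measurableT_comp; first exact: fine_measurable.
  apply: measurable_fun_limn_esup => n; exact: (measurableT_comp (@EFin_measurable R setT) (mx n)).
apply: aeT_mono xc => z _ [c /geometric_increments_cvg xz].
have l : (fun n => (x n z)%:E) @ \oo --> (limn (fun n => x n z))%:E.
  by apply: cvg_EFin; [near=> n|exact: xz].
by have [_ ->] := cvg_limn_einf_sup l.
Unshelve. all: by end_near. Qed.

Lemma cvg_finsum (J : Type) (r : seq J) (f : J -> nat -> R) (l : J -> R) :
  (forall j, (fun n => f j n) @ \oo --> l j) ->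
  (fun n => \sum_(j <- r) f j n) @ \oo --> \sum_(j <- r) l j.
Proof.
move=> fl; elim: r => [|j r IH].
  by rewrite big_nil; under eq_fun do rewrite big_nil; exact: cvg_cst.
by rewrite big_cons; under eq_fun do rewrite big_cons; exact: cvgD.
Qed.

Lemma cvg_sqr (f : nat -> R) (l : R) : f @ \oo --> l -> (fun n => f n ^+ 2) @ \oo --> l ^+ 2.
Proof. by move=> fl; exact: (cvgM fl fl). Qed.

Variables m k : nat.
Local Notation V := (C -> 'M[C]_(m, k)).

Definition L2M (F : V) := forall i j, C2 (fun z => F z i j).

Lemma LpM2P (F : mxfun m k) : LpM 2 F <-> L2M F.
Proof. by split=> H i j; apply/inLp2P; exact: H. Qed.

Definition rip (A B : 'M[C]_(m, k)) : R :=
  \sum_i \sum_j complex.Re (A i j * conjc (B i j)).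

Definition L2ip (F G : V) : R := mean (fun z => rip (F z) (G z)).

Lemma rip_frob2 A : rip A A = frob2 A.
Proof. by apply: eq_bigr => i _; apply: eq_bigr => j _; rewrite mulcJ. Qed.

Lemma rip_L1 (F G : V) : L2M F -> L2M G -> L1 (fun z => rip (F z) (G z)).
Proof.
move=> FL GL; apply: L1_sum => i; apply: L1_sum => j.
by have [] := C2M (FL i j) (C2J (GL i j)).
Qed.

Lemma L2M_frob2 (F : V) : L2M F -> L1 (fun z => frob2 (F z)).
Proof. by move=> FL; apply: L1_sum => i; apply: L1_sum => j; have [] := FL i j. Qed.

Lemma L2MD (F G : V) : L2M F -> L2M G -> L2M (F + G).
Proof. by move=> a b i j; apply: C2_ext (C2D (a i j) (b i j)) => z _; rewrite mxE. Qed.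

Lemma L2MZ c (F : V) : L2M F -> L2M (c *: F).
Proof. by move=> a i j; apply: C2_ext (C2Z c (a i j)) => z _; rewrite mxE. Qed.

Lemma L2M0 : L2M 0.
Proof. by move=> i j; apply: C2_ext (C2_cst 0) => z _; rewrite mxE. Qed.

Lemma L2M_le (F : V) (g : C -> R) : (forall i j, Cm (fun z => F z i j)) ->
  aeT (fun z => frob2 (F z) <= g z) -> L1 g -> L2M F.
Proof.
move=> mF Fg gL i j; apply: C2_le (mF i j) _ gL.
apply: aeT_mono Fg => z _; apply: le_trans.
rewrite /frob2 (bigD1 i)//= (bigD1 j)//= -addrA lerDl.
by rewrite addr_ge0// sumr_ge0// => ? _; rewrite ?sumr_ge0// => *; exact: sqr_ge0.
Qed.

(** Riesz-Fischer: a rapidly Cauchy subsequence converges almost everywhere, and Fatou's lemma turns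
    this into convergence of the whole sequence in norm. *)
Lemma L2_complete (u : nat -> V) : (forall n, L2M (u n)) -> hcauchy L2ip u ->
  exists2 x, L2M x & hlim L2ip u x.
Proof.
move=> uL uC.
have frobE a b : hnorm L2ip (u a - u b) ^+ 2 = mean (fun z => frob2 (u a z - u b z)).
  rewrite /hnorm /L2ip sqr_sqrtr.
    by apply: mean_ext => z _; rewrite rip_frob2.
  by apply: mean_ge0 => z; rewrite rip_frob2 frob2_ge0.
have /choice[N NP] : forall n, exists N, forall a b, (N <= a)%N -> (N <= b)%N ->
    hnorm L2ip (u a - u b) < 4^-1 ^+ n.
  by move=> n; apply: uC; rewrite exprn_gt0// invr_gt0.
(* The partial sum makes [phi] monotone and at least [N n]; the added n makes it unbounded. *)
pose phi n := (\sum_(i < n.+1) N i + n)%N.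
have phiN n : (N n <= phi n)%N by rewrite /phi big_ord_recr/= -addnA addnCA leq_addr.
have phiS n : (phi n <= phi n.+1)%N.
  by rewrite /phi leq_add// [leqRHS]big_ord_recr/= leq_addr.
have phi_ge n : (n <= phi n)%N by exact: leq_addl.
pose a n z := frob2 (u (phi n.+1) z - u (phi n) z).
have aL n : L1 (a n).
  by apply: L1_ext (L2M_frob2 (L2MD (uL (phi n.+1)) (L2MZ (-1) (uL (phi n))))) => z _; rewrite /a scaleN1r.
have aI n : mean (a n) <= (4^-1 ^+ n) ^+ 2.
  rewrite -frobE; have := NP n (phi n.+1) (phi n) (leq_trans (phiN n) (phiS n)) (phiN n).
  by move=> /ltW h; rewrite ler_pXn2r ?nnegrE ?sqrtr_ge0 ?exprn_ge0 ?invr_ge0.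
(* The mean of [a i] is at most 16^-i, so the weights 4^i still leave a summable series; where its
   sum is bounded by M, the entries of the i-th increment are at most sqrt(M) 2^-i. *)
pose S n z := \sum_(i < n) (4 ^+ i) * a i z.
have a0 n z : 0 <= a n z by exact: frob2_ge0.
have aeS : aeT (fun z => exists M, forall n, S n z <= M).
  apply: (@ae_bounded_monotone S 2).
  - by move=> n; apply: L1_sum => i; exact: L1Z.
  - by move=> n z; apply: sumr_ge0 => i _; rewrite mulr_ge0// exprn_ge0.
  - by move=> n z; rewrite /S big_ord_recr/= lerDl mulr_ge0// exprn_ge0.
  - move=> n; rewrite /S mean_sum => [|i]; last exact: L1Z.
    apply: (@le_trans _ _ (\sum_(i < n) 4^-1 ^+ i)).
      apply: ler_sum => i _; rewrite mean_Z//.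
      apply: le_trans (ler_wpM2l _ (aI i)) _; first by rewrite exprn_ge0.
      by rewrite expr2 mulrA -exprMn mulfV// expr1n mul1r.
    suff : \sum_(i < n) 4^-1 ^+ i <= 2 - 2 * 4^-1 ^+ n :> R.
      have : 0 <= 4^-1 ^+ n :> R by rewrite exprn_ge0// invr_ge0.
      move: (4^-1 ^+ n) (\sum_(i < n) _) => p q; lra.
    elim: n => [|n IH]; first by rewrite big_ord0 expr0 mulr1 subrr.
    rewrite big_ord_recr/= exprS.
    have : 0 <= 4^-1 ^+ n :> R by rewrite exprn_ge0// invr_ge0.
    move: IH; move: (4^-1 ^+ n) (\sum_(i < n) _) => p q; lra.
have aek : aeT (fun z => exists c, forall n i j,
    normc (u (phi n.+1) z i j - u (phi n) z i j) <= c * 2^-1 ^+ n).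
  apply: aeT_mono aeS => z _ [M SM]; exists (Num.sqrt M) => n i j.
  have M0 : 0 <= M by apply: le_trans (SM 0%N); rewrite /S big_ord0.
  rewrite -(@ler_pXn2r _ 2) ?nnegrE ?normc_ge0 ?mulr_ge0 ?sqrtr_ge0 ?exprn_ge0 ?invr_ge0//.
  rewrite exprMn (sqr_sqrtr M0) -exprM mulnC exprM [2^-1 ^+ 2]expr2 -invfM -natrM.
  have p4 : 0 < 4 ^+ n :> R by rewrite exprn_gt0.
  rewrite exprVn ler_pdivlMr// mulrC.
  apply: le_trans (SM n.+1); rewrite /S big_ord_recr/=.
  apply: ler_wpDl; first by apply: sumr_ge0 => l _; rewrite mulr_ge0// exprn_ge0.
  rewrite ler_pM2l// /a /frob2 (bigD1 i)//= (bigD1 j)//= !mxE -addrA lerDl.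
  by rewrite addr_ge0// sumr_ge0// => ? _; rewrite ?sumr_ge0// => *; exact: sqr_ge0.
have /choice[gr grP] : forall ij : 'I_m * 'I_k, exists g, Tm g /\
    aeT (fun z => (fun n => complex.Re (u (phi n) z ij.1 ij.2)) @ \oo --> g z).
  move=> ij; have [||g mg gP] := @ae_limit (fun n z => complex.Re (u (phi n) z ij.1 ij.2)).
  - by move=> n; have [[]] := uL (phi n) ij.1 ij.2.
  - apply: aeT_mono aek => z _ [c cP]; exists c => n; apply: le_trans (cP n ij.1 ij.2).
    by apply: le_trans (ler_Re_normc _); rewrite raddfB.
  by exists g.
have /choice[gi giP] : forall ij : 'I_m * 'I_k, exists g, Tm g /\
    aeT (fun z => (fun n => complex.Im (u (phi n) z ij.1 ij.2)) @ \oo --> g z).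
  move=> ij; have [||g mg gP] := @ae_limit (fun n z => complex.Im (u (phi n) z ij.1 ij.2)).
  - by move=> n; have [[]] := uL (phi n) ij.1 ij.2.
  - apply: aeT_mono aek => z _ [c cP]; exists c => n; apply: le_trans (cP n ij.1 ij.2).
    by apply: le_trans (ler_Im_normc _); rewrite raddfB.
  by exists g.
pose x : V := fun z => \matrix_(i, j) Complex (gr (i, j) z) (gi (i, j) z).
have mx i j : Cm (fun z => x z i j).
  split; [apply: Tm_ext (grP (i, j)).1|apply: Tm_ext (giP (i, j)).1];
  by move=> z _; rewrite mxE.
have aex : aeT (fun z => forall i j,
    (fun n => complex.Re (u (phi n) z i j)) @ \oo --> complex.Re (x z i j) /\
    (fun n => complex.Im (u (phi n) z i j)) @ \oo --> complex.Im (x z i j)).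
  have := aeT_and (aeT_forall (fun ij => (grP ij).2)) (aeT_forall (fun ij => (giP ij).2)).
  by apply: aeT_mono => z _ [h1 h2] i j; rewrite mxE /=; split; [exact: (h1 (i, j))|exact: (h2 (i, j))].
have cvgf p : aeT (fun z => (fun n => frob2 (u p z - u (phi n) z)) @ \oo --> frob2 (u p z - x z)).
  apply: aeT_mono aex => z _ h; rewrite /frob2.
  apply: cvg_finsum => i; apply: cvg_finsum => j.
  have [h1 h2] := h i j.
  have mB (A B : 'M[C]_(m, k)) : (A - B) i j = A i j - B i j by rewrite !mxE.
  rewrite mB normc_sq; under eq_fun do rewrite mB normc_sq.
  have e w : (complex.Re (u p z i j - w) = complex.Re (u p z i j) - complex.Re w) *
    (complex.Im (u p z i j - w) = complex.Im (u p z i j) - complex.Im w) by rewrite !raddfB.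
  rewrite !e; under eq_fun do rewrite !e.
  by apply: cvgD; apply: cvg_sqr; (apply: cvgB; [exact: cvg_cst|]).
(* For fixed p, Fatou's lemma along the subsequence turns the Cauchy estimate into one for the
   distance from [u p] to x. *)
have lim e : 0 < e -> exists P, forall p, (P <= p)%N ->
    L1 (fun z => frob2 (u p z - x z)) /\ mean (fun z => frob2 (u p z - x z)) <= e ^+ 2.
  move=> e0; have [P PP] := uC e e0; exists P => p Pp.
  apply: (@fatou_I (fun n z => frob2 (u p z - u (phi (n + P)%N) z))).
  - by move=> n; apply: L1_ext (L2M_frob2 (L2MD (uL p) (L2MZ (-1) (uL (phi (n + P)%N))))) => z _; rewrite scaleN1r.
  - by move=> n z; exact: frob2_ge0.
  - apply: Tm_sum => i; apply: Tm_sum => j; apply: TmX; apply: Tm_normc.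
    have := CmD (uL p i j).1 (CmM (Cm_cst (-1)) (mx i j)).
    by apply: Cm_ext => z _; rewrite !mxE mulN1r.
  - by move=> z; exact: frob2_ge0.
  - apply: aeT_mono (cvgf p) => z _; rewrite -(cvg_shiftn P).
    by [].
  - move=> n; rewrite -frobE; have := PP p (phi (n + P)%N) Pp.
    move=> /(_ (leq_trans (leq_addl n P) (phi_ge _)))/ltW h.
    by rewrite ler_pXn2r ?nnegrE ?sqrtr_ge0 ?(ltW e0).
have xL : L2M x.
  have [P PP] := lim 1 ltr01; have [L _] := PP P (leqnn P).
  have dL : L2M (u P - x).
    apply: (L2M_le _ _ L); last exact: aeTW.
    move=> i j; have := CmD (uL P i j).1 (CmM (Cm_cst (-1)) (mx i j)).
    by apply: Cm_ext => z _; rewrite !mxE mulN1r.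
  have -> : x = u P + (-1) *: (u P - x) by rewrite scaleN1r opprB addrC subrK.
  by apply: L2MD => //; exact: L2MZ.
exists x => //.
apply/cvgrPdist_le => /= e e0; have [P PP] := lim e e0.
near=> p; rewrite sub0r normrN ger0_norm ?sqrtr_ge0//.
have [|_ h] := PP p; first by near: p; exact: nbhs_infty_ge.
rewrite -(@ler_pXn2r _ 2) ?nnegrE ?sqrtr_ge0 ?(ltW e0)//.
rewrite /hnorm /L2ip sqr_sqrtr.
  by apply: le_trans h; rewrite le_eqVlt; apply/orP; left; apply/eqP/mean_ext => z _; rewrite rip_frob2.
by apply: mean_ge0 => z; rewrite rip_frob2 frob2_ge0.
Unshelve. all: by end_near. Qed.

Lemma L2_hilbert : hilbert L2M L2ip.
Proof.
split.
- exact: L2M0.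
- exact: L2MD.
- exact: L2MZ.
- move=> x y z xL yL zL; rewrite /L2ip -mean_D; do ?exact: rip_L1.
  apply: mean_ext => w _; rewrite /rip -big_split; apply: eq_bigr => i _.
  rewrite -big_split; apply: eq_bigr => j _ /=.
  by rewrite mxE mulrDl Re_D.
- move=> a x z xL zL; rewrite /L2ip -mean_Z; last exact: rip_L1.
  apply: mean_ext => w _; rewrite /rip mulr_sumr; apply: eq_bigr => i _.
  rewrite mulr_sumr; apply: eq_bigr => j _.
  by rewrite mxE -mulrA Re_M /= mul0r subr0.
- move=> x y _ _; apply: mean_ext => w _; apply: eq_bigr => i _; apply: eq_bigr => j _.
  by rewrite -[RHS]Re_J rmorphM /= conjcK mulrC.
- by move=> x _; apply: mean_ge0 => z; rewrite rip_frob2 frob2_ge0.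
- exact: L2_complete.
Qed.

End L2Complete.

(** * Uniqueness of Fourier coefficients *)

Section FourierUniqueness.
Context {R : realType}.
Local Notation C := (R[i]).
Implicit Types (f p : C -> C).

Definition Fzero f := C1 f /\ forall m : int, fourier f m = 0.

(** Such functions form an algebra containing every z^s, hence all trigonometric polynomials, which
    thereby need no definition of their own. *)
Definition multiplier p := forall f, Fzero f -> Fzero (fun z => p z * f z).

Lemma Fzero_ext f g : (forall z, normc z = 1 -> f z = g z) -> Fzero f -> Fzero g.
Proof.
move=> H [fC f0]; split; first exact: C1_ext fC.
by move=> m; rewrite -(f0 m); apply: Tint_ext => z z1; rewrite H.
Qed.

Lemma multiplier_cst (c : C) : multiplier (fun=> c).
Proof.
move=> f [fC f0]; split; first exact: C1Z.
move=> m; rewrite -[RHS](mulr0 c) -(f0 m) -TintZ; last exact: C1_expz.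
by apply: Tint_ext => z _; rewrite mulrA.
Qed.

Lemma multiplierD p q : multiplier p -> multiplier q -> multiplier (fun z => p z + q z).
Proof.
move=> mp mq f fz; have [pC p0] := mp f fz; have [qC q0] := mq f fz; split.
  by apply: C1_ext (C1D pC qC) => z _; rewrite mulrDl.
move=> m; rewrite -[RHS](addr0 0) -{1}(p0 m) -(q0 m) -TintD; do ?exact: C1_expz.
by apply: Tint_ext => z _; rewrite !mulrDl.
Qed.

Lemma multiplierM p q : multiplier p -> multiplier q -> multiplier (fun z => p z * q z).
Proof.
move=> mp mq f fz; have := mp _ (mq f fz).
by apply: Fzero_ext => z _; rewrite mulrA.
Qed.

Lemma multiplierX p k : multiplier p -> multiplier (fun z => p z ^+ k).
Proof.
move=> mp; elim: k => [|k IH] f fz; first exact: multiplier_cst.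
by have := multiplierM mp IH fz; apply: Fzero_ext => z _; rewrite exprS.
Qed.

Lemma multiplier_expz (s : int) : multiplier (fun z => z ^ s).
Proof.
move=> f [fC f0]; split.
  by apply: C1_ext (C1_expz s fC) => z _; rewrite mulrC.
move=> m; rewrite -(f0 (m - s)); apply: Tint_ext => z z1.
by rewrite opprB expfzDr ?circ_neq0//; ring.
Qed.

(* On [0, 1] these polynomials tend to the indicator of [0, 1/2[ as n grows.  Composed with
   the trigonometric polynomial [arcpoly], they approximate the indicator of an arc. *)
Definition bump (n : nat) (y : R) := (1 - y ^+ n) ^+ (2 ^ n).

Lemma bump01 n y : 0 <= y <= 1 -> 0 <= bump n y <= 1.
Proof.
move=> /andP[y0 y1]; have y1n : y ^+ n <= 1 by rewrite exprn_ile1.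
have y0n : 0 <= y ^+ n by rewrite exprn_ge0.
by rewrite /bump exprn_ge0 ?subr_ge0//= exprn_ile1 ?subr_ge0// gerBl.
Qed.

Lemma Bernoulli (a : R) N : 0 <= a <= 1 -> 1 - N%:R * a <= (1 - a) ^+ N.
Proof.
move=> /andP[a0 a1]; elim: N => [|N IH]; first by rewrite mul0r subr0 expr0.
rewrite exprSr; apply: (@le_trans _ _ ((1 - N%:R * a) * (1 - a))).
  rewrite -natr1 mulrDl mul1r; have : 0 <= N%:R * a * a by rewrite !mulr_ge0.
  by move: (N%:R * a) => b; nra.
by rewrite ler_wpM2r ?subr_ge0.
Qed.

Lemma Bernoulli1 (a : R) N : 0 <= a -> 1 + N%:R * a <= (1 + a) ^+ N.
Proof.
move=> a0; elim: N => [|N IH]; first by rewrite mul0r addr0 expr0.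
rewrite exprSr; apply: (@le_trans _ _ ((1 + N%:R * a) * (1 + a))).
  rewrite -natr1 mulrDl mul1r; have : 0 <= N%:R * a * a by rewrite !mulr_ge0.
  by move: (N%:R * a) => b; nra.
by rewrite ler_wpM2r// addr_ge0.
Qed.

(** Bernoulli's inequality gives [bump n y] >= 1 - (2 y)^n. *)
Lemma bump_lt y : 0 <= y -> y < 2^-1 -> (fun n => bump n y) @ \oo --> (1 : R).
Proof.
move=> y0 y2; have y1 : y <= 1 by lra.
have l : (fun n => 1 - (2 * y) ^+ n) @ \oo --> (1 : R).
  rewrite -[X in _ --> X]subr0; apply: cvgB; first exact: cvg_cst.
  by apply: cvg_expr; rewrite ger0_norm; lra.
apply: (squeeze_cvgr _ l (cvg_cst (1 : R))); near=> n.
have /andP[_ ->] : 0 <= bump n y <= 1 by apply: bump01; rewrite y0.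
rewrite andbT exprMn -natrX; apply: Bernoulli.
by rewrite exprn_ge0//= exprn_ile1.
Unshelve. all: by end_near. Qed.

(** The product of [bump n y] with (1 + y^n)^(2^n) is (1 - y^(2 n))^(2^n) <= 1, while the second
    factor is at least (2 y)^n. *)
Lemma bump_gt y : 2^-1 < y -> y <= 1 -> (fun n => bump n y) @ \oo --> (0 : R).
Proof.
move=> y2 y1; have y0 : 0 <= y by lra.
have l : (fun n => ((2 * y)^-1) ^+ n) @ \oo --> (0 : R).
  apply: cvg_expr; rewrite ger0_norm; last by rewrite invr_ge0; lra.
  by rewrite invf_lt1; lra.
apply: (squeeze_cvgr _ (cvg_cst (0 : R)) l); near=> n.
have /andP[-> _]/= : 0 <= bump n y <= 1 by apply: bump01; rewrite y0.
have yn0 : 0 <= y ^+ n by rewrite exprn_ge0.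
have yn1 : y ^+ n <= 1 by rewrite exprn_ile1.
have p : 0 < (2 * y) ^+ n by rewrite exprn_gt0//; lra.
rewrite exprVn -[_^-1]mul1r ler_pdivlMr//.
apply: (@le_trans _ _ (bump n y * (1 + y ^+ n) ^+ (2 ^ n))).
  apply: ler_wpM2l; first by have /andP[] : 0 <= bump n y <= 1 by apply: bump01; rewrite y0.
  by apply: le_trans (Bernoulli1 _ yn0); rewrite exprMn natrX lerDr.
rewrite /bump -exprMn exprn_ile1//; nra.
Unshelve. all: by end_near. Qed.

Lemma cos_gt_arc (r s : R) : 0 <= r -> r <= pi -> `|s| < r -> cos r < cos s.
Proof.
move=> r0 rpi sr.
have -> : cos s = cos `|s| by have [//|s0] := ger0P s; rewrite cosN.
by rewrite ltr_cos// in_itv/= ?r0 ?rpi// normr_ge0/= (le_trans (ltW sr)).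
Qed.

Lemma cos_lt_arc (r s : R) : 0 <= r -> r <= pi -> r < s -> s < 2 * pi - r ->
  cos s < cos r.
Proof.
move=> r0 rpi rs s2.
have [sp|sp] := leP s pi.
  by rewrite ltr_cos// in_itv/= ?r0 ?rpi// sp andbT ltW// (le_lt_trans r0).
have -> : cos s = cos (2 * pi - s).
  by rewrite mulr_natl cosB cos2pi sin2pi mul1r mul0r addr0.
rewrite ltr_cos// ?in_itv/= ?r0 ?rpi//; first lra.
by apply/andP; split; lra.
Qed.

(** At z = e^{it} this is the real number 1/2 - (cos(t - r) - cos r)/4. For r in [0, pi] it is below
    1/2 inside the arc from 0 to 2 r and above 1/2 outside; the division by 4 keeps it in [0, 1]. *)
Definition arcpoly (r : R) (z : C) : C :=
  (2^-1 + cos r / 4)%:C%C +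
  (- 8^-1)%:C%C * (expi (- r) * z ^ (1 : int) + expi r * z ^ (- 1 : int)).

Definition arcval (r t : R) : R := 2^-1 - (cos (t - r) - cos r) / 4.

Lemma arcpolyE r t : arcpoly r (expi t) = (arcval r t)%:C%C.
Proof.
rewrite /arcpoly /arcval exprN1 expr1z circ_inv ?normc_expi//.
rewrite /expi; simpc; apply/eqP; rewrite eq_complex /= cosB cosN sinN.
by apply/andP; split; apply/eqP; field.
Qed.

Lemma multiplier_bump n r : multiplier (fun z => (1 - arcpoly r z ^+ n) ^+ (2 ^ n)).
Proof.
apply: multiplierX.
have E z : 1 - arcpoly r z ^+ n = 1 + (-1) * arcpoly r z ^+ n by rewrite mulN1r.
move=> f fz; suff : multiplier (fun z => 1 + (-1) * arcpoly r z ^+ n).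
  by move=> /(_ f fz); apply: Fzero_ext => z _; rewrite E.
apply: multiplierD; first exact: multiplier_cst.
apply: multiplierM; first exact: multiplier_cst.
apply: multiplierX; apply: multiplierD; first exact: multiplier_cst.
apply: multiplierM; first exact: multiplier_cst.
by apply: multiplierD; apply: multiplierM; first [exact: multiplier_cst | exact: multiplier_expz].
Qed.

Lemma arcval01 r t : 0 <= arcval r t <= 1.
Proof.
rewrite /arcval; have := cos_geN1 r; have := cos_le1 r; have := cos_geN1 (t - r).
have := cos_le1 (t - r); move: (cos r) (cos (t - r)) => a b; lra.
Qed.

Lemma Fzero_bump (f : C -> C) n r : Fzero f ->
  Rintegral (@mu R) (@I02 R) (fun t => bump n (arcval r t) * complex.Re (f (expi t))) = 0.
Proof.
move=> f0; have [_ /(_ 0)] := multiplier_bump n r f0.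
rewrite /fourier oppr0 TintE => /(congr1 (@complex.Re R)) /= /eqP.
rewrite mulf_eq0 invr_eq0 gt_eqF ?pi2_gt0//= => /eqP <-.
congr Rintegral; apply/funext => t; rewrite expr0z mulr1 arcpolyE.
rewrite -rmorphXn -[X in (X - _)]/((1 : R)%:C%C) -rmorphB -rmorphXn /= -/(bump n (arcval r t)).
by rewrite Re_M /= mul0r subr0.
Qed.

(** The bumps of [arcpoly] integrate to zero against f and converge boundedly to the indicator of
    [0, b]. *)
Lemma Rintegral_initial_arc (f : C -> C) (b : R) : Fzero f ->
  Rintegral (@mu R) (@I02 R) (fun t : R => ((t <= b)%R)%:R * complex.Re (f (expi t))) = 0.
Proof.
move=> f0; have [[fL _] /(_ 0)] := f0.
have [b0|b0] := ltP b 0.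
  move=> _; rewrite -[RHS](mul0r (fine (@mu R (@I02 R)))).
  rewrite -(Rintegral_cst (@mu R) mI02 0); apply: eq_Rintegral => t.
  rewrite inE /I02 /= in_itv/= => /andP[t0 _].
  by rewrite leNgt (lt_le_trans b0 t0) mul0r.
have [b2|b2] := ltP (2 * pi) b.
  rewrite /fourier oppr0 TintE => /(congr1 (@complex.Re R)) /= /eqP.
  rewrite mulf_eq0 invr_eq0 gt_eqF ?pi2_gt0//= => /eqP <-.
  apply: eq_Rintegral => t; rewrite inE /I02 /= in_itv/= => /andP[_ t2].
  by rewrite (le_trans t2 (ltW b2)) mul1r expr0z mulr1.
(* The arc [0, b] has centre b/2 and half-width b/2. *)
move=> _; pose r := b / 2.
have r0 : 0 <= r by rewrite /r divr_ge0.
have rpi : r <= pi by rewrite /r ler_pdivrMr// mulrC.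
pose F n (t : R) := (bump n (arcval r t) * complex.Re (f (expi t)))%:E.
pose G (t : R) := (((t <= b)%R)%:R * complex.Re (f (expi t)))%:E.
have mcos : measurable_fun [set: R] (fun t : R => arcval r t).
  apply: measurable_funB => //; apply: measurable_funM => //.
  apply: measurable_funB => //.
  apply: (@measurableT_comp _ _ _ _ _ _ cos).
    by apply: continuous_measurable_fun; exact: continuous_cos.
  exact: measurable_funB.
have mb n : measurable_fun [set: R] (fun t : R => bump n (arcval r t)).
  by apply: measurable_funX; apply: measurable_funB => //; exact: measurable_funX.
have mF n : measurable_fun (@I02 R : set (measurableTypeR R)) (F n).
  apply: measurable_funTS.
  exact: (measurableT_comp (@EFin_measurable R setT) (measurable_funM (mb n) (L1m fL))).
have mG : measurable_fun (@I02 R : set (measurableTypeR R)) G.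
  apply: measurable_funTS.
  have mi : measurable_fun [set: R] (fun t : R => ((t <= b)%R)%:R : R).
    rewrite (_ : (fun t => _) = (fun t : R => if t <= b then 1 else 0)).
      by apply: measurable_fun_ifT => //; exact: measurable_fun_ler.
    by apply/funext => t; case: ifP.
  exact: (measurableT_comp (@EFin_measurable R setT) (measurable_funM mi (L1m fL))).
have cvF : {ae @mu R, forall t, @I02 R t -> (fun n => F n t) @ \oo --> G t}.
  have N1 (a : R) : (@mu R).-negligible ([set a] : set (measurableTypeR R)).
    by exists [set a]; split => //; exact: lebesgue_measure_set1.
  (* At these three points [arcval] equals 1/2, the value left out by [bump_lt] and [bump_gt]. *)
  have N : (@mu R).-negligible ([set 0%R] `|` [set b] `|` [set 2 * pi] : set (measurableTypeR R)).
    by apply: negligibleU => //; exact: negligibleU.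
  apply: negligibleS N => t /= /not_implyP[tI].
  apply: contra_notP => /not_orP[/not_orP[/eqP t0 /eqP tb] /eqP t2].
  move: tI; rewrite /I02 /= in_itv/= => /andP[t0' t2'].
  apply: cvg_EFin; first by near=> n.
  apply: cvgM; last exact: cvg_cst.
  have /andP[y0 y1] := arcval01 r t.
  have [tb'|tb'] := leP t b.
    apply: bump_lt => //; rewrite /arcval gtrBl divr_gt0// subr_gt0.
    apply: cos_gt_arc => //; rewrite ltr_norml /r.
    have : 0 < t by rewrite lt_neqAle eq_sym t0.
    have : t < b by rewrite lt_neqAle tb.
    by move=> ? ?; apply/andP; split; lra.
  apply: bump_gt => //; rewrite /arcval ltrBDr gtrDl pmulr_llt0// subr_lt0.
  have t2'' : t < 2 * pi by rewrite lt_neqAle t2.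
  by apply: cos_lt_arc => //; rewrite /r; lra.
have gI : (@mu R).-integrable (@I02 R) (fun t : measurableTypeR R => `|complex.Re (f (expi t))|%:E).
  by have [] := L1_norm fL.
have dom : {ae @mu R, forall t, forall n, @I02 R t -> (`|F n t| <= `|complex.Re (f (expi t))|%:E)%E}.
  apply: aeW => t n _; rewrite lee_fin normrM ler_piMl//.
  by have /andP[? ?] := bump01 n (arcval01 r t); rewrite ger0_norm.
have [_ _ l] := dominated_convergence mI02 mF mG cvF gI dom.
have Gi : (\int[@mu R]_(t in @I02 R) G t = 0)%E.
  apply/esym/(cvg_unique _ _ l) => //.
  rewrite (_ : [sequence _]_n = cst 0%E); first exact: cvg_cst.
  apply/funext => n /=.
  have FI : (@mu R).-integrable (@I02 R) (F n).
    apply/integrableP; split => //; move/integrableP: gI => [_]; apply: le_lt_trans.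
    apply: ae_ge0_le_integral => //.
    - exact: mI02.
    - exact: measurableT_comp.
    - by apply: measurableT_comp => //; exact: Tm_E (Tm_norm (L1m fL)).
    - by apply: (ae_muS _ dom) => t /(_ n) H tI; apply: le_trans (H tI) _; rewrite abse_EFin normr_id.
  rewrite -(fineK (integrable_fin_num mI02 FI)); congr (_%:E).
  exact: (Fzero_bump n r f0).
by rewrite /Rintegral Gi.
Unshelve. all: by end_near. Qed.

(** By Lebesgue differentiation the integrand is almost everywhere the derivative of its integral up
    to x, and that integral is identically zero. *)
Lemma Fzero_Re_ae f : Fzero f -> aeT (fun z => complex.Re (f z) = 0).
Proof.
move=> f0; have [[fL _] _] := f0.
pose h (t : R) := complex.Re (f (expi t)).
pose hD := h \_ (@I02 R).
have hI : (@lebesgue_measure R).-integrable (@I02 R) (EFin \o h) := fL.2.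
have lI : locally_integrable [set: R] hD by apply: integrable_locally => //; exact: mI02.
have hDI : (@lebesgue_measure R).-integrable setT (EFin \o hD).
  by rewrite /hD -restrict_EFin; apply/(integrable_mkcond _ mI02).
have := @FTC1Ny R hD _ lI => /= H.
have {H} := H (fun y => @integrableS _ (measurableTypeR R) R (@lebesgue_measure R) _ _ _
  measurableT (measurable_itv _) (@subsetT _ _) hDI).
have F0 x : \int[@lebesgue_measure R]_(t in `]-oo, x]) hD t = 0.
  rewrite -[RHS](Rintegral_initial_arc x f0).
  rewrite /hD [LHS]Rintegral_mkcond [RHS]Rintegral_mkcond; congr Rintegral.
  apply/funext => t; rewrite /patch mem_setE in_itv/= /h.
  by case: (t <= x)%R; case: ifP; rewrite ?mul1r ?mul0r.
rewrite (_ : (fun x => _) = cst 0); last by apply/funext => x; exact: F0.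
apply: ae_muS => t [_]; rewrite derive1_cst /hD patchE => H tI.
by move: H; rewrite mem_set.
Qed.

Lemma FzeroP f : Fzero f -> aeT (fun z => f z = 0).
Proof.
move=> f0; have := multiplier_cst (Complex 0 (- 1)) f0.
move=> /Fzero_Re_ae; apply: aeT2 (Fzero_Re_ae f0) => z _ h1 h2.
apply/eqP; rewrite eq_complex /= h1 eqxx/=; apply/eqP.
by move: h2; rewrite Re_M /= mul0r sub0r mulN1r opprK.
Qed.

Lemma fourier_inj f g : C1 f -> C1 g -> (forall m, fourier f m = fourier g m) ->
  aeT (fun z => f z = g z).
Proof.
move=> fC gC fg; have : aeT (fun z => f z - g z = 0).
  apply: FzeroP; split.
    by apply: C1_ext (C1D fC (C1Z (-1) gC)) => z _; rewrite mulN1r.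
  move=> m; rewrite -(subrr (fourier g m)) -{1}fg -TintB; do ?exact: C1_expz.
  by apply: Tint_ext => z _; rewrite mulrBl.
by apply: aeT_mono => z _ /eqP; rewrite subr_eq0 => /eqP.
Qed.

End FourierUniqueness.

(** * Means of the characters z^s *)

Section CharacterIntegrals.
Context {R : realType}.
Local Notation C := (R[i]).

Lemma expiX (t : R) n : expi t ^+ n = expi (n%:R * t).
Proof.
elim: n => [|n IH].
  by rewrite expr0 mul0r /expi cos0 sin0.
rewrite exprS IH -natr1 mulrDl mul1r /expi; simpc.
by rewrite cosD sinD; congr Complex; ring.
Qed.

Lemma Rintegral_cos n : (0 < n)%N ->
  Rintegral (@mu R) (@I02 R) (fun t : R => cos (n%:R * t)) = 0.
Proof.
move=> n0; have n0' : n%:R != 0 :> R by rewrite pnatr_eq0 -lt0n.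
pose F (t : R) : R := sin (n%:R * t) / n%:R.
have dF (t : R) : is_derive t 1 F (cos (n%:R * t)).
  have h : is_derive t 1 (fun t : R => n%:R * t) n%:R.
    by apply: is_derive_eq; rewrite /GRing.scale/= mulr1.
  have h2 := @is_derive1_comp _ sin (fun t : R => n%:R * t) t _ _ (is_derive_sin _) h.
  have := @is_deriveM _ _ (sin \o (fun t : R => n%:R * t)) (cst (n%:R^-1)) t 1 _ _ h2 (is_derive_cst _ _ _).
  rewrite scaler0 add0r; congr is_derive.
  by rewrite /GRing.scale/=; field.
have cF : continuous F.
  by move=> t; apply/differentiable_continuous/derivable1_diffP; have [] := dF t.
have ccos : continuous (fun t : R => cos (n%:R * t)).
  move=> t; apply: continuous_comp; last exact: continuous_cos.
  exact: mulrl_continuous.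
have s0 : sin (n%:R * (2 * pi)) = 0 :> R.
  have : expi (n%:R * (2 * pi)) = 1 :> C.
    by rewrite -expiX /expi mulr_natl cos2pi sin2pi -[Complex 1 0]/(1 : C) expr1n.
  by move=> [].
rewrite /Rintegral /I02 (@continuous_FTC2 _ (fun t : R => cos (n%:R * t)) F _ _ (@pi2_gt0 R)).
- by rewrite /F mulr0 s0 sin0 mul0r -EFinB subrr.
- exact: continuous_subspaceT.
- split; [by move=> t _; have [] := dF t|exact/cvg_at_right_filter/cF|exact/cvg_at_left_filter/cF].
- by move=> t _; rewrite derive1E; apply: derive_val.
Qed.

Lemma Rintegral_sin n : (0 < n)%N ->
  Rintegral (@mu R) (@I02 R) (fun t : R => sin (n%:R * t)) = 0.
Proof.
move=> n0; have n0' : n%:R != 0 :> R by rewrite pnatr_eq0 -lt0n.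
pose F (t : R) : R := - cos (n%:R * t) / n%:R.
have dF (t : R) : is_derive t 1 F (sin (n%:R * t)).
  have h : is_derive t 1 (fun t : R => n%:R * t) n%:R.
    by apply: is_derive_eq; rewrite /GRing.scale/= mulr1.
  have h2 := is_deriveN (@is_derive1_comp _ cos (fun t : R => n%:R * t) t _ _ (is_derive_cos _) h).
  have := @is_deriveM _ _ (- (cos \o (fun t : R => n%:R * t))) (cst (n%:R^-1)) t 1 _ _ h2 (is_derive_cst _ _ _).
  rewrite scaler0 add0r; congr is_derive.
  by rewrite /GRing.scale/=; field.
have cF : continuous F.
  by move=> t; apply/differentiable_continuous/derivable1_diffP; have [] := dF t.
have csin : continuous (fun t : R => sin (n%:R * t)).
  move=> t; apply: continuous_comp; last exact: continuous_sin.
  exact: mulrl_continuous.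
have s0 : cos (n%:R * (2 * pi)) = 1 :> R.
  have : expi (n%:R * (2 * pi)) = 1 :> C.
    by rewrite -expiX /expi mulr_natl cos2pi sin2pi -[Complex 1 0]/(1 : C) expr1n.
  by move=> [].
rewrite /Rintegral /I02 (@continuous_FTC2 _ (fun t : R => sin (n%:R * t)) F _ _ (@pi2_gt0 R)).
- by rewrite /F mulr0 s0 cos0 -EFinB subrr.
- exact: continuous_subspaceT.
- split; [by move=> t _; have [] := dF t|exact/cvg_at_right_filter/cF|exact/cvg_at_left_filter/cF].
- by move=> t _; rewrite derive1E; apply: derive_val.
Qed.

Lemma Tint_expz (s : int) : s != 0 -> Tint (fun z : C => z ^ s) = 0.
Proof.
have P n : (0 < n)%N -> Tint (fun z : C => z ^+ n) = 0.
  move=> n0; rewrite TintE; apply/eqP; rewrite eq_complex /mean /=.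
  under eq_Rintegral do rewrite expiX /=.
  rewrite Rintegral_cos// mulr0 eqxx/=.
  under eq_Rintegral do rewrite expiX /=.
  by rewrite Rintegral_sin// mulr0.
case: s => s s0.
  by rewrite -(P s) ?lt0n//; apply: eqb_neg.
have := P s.+1 isT => /(congr1 conjc); rewrite conjc0 -TintJ.
  by move=> <-; apply: Tint_ext => z z1; rewrite NegzE -invr_expz circ_inv ?normc_expz.
have := C1_expz s.+1 (C1_cst (1 : C)).
by apply: C1_ext => z _; rewrite mul1r.
Qed.

End CharacterIntegrals.

(** * Invariant subspaces and Hardy spaces *)

Section Hardy.
Context {R : realType}.
Local Notation C := (R[i]).

Definition cdot m k (A B : 'M[C]_(m, k)) : C := \sum_i \sum_j A i j * conjc (B i j).

Definition shift m k (s : int) (F : C -> 'M[C]_(m, k)) : C -> 'M[C]_(m, k) :=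
  fun z => z ^ s *: F z.

Definition csub m k := closed_subspace (@L2M R m k) (@L2ip R m k).

Section General.
Variables m k : nat.
Local Notation V := (C -> 'M[C]_(m, k)).
Implicit Types (x y F : V) (W : V -> Prop).

Local Notation Hb := (@L2_hilbert R m k).

Lemma rip_cdot (A B : 'M[C]_(m, k)) : rip A B = complex.Re (cdot A B).
Proof. by rewrite /rip /cdot raddf_sum; apply: eq_bigr => i _; rewrite raddf_sum. Qed.

Lemma cdot_C1 x y : L2M x -> L2M y -> C1 (fun z => cdot (x z) (y z)).
Proof. by move=> xL yL; apply: C1_sum => i; apply: C1_sum => j; apply: C2M => //; exact: C2J. Qed.

Lemma L2ip_Tint x y : L2ip x y = complex.Re (Tint (fun z => cdot (x z) (y z))).
Proof. by rewrite Re_Tint; apply: mean_ext => z _; rewrite rip_cdot. Qed.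

Lemma cdotZl (c : C) (A B : 'M[C]_(m, k)) : cdot (c *: A) B = c * cdot A B.
Proof.
rewrite /cdot mulr_sumr; apply: eq_bigr => i _; rewrite mulr_sumr; apply: eq_bigr => j _.
by rewrite mxE mulrA.
Qed.

Lemma cdotZr (c : C) (A B : 'M[C]_(m, k)) : cdot A (c *: B) = conjc c * cdot A B.
Proof.
rewrite /cdot mulr_sumr; apply: eq_bigr => i _; rewrite mulr_sumr; apply: eq_bigr => j _.
by rewrite mxE rmorphM mulrCA.
Qed.

Lemma cdotDl (A B D : 'M[C]_(m, k)) : cdot (A + B) D = cdot A D + cdot B D.
Proof.
rewrite /cdot -big_split; apply: eq_bigr => i _; rewrite -big_split; apply: eq_bigr => j _ /=.
by rewrite mxE mulrDl.
Qed.

Lemma cdot0l (B : 'M[C]_(m, k)) : cdot 0 B = 0.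
Proof. by rewrite -(scale0r (0 : 'M[C]_(m, k))) cdotZl mul0r. Qed.

Lemma cdotJ (A B : 'M[C]_(m, k)) : conjc (cdot A B) = cdot B A.
Proof.
rewrite /cdot rmorph_sum; apply: eq_bigr => i _; rewrite rmorph_sum.
by apply: eq_bigr => j _ /=; rewrite rmorphM /= conjcK mulrC.
Qed.

Lemma cdot_frob2 (A : 'M[C]_(m, k)) : cdot A A = (frob2 A)%:C%C.
Proof.
rewrite /cdot /frob2 rmorph_sum; apply: eq_bigr => i _; rewrite rmorph_sum.
by apply: eq_bigr => j _; rewrite mulcJ.
Qed.

(** [L2ip] is only the real part of the Hermitian product; the imaginary part is reached through the
    factor c = -i, hence the quantifier over c. *)
Lemma Tint_cdot0P x y : L2M x -> L2M y ->
  (forall c : C, L2ip (c *: x) y = 0) -> Tint (fun z => cdot (x z) (y z)) = 0.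
Proof.
move=> xL yL H; apply/eqP; rewrite eq_complex; apply/andP; split; apply/eqP.
  by have := H 1; rewrite scale1r L2ip_Tint.
have := H (Complex 0 (-1)); rewrite L2ip_Tint.
rewrite (_ : Tint _ = Complex 0 (-1) * Tint (fun z => cdot (x z) (y z))).
  by rewrite Re_M /= mul0r sub0r mulN1r opprK.
by rewrite -TintZ; [apply: Tint_ext => z _; rewrite -cdotZl|exact: cdot_C1].
Qed.

Lemma hnormE x : hnorm (@L2ip R m k) x = Num.sqrt (mean (fun z => frob2 (x z))).
Proof. by rewrite /hnorm; congr Num.sqrt; apply: mean_ext => z _; rewrite rip_frob2. Qed.

Lemma frob2_eq0 (A : 'M[C]_(m, k)) : frob2 A = 0 -> A = 0.
Proof.
move=> /eqP; rewrite psumr_eq0 => [/allP H|i _]; last first.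
  by apply: sumr_ge0 => j _; exact: sqr_ge0.
apply/matrixP => i j; have := H i (mem_index_enum _).
rewrite /= psumr_eq0 => [/allP/(_ j (mem_index_enum _))|j' _]; last exact: sqr_ge0.
by rewrite /= expf_eq0/= normc_eq0 mxE => /eqP.
Qed.

Lemma hnorm_eq0 x : L2M x -> hnorm (@L2ip R m k) x = 0 -> aeT (fun z => x z = 0).
Proof.
move=> xL; rewrite hnormE => /eqP; rewrite sqrtr_eq0 => h.
have /mean_eq0 : mean (fun z => frob2 (x z)) = 0.
  by apply/eqP; rewrite eq_le h mean_ge0// => z; exact: frob2_ge0.
move=> /(_ (L2M_frob2 xL)) /(_ (fun z => frob2_ge0 (x z))).
by apply: aeT_mono => z _; exact: frob2_eq0.
Qed.

Lemma frob20 : frob2 (0 : 'M[C]_(m, k)) = 0.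
Proof. by apply: big1 => i _; apply: big1 => j _; rewrite mxE normc0 expr0n. Qed.

Lemma ae_hnorm0 x : L2M x -> aeT (fun z => x z = 0) -> hnorm (@L2ip R m k) x = 0.
Proof.
move=> xL x0; rewrite hnormE (@mean_ae_eq _ _ (fun=> 0)) ?mean_cst ?sqrtr0//.
- exact: (L1m (L2M_frob2 xL)).
- exact: Tm_cst.
- by apply: aeT_mono x0 => z _ ->; exact: frob20.
Qed.

Lemma L2MB x y : L2M x -> L2M y -> L2M (x - y).
Proof. exact: (h_DB Hb). Qed.

(** The constant sequence x converges to y in the seminorm when the two agree almost everywhere. *)
Lemma csub_ae W x y : csub W -> W x -> L2M y -> aeT (fun z => x z = y z) -> W y.
Proof.
move=> cW Wx yL xy; apply: (cs_lim cW (u := fun=> x)) => //.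
rewrite /hlim ae_hnorm0; first exact: cvg_cst.
  by apply: L2MB => //; exact: cs_D cW _ Wx.
by apply: aeT_mono xy => z _ /= xz; rewrite -[LHS]/(x z - y z) xz subrr.
Qed.

Lemma csubN W x : csub W -> W x -> W (- x).
Proof. by move=> cW Wx; rewrite -scaleN1r; exact: (cs_scale cW). Qed.

Lemma csubB W x y : csub W -> W x -> W y -> W (x - y).
Proof. by move=> cW Wx Wy; apply: (cs_add cW) => //; exact: csubN. Qed.

Lemma L2M_shift s x : L2M x -> L2M (shift s x).
Proof. by move=> xL i j; apply: C2_ext (C2_expz s (xL i j)) => z _; rewrite mxE. Qed.

Lemma L2ip_shift s x y : L2ip (shift s x) (shift s y) = L2ip x y.
Proof.
rewrite !L2ip_Tint; congr complex.Re; apply: Tint_ext => z z1.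
by rewrite cdotZl cdotZr mulrA mulcJ normc_expz// expr1n mul1r.
Qed.

Lemma hnorm_shift s x : hnorm (@L2ip R m k) (shift s x) = hnorm (@L2ip R m k) x.
Proof. by rewrite /hnorm L2ip_shift. Qed.

Lemma shift_shift s t x z : normc z = 1 -> shift s (shift t x) z = shift (s + t) x z.
Proof. by move=> z1; rewrite /shift scalerA expfzDr// circ_neq0. Qed.

Lemma shift0 x : shift 0 x = x.
Proof. by apply/funext => z; rewrite /shift expr0z scale1r. Qed.

Lemma shiftD s x y : shift s (x + y) = shift s x + shift s y.
Proof. by apply/funext => z; exact: scalerDr. Qed.

Lemma shiftB s x y : shift s (x - y) = shift s x - shift s y.
Proof. by apply/funext => z; exact: scalerBr. Qed.

Lemma shiftZ s c x : shift s (c *: x) = c *: shift s x.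
Proof.
apply/funext => z; rewrite -[LHS]/(z ^ s *: (c *: x z)) -[RHS]/(c *: (z ^ s *: x z)).
by rewrite !scalerA mulrC.
Qed.

Lemma hlim_shift s u x : hlim (@L2ip R m k) u x ->
  hlim (@L2ip R m k) (fun n => shift s (u n)) (shift s x).
Proof.
move=> ux; rewrite /hlim; under eq_fun do rewrite -shiftB hnorm_shift.
exact: ux.
Qed.

(** Hermitian orthogonality passes to limits; this is why the subspaces below that are cut out by
    vanishing coefficients are closed. *)
Lemma Tint_cdot_lim u x y : (forall n, L2M (u n)) -> L2M x -> L2M y ->
  hlim (@L2ip R m k) u x -> (forall n, Tint (fun z => cdot (u n z) (y z)) = 0) ->
  Tint (fun z => cdot (x z) (y z)) = 0.
Proof.
move=> uL xL yL ux u0; apply: Tint_cdot0P => // c.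
suff : L2ip x (conjc c *: y) = 0.
  rewrite !L2ip_Tint => <-; congr complex.Re; apply: Tint_ext => z _.
  by rewrite [RHS]cdotZr cdotZl conjcK.
have cyL : L2M (conjc c *: y) by exact: L2MZ.
have := hlim_ip Hb uL xL cyL ux.
rewrite (_ : (fun n => _) = (fun=> 0)); first by move/(cvg_unique _ (cvg_cst 0)) => <-.
apply/funext => n; rewrite L2ip_Tint.
rewrite (_ : Tint _ = c * Tint (fun z => cdot (u n z) (y z))); first by rewrite u0 mulr0.
rewrite -TintZ; last exact: cdot_C1.
by apply: Tint_ext => z _; rewrite [LHS]cdotZr conjcK.
Qed.

Definition deltaf (s : int) (i : 'I_m) (j : 'I_k) : V := fun z => z ^ s *: delta_mx i j.

Lemma L2M_deltaf s i j : L2M (deltaf s i j).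
Proof.
apply: (L2M_shift s (x := fun=> delta_mx i j)) => a b; exact: C2_cst.
Qed.

(** This exhibits the coefficient as a Hermitian product, hence as a continuous functional on
    L^2. *)
Lemma fourier_cdot x i j s :
  fourier (fun z => x z i j) s = Tint (fun z => cdot (x z) (deltaf s i j z)).
Proof.
apply: Tint_ext => z z1; rewrite cdotZr mulrC; congr (_ * _); last first.
  rewrite /cdot (bigD1 i)//= (bigD1 j)//= !mxE !eqxx conjc1 mulr1.
  rewrite big1 ?addr0; last by move=> j' jj; rewrite mxE (negbTE jj) andbF conjc0 mulr0.
  rewrite big1 ?addr0// => i' ii; apply: big1 => j' _.
  by rewrite mxE (negbTE ii) conjc0 mulr0.
by rewrite -circ_inv ?normc_expz// invr_expz.
Qed.

Definition H2M x := L2M x /\ forall i j (s : int), s < 0 -> fourier (fun z => x z i j) s = 0.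

Lemma H2MP (x : mxfun m k) : HpM 2 x <-> H2M x.
Proof.
split=> [[xL xa]|[xL xa]]; split.
- exact/LpM2P.
- by move=> i j s s0; exact: xa.
- exact/LpM2P.
- by move=> i j s s0; exact: xa.
Qed.

Lemma csub_H2M : csub H2M.
Proof.
split.
- by move=> x [].
- split; first exact: L2M0.
  move=> i j s _; rewrite fourier_cdot -[RHS](Tint_cst 0); apply: Tint_ext => z _.
  exact: cdot0l.
- move=> x y [xL xa] [yL ya]; split; first exact: L2MD.
  move=> i j s s0; rewrite fourier_cdot -[RHS](addr0 0) -{1}(xa i j s s0) -(ya i j s s0).
  rewrite !fourier_cdot -TintD; do ?[apply: cdot_C1 => //; exact: L2M_deltaf].
  by apply: Tint_ext => z _; rewrite cdotDl.
- move=> c x [xL xa]; split; first exact: L2MZ.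
  move=> i j s s0; rewrite fourier_cdot -[RHS](mulr0 c) -(xa i j s s0) fourier_cdot -TintZ.
    by apply: Tint_ext => z _; rewrite cdotZl.
  by apply: cdot_C1 => //; exact: L2M_deltaf.
- move=> u x uH xL ux; split => // i j s s0; rewrite fourier_cdot.
  apply: (Tint_cdot_lim _ xL (L2M_deltaf s i j) ux) => n; first by have [] := uH n.
  by have [_ /(_ i j s s0)] := uH n; rewrite fourier_cdot.
Qed.

Lemma fourier_shift (f : C -> C) (s t : int) :
  fourier (fun z => z ^ s * f z) t = fourier f (t - s).
Proof.
apply: Tint_ext => z z1; rewrite opprB expfzDr ?circ_neq0//; ring.
Qed.

Lemma H2M_shift (s : nat) x : H2M x -> H2M (shift s%:Z x).
Proof.
move=> [xL xa]; split; first exact: L2M_shift.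
move=> i j t t0; rewrite -(xa i j (t - s%:Z)); last by rewrite subr_lt0 (lt_le_trans t0).
by rewrite -fourier_shift; apply: Tint_ext => z _; rewrite !mxE.
Qed.

Lemma shiftinv_nat W : (forall x, W x -> W (shift 1 x)) -> csub W ->
  forall (s : nat) x, W x -> W (shift s%:Z x).
Proof.
move=> sW cW; elim=> [|s IH] x Wx; first by rewrite shift0.
apply: (csub_ae cW (sW _ (IH _ Wx))).
  by apply: L2M_shift; exact: cs_D cW _ Wx.
by apply: aeTW => z z1; rewrite shift_shift// -intS.
Qed.

End General.

Definition sc (f : C -> C) : C -> 'M[C]_(1, 1) := fun z => const_mx (f z).

Lemma sc_L2M f : C2 f -> L2M (sc f).
Proof. by move=> fC i j; apply: C2_ext fC => z _; rewrite mxE. Qed.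

Lemma cdot11 (A B : 'M[C]_(1, 1)) : cdot A B = A 0 0 * conjc (B 0 0).
Proof. by rewrite /cdot !big_ord1. Qed.

Lemma frob2Z m k (c : C) (A : 'M[C]_(m, k)) : frob2 (c *: A) = normc c ^+ 2 * frob2 A.
Proof.
rewrite /frob2 mulr_sumr; apply: eq_bigr => i _; rewrite mulr_sumr; apply: eq_bigr => j _.
by rewrite mxE normcM exprMn.
Qed.

Lemma H2M_cst m k (A : 'M[C]_(m, k)) : H2M (fun=> A).
Proof.
split; first by move=> i j; exact: C2_cst.
move=> i j s s0; rewrite /fourier TintZ; last first.
  by have := C1_expz (- s) (C1_cst (1 : C)); apply: C1_ext => z _; rewrite mul1r.
by rewrite Tint_expz ?mulr0// oppr_eq0 lt_eqF.
Qed.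

Lemma H2M_one : H2M (fun=> const_mx 1 : 'M[C]_(1, 1)).
Proof. exact: H2M_cst. Qed.

(* The residual of the projection onto W has only vanishing Fourier coefficients. *)
Lemma H2_sub_invariant (W : (C -> 'M[C]_(1, 1)) -> Prop) : csub W ->
  (forall x, W x -> W (shift 1 x)) -> W (fun=> const_mx 1) ->
  forall x, H2M x -> W x.
Proof.
move=> cW sW W1 x xH.
have cH := @csub_H2M 1 1.
(* Projecting onto the intersection with H^2 keeps the residual in H^2: its negative coefficients
   vanish by membership, the others by orthogonality to z^s. *)
pose W' y := W y /\ H2M y.
have cW' : csub W'.
  split.
  - by move=> y [_ []].
  - by split; [exact: cs_0 cW|exact: cs_0 cH].
  - by move=> y y' [? ?] [? ?]; split; [exact: (cs_add cW)|exact: (cs_add cH)].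
  - by move=> c y [? ?]; split; [exact: (cs_scale cW)|exact: (cs_scale cH)].
  - move=> u y uW yL uy; split.
      by apply: (cs_lim cW _ yL uy) => n; have [] := uW n.
    by apply: (cs_lim cH _ yL uy) => n; have [] := uW n.
have [xL xa] := xH.
have [p [Wp pH] pP] := orthogonal_projection (@L2_hilbert R 1 1) cW' xL.
apply: (csub_ae cW Wp xL).
have xpH : H2M (x - p) by apply: csubB.
have [xpL xpa] := xpH.
have W1' (s : nat) : W' (shift s%:Z (fun=> const_mx 1)).
  split; first exact: shiftinv_nat.
  exact/H2M_shift/H2M_one.
have xpL1 : C1 (fun z => (x - p) z 0 0) by exact/C2_C1/xpL.
have : aeT (fun z => (x - p) z 0 0 = 0).
  apply: FzeroP; split => // -[s|s]; last exact: xpa.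
  have := fun c => pP _ (cs_scale cW' c (W1' s)).
  move=> h; have : Tint (fun z => cdot (shift s%:Z (fun=> const_mx 1) z) ((x - p) z)) = 0.
    apply: Tint_cdot0P => //; first by apply: L2M_shift => i j; exact: C2_cst.
    move=> c; rewrite (h_ipC (@L2_hilbert R 1 1))//.
    by apply: L2MZ; apply: L2M_shift => i j; exact: C2_cst.
  move=> /(congr1 conjc); rewrite conjc0 -TintJ; last first.
    by apply: cdot_C1 => //; apply: L2M_shift => i j; exact: C2_cst.
  move=> <-; apply: Tint_ext => z z1; rewrite cdotJ cdot11 /shift !mxE mulr1.
  by rewrite -invr_expz circ_inv ?normc_expz.
apply: aeT_mono => z _; rewrite -[(x - p) z]/(x z - p z) !mxE => /eqP.
rewrite subr_eq0 => /eqP h; apply/matrixP => i j; rewrite !ord1.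
by rewrite h.
Qed.

(** The x whose integrals against z^s g vanish for all s >= 0 form a closed shift-invariant
    subspace. It contains 1 because g has no coefficients of index <= 0, hence it contains H^2. *)
Lemma fourier_H2_H20 (f g : C -> C) : C2 f -> (forall s : int, s < 0 -> fourier f s = 0) ->
  C2 g -> (forall s : int, s <= 0 -> fourier g s = 0) ->
  Tint (fun z => f z * g z) = 0.
Proof.
move=> fL fa gL ga.
pose y (s : nat) : C -> 'M[C]_(1, 1) := sc (fun z => conjc (z ^ s%:Z * g z)).
have yL s : L2M (y s) by apply/sc_L2M/C2J/C2_expz.
pose W x := @L2M R 1 1 x /\ forall s : nat, Tint (fun z => cdot (x z) (y s z)) = 0.
have WE x (s : nat) : Tint (fun z => cdot (x z) (y s z)) = Tint (fun z => x z 0 0 * (z ^ s%:Z * g z)).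
  by apply: Tint_ext => z _; rewrite cdot11 mxE conjcK.
have cW : csub W.
  split.
  - by move=> x [].
  - split; first exact: L2M0.
    move=> s; rewrite -[RHS](Tint_cst 0); apply: Tint_ext => z _.
    exact: cdot0l.
  - move=> x x' [xL x0] [xL' x0']; split; first exact: L2MD.
    move=> s; rewrite -[RHS](addr0 0) -{1}(x0 s) -(x0' s) -TintD; do ?exact: cdot_C1.
    by apply: Tint_ext => z _; rewrite cdotDl.
  - move=> c x [xL x0]; split; first exact: L2MZ.
    move=> s; rewrite -[RHS](mulr0 c) -(x0 s) -TintZ; last exact: cdot_C1.
    by apply: Tint_ext => z _; rewrite cdotZl.
  - move=> u x uW xL ux; split => // s.
    by apply: (Tint_cdot_lim _ xL (yL s) ux) => n; have [] := uW n.
have sW x : W x -> W (shift 1 x).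
  move=> [xL x0]; split; first exact: L2M_shift.
  move=> s; rewrite -(x0 s.+1) !WE; apply: Tint_ext => z z1.
  by rewrite mxE intS expfzDr ?circ_neq0//; ring.
have W1 : W (fun=> const_mx 1).
  split; first by move=> i j; exact: C2_cst.
  move=> s; rewrite WE -(ga (- s%:Z)) ?oppr_le0//; apply: Tint_ext => z _.
  by rewrite mxE mul1r opprK mulrC.
have [_ /(_ 0%N)] : W (sc f).
  apply: (H2_sub_invariant cW sW W1); split; first exact: sc_L2M.
  by move=> i j s s0; rewrite -(fa s s0); apply: Tint_ext => z _; rewrite mxE.
by rewrite WE => <-; apply: Tint_ext => z _; rewrite mxE mul1r.
Qed.

Lemma fourier_mul_H2_H20 (f g : C -> C) : C2 f -> (forall s : int, s < 0 -> fourier f s = 0) ->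
  C2 g -> (forall s : int, s <= 0 -> fourier g s = 0) ->
  forall s : int, s <= 0 -> fourier (fun z => f z * g z) s = 0.
Proof.
move=> fL fa gL ga s s0.
rewrite -(@fourier_H2_H20 (fun z => z ^ (- s) * f z) g)//.
- by apply: Tint_ext => z _; ring.
- exact: C2_expz.
- by move=> t t0; rewrite fourier_shift; apply: fa; rewrite opprK (le_lt_trans _ t0)// gerDl.
Qed.

(** The scalar x with x v in W form a closed shift-invariant subspace containing 1, hence containing
    H^2. Boundedness of v makes multiplication by v continuous on L^2. *)
Lemma invariant_mul_H2 n (W : (C -> 'M[C]_(n, 1)) -> Prop) (v : C -> 'M[C]_(n, 1)) (g : C -> C) :
  csub W -> (forall x, W x -> W (shift 1 x)) -> W v ->
  aeT (fun z => frob2 (v z) <= 1) ->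
  C2 g -> (forall s : int, s < 0 -> fourier g s = 0) ->
  W (fun z => g z *: v z).
Proof.
move=> cW sW Wv v1 gL ga.
have vL := cs_D cW Wv.
have mulL (x : C -> 'M[C]_(1, 1)) : L2M x -> L2M (fun z => x z 0 0 *: v z).
  move=> xL i j; apply: C2_ext (@C2_bdd R (fun z => x z 0 0) (fun z => v z i j) 1 (vL i j).1 _ (xL 0 0)).
    by move=> z _; rewrite mxE mulrC.
  apply: aeT_mono v1 => z _; rewrite /frob2 (bigD1 i)//= (bigD1 j)//= -addrA => h.
  rewrite -(@ler_pXn2r _ 2) ?nnegrE ?normc_ge0// expr1n; apply: le_trans h.
  by rewrite lerDl addr_ge0// sumr_ge0// => ? _; rewrite ?sumr_ge0// => *; exact: sqr_ge0.
pose W' x := @L2M R 1 1 x /\ W (fun z => x z 0 0 *: v z).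
have cW' : csub W'.
  split.
  - by move=> x [].
  - split; first exact: L2M0.
    by apply: csub_ae (cs_0 cW) (mulL _ (@L2M0 R 1 1)) _ => //; apply: aeTW => z _; rewrite mxE scale0r.
  - move=> x y [xL Wx] [yL Wy]; split; first exact: L2MD.
    apply: csub_ae (cs_add cW Wx Wy) (mulL _ (L2MD xL yL)) _ => //.
    by apply: aeTW => z _; rewrite mxE scalerDl.
  - move=> c x [xL Wx]; split; first exact: L2MZ.
    apply: csub_ae (cs_scale cW c Wx) (mulL _ (L2MZ c xL)) _ => //.
    by apply: aeTW => z _; rewrite mxE -scalerA.
  - move=> u x uW xL ux; split => //.
    apply: (cs_lim cW (u := fun k z => u k z 0 0 *: v z)); [by move=> k; have [] := uW k|exact: mulL|].
    apply: (@squeeze_cvgr _ _ _ _ (fun=> 0) (fun k => hnorm (@L2ip R 1 1) (u k - x))); [|exact: cvg_cst|exact: ux].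
    near=> k; rewrite hnorm_ge0/= !hnormE ler_wsqrtr//.
    have uxL : L2M (u k - x) by apply: L2MB => //; have [] := uW k.
    apply: mean_le; [|exact: L2M_frob2|].
      by apply: L2M_frob2; apply: L2MB; apply: mulL => //; have [] := uW k.
    apply: aeT_mono v1 => z _ h.
    rewrite -[X in frob2 X <= _]/(u k z 0 0 *: v z - x z 0 0 *: v z) -scalerBl.
    rewrite frob2Z {2}/frob2 !big_ord1 !mxE -[leRHS]mulr1.
    by rewrite ler_wpM2l ?sqr_ge0.
have sW' x : W' x -> W' (shift 1 x).
  move=> [xL Wx]; split; first exact: L2M_shift.
  apply: csub_ae (sW _ Wx) (mulL _ (L2M_shift 1 xL)) _ => //.
  by apply: aeTW => z _; rewrite /shift mxE -scalerA.
have W'1 : W' (fun=> const_mx 1).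
  have oL : L2M (fun=> const_mx 1 : 'M[C]_(1, 1)) by move=> i j; exact: C2_cst.
  split => //; apply: csub_ae Wv (mulL _ oL) _ => //.
  by apply: aeTW => z _; rewrite mxE scale1r.
have gH : H2M (sc g).
  split; first exact: sc_L2M.
  by move=> i j s s0; rewrite -(ga s s0); apply: Tint_ext => z _; rewrite mxE.
have [_ W'g] := H2_sub_invariant cW' sW' W'1 gH.
apply: csub_ae W'g _ _ => //.
  have := mulL _ (sc_L2M gL).
  by rewrite (_ : (fun z => _) = (fun z => g z *: v z))//; apply/funext => z; rewrite mxE.
by apply: aeTW => z _; rewrite mxE.
Unshelve. all: by end_near. Qed.

End Hardy.

(** * Measurability of norms and singular values of matrix functions *)

Section Measurability.
Context {R : realType}.
Local Notation C := (R[i]).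

(** The preimage is a countable union of level sets of h, so g may be arbitrary. *)
Lemma measurable_countable_factor (T : countType) (h : C -> T) (g : T -> R) :
  (forall t, measurable_fun [set: R] (fun x : R => h (expi x) == t)) ->
  Tm (fun z => g (h z)).
Proof.
move=> mh _ Y mY; rewrite setTI.
pose E k : set R := if @unpickle T k is Some t then
  (if `[< Y (g t) >] then [set x : R | h (expi x) == t] else set0) else set0.
rewrite (_ : _ @^-1` Y = \bigcup_k E k).
  apply: bigcupT_measurable => k; rewrite /E; case: unpickle => [t|] //.
  case: ifP => // _; have := mh t measurableT [set true].
  by rewrite setTI; apply.
apply/seteqP; split=> [x Yx|x [k _]].
  exists (pickle (h (expi x))) => //=; rewrite /E pickleK.
  by case: asboolP => //=.
rewrite /E; case: unpickle => // t; case: asboolP => // Yt /= /eqP ht.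
by rewrite /preimage /= ht.
Qed.

Lemma measurable_all (J : Type) (s : seq J) (P : J -> R -> bool) :
  (forall j, measurable_fun [set: R] (P j)) ->
  measurable_fun [set: R] (fun x => all (fun j => P j x) s).
Proof.
move=> mP; elim: s => [|j s IH] /=; first exact: measurable_cst.
exact: measurable_and.
Qed.

Variables m k : nat.
Local Notation M := 'M[C]_(m, k).

Definition entsum (A : M) : R := \sum_i \sum_j normc (A i j).

(* Rounding to a countable grid turns an arbitrary function of a measurable matrix function
   into a measurable one. *)
Definition rnd (N : nat) (A : M) : 'M[(int * int)%type]_(m, k) :=
  \matrix_(i, j) (Num.floor (N.+1%:R * complex.Re (A i j)), Num.floor (N.+1%:R * complex.Im (A i j))).

Definition unrnd (N : nat) (B : 'M[(int * int)%type]_(m, k)) : M :=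
  \matrix_(i, j) Complex (((B i j).1)%:~R / N.+1%:R) (((B i j).2)%:~R / N.+1%:R).

Lemma floor_approx (N : nat) (x : R) :
  `|x - (Num.floor (N.+1%:R * x))%:~R / N.+1%:R| <= N.+1%:R^-1.
Proof.
have l := floor_le (N.+1%:R * x); have u := ltW (floorD1_gt (N.+1%:R * x)).
have N0 : 0 < N.+1%:R :> R by [].
move: N0 l u; move: (N.+1%:R) => c c0 l u.
have -> : x - (Num.floor (c * x))%:~R / c = (c * x - (Num.floor (c * x))%:~R) / c.
  by field; rewrite gt_eqF.
rewrite normrM [`|_^-1|]ger0_norm ?invr_ge0 ?(ltW c0)//.
rewrite ler_piMl ?invr_ge0 ?(ltW c0)// ger0_norm ?subr_ge0//.
by rewrite lerBlDl; move: u; rewrite intrD.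
Qed.

Lemma entsum_rnd N A : entsum (A - unrnd N (rnd N A)) <= (m * k)%:R * (2 / N.+1%:R).
Proof.
apply: (@le_trans _ _ (\sum_(i < m) \sum_(j < k) (2 / N.+1%:R))).
  apply: ler_sum => i _; apply: ler_sum => j _; rewrite !mxE.
  apply: le_trans (normc_le_ReIm _) _; case: (A i j) => x y /=.
  have -> : 2 / N.+1%:R = N.+1%:R^-1 + N.+1%:R^-1 :> R by rewrite mulr_natl mulr2n.
  by rewrite lerD// floor_approx.
by rewrite !sumr_const !card_ord -mulrnA mulnC [leRHS]mulr_natl.
Qed.

Lemma Tm_rounded (F : C -> M) (g : 'M[(int * int)%type]_(m, k) -> R) N :
  (forall i j, Cm (fun z => F z i j)) -> Tm (fun z => g (rnd N (F z))).
Proof.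
move=> mF; apply: measurable_countable_factor => B.
have mfloor (f : C -> R) (a : int) : Tm f ->
    measurable_fun [set: R] (fun x : R => Num.floor (N.+1%:R * f (expi x)) == a).
  move=> mf; under eq_fun do rewrite floor_eq.
  have mNf : measurable_fun [set: R] (fun x : R => N.+1%:R * f (expi x)).
    exact: (TmM (Tm_cst N.+1%:R) mf).
  apply: measurable_and; first by apply: measurable_fun_ler.
  exact: measurable_fun_ltr.
rewrite (_ : (fun x => _) = (fun x : R => all (fun ij : 'I_m * 'I_k =>
    (Num.floor (N.+1%:R * complex.Re (F (expi x) ij.1 ij.2)) == (B ij.1 ij.2).1) &&
    (Num.floor (N.+1%:R * complex.Im (F (expi x) ij.1 ij.2)) == (B ij.1 ij.2).2))
    (enum {: 'I_m * 'I_k}))).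
  apply: measurable_all => ij; have [mr mi] := mF ij.1 ij.2.
  by apply: measurable_and; apply: (mfloor (fun z => _ (F z ij.1 ij.2))).
apply/funext => x; apply/eqP/allP => [<- ij _|h].
  by rewrite !mxE /= !eqxx.
apply/matrixP => i j; rewrite mxE; have /andP[/eqP /= -> /eqP ->] := h (i, j) (mem_enum _ _).
by case: (B i j).
Qed.

(** A Lipschitz function of F is the pointwise limit of the same function of the rounded F, which is
    measurable whatever the function. *)
Lemma Tm_lip (F : C -> M) (phi : M -> R) (L : R) :
  (forall A B, `|phi A - phi B| <= L * entsum (A - B)) ->
  (forall i j, Cm (fun z => F z i j)) -> Tm (fun z => phi (F z)).
Proof.
move=> phiL mF.
apply: (@measurable_fun_cvg _ _ _ _ (fun N (x : R) => phi (unrnd N (rnd N (F (expi x)))))).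
  by move=> N; exact: (@Tm_rounded F (fun B => phi (unrnd N B)) N mF).
move=> x _; set A := F (expi x).
apply/cvgrPdist_le => /= e e0.
pose c := `|L| * (m * k)%:R * 2 + 1.
have c0 : 0 < c by rewrite ltr_wpDl// !mulr_ge0.
have ec : 0 < e / c by rewrite divr_gt0.
near=> N; apply: le_trans (phiL _ _) _.
apply: (@le_trans _ _ (`|L| * ((m * k)%:R * (2 / N.+1%:R)))).
  have en : 0 <= entsum (A - unrnd N (rnd N A)).
    by apply: sumr_ge0 => i _; apply: sumr_ge0 => j _; exact: normc_ge0.
  apply: (@le_trans _ _ (`|L| * entsum (A - unrnd N (rnd N A)))).
    by rewrite ler_wpM2r// ler_norm.
  by rewrite ler_wpM2l// entsum_rnd.
rewrite !mulrA; apply: (@le_trans _ _ (c * N.+1%:R^-1)).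
  by rewrite ler_wpM2r ?invr_ge0// lerDl.
rewrite mulrC -ler_pdivlMr//.
by near: N; have [N0 _ NP] := near_infty_natSinv_lt (PosNum ec); exists N0 => // N /NP /ltW.
Unshelve. all: by end_near. Qed.

Lemma opnorm_le_entsum (A : M) : opnorm A <= entsum A.
Proof.
rewrite {1}(matrix_sum_delta A).
have d1 i j : opnorm (delta_mx i j : M) <= 1.
  rewrite -(@ler_pXn2r _ 2) ?nnegrE ?opnorm_ge0// expr1n.
  apply: le_trans (opnorm_le_frob2 _) _; rewrite /frob2 (bigD1 i)//= (bigD1 j)//= mxE !eqxx normc1 expr1n.
  rewrite big1 ?addr0; last by move=> j' jj; rewrite mxE (negbTE jj) andbF normc0 expr0n.
  rewrite big1 ?addr0// => i' ii; apply: big1 => j' _.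
  by rewrite mxE (negbTE ii) normc0 expr0n.
rewrite /entsum; elim/big_ind2 : _ => [|x a y b xa yb|i _]; first by rewrite opnorm0.
  by rewrite (le_trans (opnormD _ _))// lerD.
elim/big_ind2 : _ => [|x a y b xa yb|j _]; first by rewrite opnorm0.
  by rewrite (le_trans (opnormD _ _))// lerD.
by rewrite opnormZ ler_piMr ?normc_ge0.
Qed.

Lemma lip_sub (phi : M -> R) (L : R) : (forall A B, phi A <= phi B + L * opnorm (A - B)) ->
  0 <= L -> forall A B, `|phi A - phi B| <= L * entsum (A - B).
Proof.
move=> H L0 A B; apply: (@le_trans _ _ (L * opnorm (A - B))).
  rewrite ler_norml lerBlDl H andbT lerNl opprB lerBlDl.
  by rewrite -opprB opnormN H.
by rewrite ler_wpM2l// opnorm_le_entsum.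
Qed.

Lemma Tm_opnorm (F : C -> M) : (forall i j, Cm (fun z => F z i j)) -> Tm (fun z => opnorm (F z)).
Proof.
apply: (@Tm_lip _ _ 1); apply: lip_sub => // A B.
by rewrite mul1r -{1}(subrK B A) addrC opnormD.
Qed.

Lemma Tm_sing (F : C -> M) j : (forall i j, Cm (fun z => F z i j)) -> Tm (fun z => sing j (F z)).
Proof. by apply: (@Tm_lip _ _ 1); apply: lip_sub => // A B; rewrite mul1r sing_lip. Qed.

Lemma Tm_trnorm (F : C -> M) : (forall i j, Cm (fun z => F z i j)) -> Tm (fun z => trnorm (F z)).
Proof. by move=> mF; apply: Tm_sum => j; exact: Tm_sing. Qed.

End Measurability.

(** * Wandering vectors *)

Section Wandering.
Context {R : realType}.
Local Notation C := (R[i]).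
Variable n : nat.
Local Notation V := (C -> 'M[C]_(n, 1)).
Local Notation Hb := (@L2_hilbert R n 1).
Implicit Types (W : V -> Prop) (x y v : V).

Lemma cdot_vdot (A B : 'cV[C]_n) : cdot A B = vdot A B.
Proof. by apply: eq_bigr => i _; rewrite big_ord1. Qed.

Lemma frob2_vnorm (A : 'cV[C]_n) : frob2 A = vnorm A ^+ 2.
Proof. by rewrite vnorm_sq; apply: eq_bigr => i _; rewrite big_ord1. Qed.

Lemma cdot_bound (A B : 'cV[C]_n) : frob2 B <= 1 -> normc (cdot A B) ^+ 2 <= frob2 A.
Proof.
rewrite cdot_vdot !frob2_vnorm => B1; apply: (@le_trans _ _ ((vnorm A * vnorm B) ^+ 2)).
  by rewrite ler_pXn2r ?nnegrE ?normc_ge0 ?mulr_ge0 ?vnorm_ge0 ?CauchySchwarz_vdot.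
by rewrite exprMn ler_piMr ?sqr_ge0.
Qed.

Lemma cdot_C2 x v : L2M x -> L2M v -> aeT (fun z => frob2 (v z) <= 1) ->
  C2 (fun z => cdot (x z) (v z)).
Proof.
move=> xL vL v1; apply: C2_le (C1_Cm (cdot_C1 xL vL)) _ (L2M_frob2 xL).
by apply: aeT_mono v1 => z _; exact: cdot_bound.
Qed.

Lemma Tint_shift_cdot (s : int) x y :
  Tint (fun z => z ^ s * cdot (x z) (y z)) = Tint (fun z => cdot (shift s x z) (y z)).
Proof. by apply: Tint_ext => z _; rewrite cdotZl. Qed.

Lemma fourier_cst (c : C) (s : int) : s != 0 -> fourier (fun=> c) s = 0.
Proof.
move=> s0; rewrite /fourier TintZ; last first.
  by have := C1_expz (- s) (C1_cst (1 : C)); apply: C1_ext => z _; rewrite mul1r.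
by rewrite Tint_expz ?mulr0// oppr_eq0.
Qed.

(** The last clause says that the scalar product of any y in W with v has no negative Fourier
    coefficients. *)
Definition wandering W v :=
  [/\ W v, aeT (fun z => frob2 (v z) = 1) &
    forall y, W y -> forall s : nat, Tint (fun z => z ^ s.+1%:Z * cdot (y z) (v z)) = 0].

(* A vector of W orthogonal to z W has constant length on the circle, since all nonzero
   Fourier coefficients of its squared length vanish. *)
Lemma exists_wandering W : csub W -> (forall x, W x -> W (shift 1 x)) ->
  (forall x, W x -> (forall s : nat, W (shift (- s%:Z) x)) -> aeT (fun z => x z = 0)) ->
  (exists2 x, W x & ~ aeT (fun z => x z = 0)) ->
  exists v, wandering W v.
Proof.
move=> cW sW pW [x1 Wx1 x10].
have sWn := shiftinv_nat sW cW.
(* Otherwise W = z W, so every element stays in W after division by any power of z and vanishes by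
   the purity hypothesis. *)
have [x0 Wx0 x0N] : exists2 x, W x & ~ W (shift (-1) x).
  apply: contrapT => /forall2NP h.
  have sWN x : W x -> W (shift (-1) x) by move=> Wx; have [//|/contrapT] := h x.
  apply: x10; apply: pW => //; elim=> [|s IH]; first by rewrite oppr0 shift0.
  apply: (csub_ae cW (sWN _ IH)); first exact/L2M_shift/(cs_D cW).
  by apply: aeTW => z z1; rewrite shift_shift// -opprD -intS.
(* This is z W, described through z^-1 so that closedness is inherited directly from W. *)
pose Z x := L2M x /\ W (shift (-1) x).
have cZ : csub Z.
  split.
  - by move=> x [].
  - split; first exact: L2M0.
    rewrite (_ : shift _ _ = 0); first exact: cs_0 cW.
    by apply/funext => z; exact: scaler0.
  - by move=> x y [xL Wx] [yL Wy]; split; [exact: L2MD|rewrite shiftD; exact: (cs_add cW)].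
  - by move=> c x [xL Wx]; split; [exact: L2MZ|rewrite shiftZ; exact: (cs_scale cW)].
  - move=> u x uZ xL ux; split => //.
    apply: (cs_lim cW (u := fun k => shift (-1) (u k))); [by move=> k; have [] := uZ k|exact: L2M_shift|exact: hlim_shift].
have ZW x : Z x -> W x.
  move=> [xL Wx]; apply: (csub_ae cW (sW _ Wx) xL).
  by apply: aeTW => z z1; rewrite shift_shift// addrN shift0.
have x0L := cs_D cW Wx0.
have [p Zp pP] := orthogonal_projection Hb cZ x0L.
pose v0 := x0 - p; have Wv0 : W v0 by apply: csubB => //; exact: ZW.
have v0L := cs_D cW Wv0.
have orth y (s : nat) : W y -> Tint (fun z => z ^ s.+1%:Z * cdot (y z) (v0 z)) = 0.
  move=> Wy; have yL := cs_D cW Wy; rewrite Tint_shift_cdot.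
  have syL : L2M (shift s.+1%:Z y) by exact: L2M_shift.
  have Zsy : Z (shift s.+1%:Z y).
    split => //; apply: (csub_ae cW (sWn s _ Wy)); first exact: L2M_shift.
    by apply: aeTW => z z1; rewrite shift_shift// intS addKr.
  apply: Tint_cdot0P => // c; rewrite (h_ipC Hb) ?pP//; [exact: (cs_scale cZ)|exact: L2MZ].
have f1 : C1 (fun z => cdot (v0 z) (v0 z)) by exact: cdot_C1.
pose c := mean (fun z => frob2 (v0 z)).
have TE : Tint (fun z => cdot (v0 z) (v0 z)) = c%:C%C.
  rewrite TintE; apply/eqP; rewrite eq_complex /=; apply/andP; split; apply/eqP.
    by apply: mean_ext => z _; rewrite cdot_frob2.
  by rewrite -[RHS](mean_cst 0); apply: mean_ext => z _; rewrite cdot_frob2.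
have fc : aeT (fun z => cdot (v0 z) (v0 z) = c%:C%C).
  apply: fourier_inj => //; first exact: C1_cst.
  move=> s; have [->|s0] := eqVneq s 0.
    rewrite /fourier oppr0 -(Tint_cst c%:C%C) -{1}(Tint_cst c%:C%C) -TE.
    rewrite Tint_cst; transitivity (Tint (fun z => cdot (v0 z) (v0 z))).
      by apply: Tint_ext => z _; rewrite expr0z mulr1.
    by rewrite TE Tint_cst -[LHS]Tint_cst; apply: Tint_ext => z _; rewrite expr0z mulr1.
  rewrite fourier_cst//; case: s s0 => [[|s]|s] // _.
    rewrite -conjc0 -(orth v0 s Wv0) -TintJ; last first.
      by have := C1_expz s.+1%:Z f1; apply: C1_ext => z _; rewrite mulrC.
    apply: Tint_ext => z z1; rewrite rmorphM /= cdotJ mulrC; congr (_ * _).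
    by rewrite -circ_inv ?normc_expz// invr_expz.
  by rewrite -(orth v0 s Wv0); apply: Tint_ext => z z1; rewrite NegzE opprK mulrC.
(* If c = 0, then [x0] agrees with its projection p and lies in z W. *)
have c0 : c != 0.
  apply/eqP => c0; apply: x0N.
  suff [] : Z x0 by [].
  apply: (csub_ae cZ Zp x0L).
  have : aeT (fun z => v0 z = 0).
    by apply: hnorm_eq0 => //; rewrite hnormE -/c c0 sqrtr0.
  by apply: aeT_mono => z _ /eqP; rewrite -[v0 z]/(x0 z - p z) subr_eq0 => /eqP.
have cge0 : 0 <= c by apply: mean_ge0 => z; exact: frob2_ge0.
pose a := (Num.sqrt c)^-1.
exists (a%:C%C *: v0); split.
- exact: (cs_scale cW).
- apply: aeT_mono fc => z _; rewrite cdot_frob2 => /complexI fz.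
  rewrite -[X in frob2 X]/(a%:C%C *: v0 z) frob2Z fz normcR ger0_norm ?invr_ge0 ?sqrtr_ge0//.
  by rewrite exprVn sqr_sqrtr// mulVf.
- move=> y Wy s; rewrite -(mulr0 (conjc a%:C%C)) -(orth y s Wy) -TintZ.
    by apply: Tint_ext => z _; rewrite [cdot _ _]cdotZr mulrCA.
  have := C1_expz s.+1%:Z (cdot_C1 (cs_D cW Wy) v0L).
  by apply: C1_ext => z _; rewrite mulrC.
Qed.

(** Indexing by all of [nat] lets a family be extended without casts; only the first r entries
    count. *)
Definition wfamily W (r : nat) (v : nat -> V) :=
  (forall i, (i < r)%N -> wandering W (v i)) /\
  aeT (fun z => forall i j, (i < r)%N -> (j < r)%N -> cdot (v i z) (v j z) = (i == j)%:R).

Section Step.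
Variables (W : V -> Prop) (r : nat) (v : nat -> V).
Hypothesis cW : csub W.
Hypothesis sW : forall x, W x -> W (shift 1 x).
Hypothesis pW : forall x, W x -> (forall s : nat, W (shift (- s%:Z) x)) -> aeT (fun z => x z = 0).
Hypothesis fv : wfamily W r v.

Let wv (i : 'I_r) : wandering W (v i). Proof. exact: fv.1. Qed.
Let vL (i : 'I_r) : L2M (v i). Proof. by have [/(cs_D cW)] := wv i. Qed.
Let v1 (i : 'I_r) : aeT (fun z => frob2 (v i z) <= 1).
Proof. by have [_ h _] := wv i; apply: aeT_mono h => z _ ->. Qed.

Lemma wcoef_C2 y (i : 'I_r) : L2M y -> C2 (fun z => cdot (y z) (v i z)).
Proof. by move=> yL; apply: cdot_C2. Qed.

Lemma wcoef_analytic y (i : 'I_r) (s : int) : W y -> s < 0 ->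
  fourier (fun z => cdot (y z) (v i z)) s = 0.
Proof.
move=> Wy; case: s => // s _; have [_ _ /(_ y Wy s) <-] := wv i.
by apply: Tint_ext => z _; rewrite NegzE opprK mulrC.
Qed.

Definition wproj y : V := fun z => \sum_(i < r) cdot (y z) (v i z) *: v i z.

Lemma W_sum (f : 'I_r -> V) : (forall i, W (f i)) -> W (fun z => \sum_i f i z).
Proof.
move=> Wf; rewrite (_ : (fun z => _) = \sum_i f i).
  by elim/big_ind : _ => [|x y Wx Wy|i _]; [exact: cs_0 cW|exact: (cs_add cW)|exact: Wf].
apply/funext => z; elim/big_ind2 : _ => [//|x a y b -> ->//|//].
Qed.

(** The coefficients of y along wandering vectors are in H^2, and multiplying a bounded vector of W
    by an H^2 function stays in W. *)
Lemma W_wproj y : W y -> W (wproj y).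
Proof.
move=> Wy; apply: (W_sum (f := fun i z => cdot (y z) (v i z) *: v i z)) => i.
apply: invariant_mul_H2 => //; first by have [] := wv i.
  by apply: wcoef_C2; exact: cs_D cW _ Wy.
by move=> s; exact: wcoef_analytic.
Qed.

Lemma cdot_sumZl (J : finType) (a : J -> C) (A : J -> 'cV[C]_n) (B : 'cV[C]_n) :
  cdot (\sum_j a j *: A j) B = \sum_j a j * cdot (A j) B.
Proof.
elim/big_ind2 : _ => [|x u y w <- <-|j _]; [exact: cdot0l|exact: cdotDl|exact: cdotZl].
Qed.

Lemma cdot_wproj y : aeT (fun z => forall i : 'I_r, cdot (y z - wproj y z) (v i z) = 0).
Proof.
apply: aeT_mono fv.2 => z _ h i.
rewrite -scaleN1r cdotDl cdotZl cdot_sumZl (bigD1 i)//= big1 ?addr0 => [|j ji].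
  by rewrite h// eqxx mulr1 mulN1r subrr.
by rewrite h// -[(_ == _)]/(j == i) (negbTE ji) mulr0.
Qed.

(* If the pointwise projections onto the family do not exhaust W, the vectors of W that are
   pointwise orthogonal to the family form an invariant subspace with a wandering vector. *)
Lemma wfamily_step : (forall y, W y -> aeT (fun z => y z = wproj y z)) \/
  exists v' : nat -> V, wfamily W r.+1 v'.
Proof.
(* Pointwise orthogonality is stated through integrals against all z^s v_i, a condition stable under
   limits; uniqueness of Fourier coefficients recovers the pointwise form. *)
pose W' y := W y /\ forall (i : 'I_r) (s : int), Tint (fun z => cdot (y z) (shift s (v i) z)) = 0.
have svL (i : 'I_r) (s : int) : L2M (shift s (v i)) by exact: L2M_shift (vL i).
have cW' : csub W'.
  split.
  - by move=> y [/(cs_D cW)].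
  - split; first exact: cs_0 cW.
    by move=> i s; rewrite -[RHS](Tint_cst 0); apply: Tint_ext => z _; exact: cdot0l.
  - move=> x x' [Wx x0] [Wx' x0']; split; first exact: (cs_add cW).
    move=> i s; rewrite -[RHS](addr0 0) -{1}(x0 i s) -(x0' i s) -TintD; last 2 first.
    + by apply: cdot_C1 => //; exact: cs_D cW _ Wx.
    + by apply: cdot_C1 => //; exact: cs_D cW _ Wx'.
    by apply: Tint_ext => z _; rewrite cdotDl.
  - move=> c x [Wx x0]; split; first exact: (cs_scale cW).
    move=> i s; rewrite -[RHS](mulr0 c) -(x0 i s) -TintZ.
      by apply: Tint_ext => z _; rewrite cdotZl.
    by apply: cdot_C1 => //; exact: cs_D cW _ Wx.
  - move=> u x uW xL ux; split.
      by apply: (cs_lim cW _ xL ux) => k; have [] := uW k.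
    move=> i s; apply: (Tint_cdot_lim _ xL (svL i s) ux) => k; have [Wu u0] := uW k => //.
    exact: cs_D cW _ Wu.
have W'ae y : W' y -> aeT (fun z => forall i : 'I_r, cdot (y z) (v i z) = 0).
  move=> [Wy y0]; apply: aeT_forall => i; apply: FzeroP; split.
    by apply: cdot_C1 => //; exact: cs_D cW _ Wy.
  move=> s; rewrite -(y0 i s); apply: Tint_ext => z z1.
  by rewrite cdotZr mulrC -circ_inv ?normc_expz// invr_expz.
have W'I y : W y -> aeT (fun z => forall i : 'I_r, cdot (y z) (v i z) = 0) -> W' y.
  move=> Wy y0; split => // i s; rewrite -[RHS](Tint_cst 0); apply: Tint_ae_eq.
  - by apply: C1_Cm; apply: cdot_C1 => //; exact: cs_D cW _ Wy.
  - exact: Cm_cst.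
  - by apply: aeT_mono y0 => z _ /(_ i) h; rewrite cdotZr h mulr0.
have projW' y : W y -> W' (y - wproj y).
  move=> Wy; apply: W'I; first by apply: csubB => //; exact: W_wproj.
  exact: cdot_wproj.
have [h|/existsNP[x /not_implyP[W'x x0]]] := pselect (forall x, W' x -> aeT (fun z => x z = 0)).
  left=> y Wy; apply: aeT_mono (h _ (projW' _ Wy)) => z _ /eqP.
  by rewrite -[(y - wproj y) z]/(y z - wproj y z) subr_eq0 => /eqP.
right.
have [] := @exists_wandering W' cW'.
- move=> y W'y; apply: W'I; first by apply: sW; have [] := W'y.
  by apply: aeT_mono (W'ae _ W'y) => z _ h i; rewrite cdotZl h mulr0.
- by move=> y [Wy _] h; apply: pW => // s; have [] := h s.
- by exists x.
move=> v0 [W'v0 v01 v0o].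
exists (fun i => if i == r then v0 else v i); split.
  move=> i; rewrite ltnS leq_eqVlt => /orP[/eqP ->|ir]; last first.
    by rewrite (ltn_eqF ir); exact: fv.1.
  rewrite eqxx; split => //; first by have [] := W'v0.
  (* [v0] is known to wander in W' only. It does so in W because it is pointwise orthogonal to
     [wproj y], which may be subtracted from y. *)
  move=> y Wy s; rewrite -(v0o _ (projW' _ Wy) s).
  have yL := cs_D cW Wy; have v0L := cs_D cW' W'v0.
  have pL := cs_D cW' (projW' _ Wy).
  rewrite !Tint_shift_cdot; apply: Tint_ae_eq.
  - by apply/C1_Cm/cdot_C1 => //; exact: L2M_shift.
  - by apply/C1_Cm/cdot_C1 => //; exact: L2M_shift.
  - apply: aeT_mono (W'ae _ W'v0) => z _ h; rewrite !cdotZl; congr (_ * _).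
    rewrite -[(y - wproj y) z]/(y z - wproj y z) -scaleN1r cdotDl cdotZl cdot_sumZl.
    rewrite big1 ?mulr0 ?addr0// => j _.
    by rewrite -(cdotJ (v0 z)) h conjc0 mulr0.
apply: aeT3 fv.2 (W'ae _ W'v0) v01 => z _ h1 h2 h3 i j.
rewrite !ltnS leq_eqVlt => /orP[/eqP->|ir]; rewrite leq_eqVlt => /orP[/eqP->|jr].
- by rewrite !eqxx cdot_frob2 h3.
- by rewrite eqxx (ltn_eqF jr) (gtn_eqF jr) (h2 (Ordinal jr)).
- by rewrite eqxx (ltn_eqF ir) -cdotJ (h2 (Ordinal ir)) conjc0.
- by rewrite (ltn_eqF ir) (ltn_eqF jr) h1.
Qed.

End Step.

(** Each failure to span adds a vector to the family, which the bound on r allows only finitely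
    often. *)
Lemma wandering_basis W l : csub W -> (forall x, W x -> W (shift 1 x)) ->
  (forall x, W x -> (forall s : nat, W (shift (- s%:Z) x)) -> aeT (fun z => x z = 0)) ->
  (forall r (v : nat -> V), wfamily W r v -> (r <= l)%N) ->
  exists r (v : nat -> V), [/\ (r <= l)%N, wfamily W r v &
    forall y, W y -> aeT (fun z => y z = wproj r v y z)].
Proof.
move=> cW sW pW bd.
suff H d r (v : nat -> V) : wfamily W r v -> (l <= r + d)%N ->
    exists r (v : nat -> V), wfamily W r v /\ forall y, W y -> aeT (fun z => y z = wproj r v y z).
  have [||r [v [fv sp]]] := H l 0%N (fun=> 0).
  - by split => // ; apply: aeTW.
  - by [].
  - by exists r, v; split => //; exact: bd fv.
elim: d r v => [|d IH] r v fv lr.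
  have [sp|[v' fv']] := wfamily_step cW sW pW fv; first by exists r, v.
  by have := leq_trans (bd _ _ fv') lr; rewrite addn0 ltnn.
have [sp|[v' fv']] := wfamily_step cW sW pW fv; first by exists r, v.
by apply: (IH _ _ fv'); rewrite addSnnS.
Qed.

End Wandering.

(** * Factorization of functions in H^1 *)

Section Factorization.
Context {R : realType}.
Local Notation C := (R[i]).
Local Notation adj A := (map_mx Num.conj (A^T)).

Lemma csub_L2M m k : csub (@L2M R m k).
Proof.
split=> //; [exact: L2M0|move=> x y; exact: L2MD|by move=> c x; exact: L2MZ].
Qed.

Lemma hnormZC m k (c : C) (x : C -> 'M[C]_(m, k)) : L2M x ->
  hnorm (@L2ip R m k) (c *: x) = normc c * hnorm (@L2ip R m k) x.
Proof.
move=> xL; rewrite !hnormE.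
have -> : mean (fun z => frob2 ((c *: x) z)) = normc c ^+ 2 * mean (fun z => frob2 (x z)).
  rewrite -mean_Z; last exact: L2M_frob2.
  by apply: mean_ext => z _; exact: frob2Z.
by rewrite sqrtrM ?sqr_ge0// sqrtr_sqr ger0_norm ?normc_ge0.
Qed.

Section WeightedCoef.
Variables (n : nat) (q : C -> R) (S : int -> Prop).
Hypothesis mq : Tm q.
Hypothesis q2 : L1 (fun z => q z ^+ 2).

(** Used with two weights: |Psi|^{1/2} and negative indices for analyticity, the indicator of the
    zero set of Psi and all indices for vanishing. *)
Definition wcoef0 (x : C -> 'cV[C]_n) := L2M x /\
  forall i (s : int), S s -> fourier (fun z => (q z)%:C%C * x z i 0) s = 0.

Definition wdelta (s : int) (i : 'I_n) : C -> 'cV[C]_n := fun z => (q z)%:C%C *: deltaf s i 0 z.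

Lemma L2M_wdelta s i : L2M (wdelta s i).
Proof.
move=> a b; apply: C2_le q2.
  apply: Cm_ext (CmM (Cm_real mq) (C1_Cm (C2_C1 (@L2M_deltaf R n 1 s i 0 a b)))) => z _.
  by rewrite [RHS]mxE.
apply: aeTW => z z1; rewrite mxE normcM normcR exprMn real_normK ?num_real//.
rewrite ler_piMr ?sqr_ge0// exprn_ile1 ?normc_ge0// mxE normcM normc_expz// mul1r mxE.
by case: (_ && _); rewrite ?normc1 ?normc0.
Qed.

Lemma wcoef_cdot (x : C -> 'cV[C]_n) i s :
  fourier (fun z => (q z)%:C%C * x z i 0) s = Tint (fun z => cdot (x z) (wdelta s i z)).
Proof.
transitivity (fourier (fun z => ((fun z => (q z)%:C%C *: x z) z) i 0) s).
  by apply: Tint_ext => z _; rewrite mxE.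
rewrite fourier_cdot; apply: Tint_ext => z _.
by rewrite cdotZl [RHS]cdotZr; congr (_ * _); exact/esym/conjc_real.
Qed.

Lemma csub_wcoef0 : csub wcoef0.
Proof.
split.
- by move=> x [].
- split; first exact: L2M0.
  by move=> i s _; rewrite wcoef_cdot -[RHS](Tint_cst 0); apply: Tint_ext => z _; exact: cdot0l.
- move=> x y [xL x0] [yL y0]; split; first exact: L2MD.
  move=> i s Ss; rewrite wcoef_cdot -[RHS](addr0 0) -{1}(x0 i s Ss) -(y0 i s Ss) !wcoef_cdot.
  rewrite -TintD; do ?[by apply: cdot_C1 => //; exact: L2M_wdelta].
  by apply: Tint_ext => z _; rewrite cdotDl.
- move=> c x [xL x0]; split; first exact: L2MZ.
  move=> i s Ss; rewrite wcoef_cdot -[RHS](mulr0 c) -(x0 i s Ss) wcoef_cdot -TintZ.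
    by apply: Tint_ext => z _; rewrite cdotZl.
  by apply: cdot_C1 => //; exact: L2M_wdelta.
- move=> u x uW xL ux; split => // i s Ss; rewrite wcoef_cdot.
  apply: (Tint_cdot_lim _ xL (L2M_wdelta s i) ux) => k; have [uL u0] := uW k => //.
  by rewrite -wcoef_cdot u0.
Qed.

Lemma weighted_C1 (x : C -> 'cV[C]_n) i : L2M x -> C1 (fun z => (q z)%:C%C * x z i 0).
Proof.
move=> xL; apply: C2M (xL i 0); apply: C2_le (Cm_real mq) _ q2.
by apply: aeTW => z _; rewrite normcR real_normK ?num_real.
Qed.

End WeightedCoef.

Variables (n l : nat) (Psi : @mxfun R n n).
Hypothesis PsiH : Hp0M 1 Psi.
Hypothesis Psir : aeT (fun z => (\rank (Psi z) <= l)%N).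

Let PsiC i j : C1 (fun z => Psi z i j). Proof. by apply/inLp1P; exact: PsiH.1.1. Qed.
Let mPsi i j : Cm (fun z => Psi z i j). Proof. exact: C1_Cm (PsiC i j). Qed.

Let w z : R := opnorm (Psi z).
Let sw z : R := Num.sqrt (w z).
Let P z : 'M[C]_n := z^-1 *: Psi z.
(** The convention 0^-1 = 0 makes U vanish where Psi does, so that |U|^2 = |Psi| on the whole
    circle. *)
Let U z : 'M[C]_n := ((sw z)^-1)%:C%C *: P z.

Let mw : Tm w. Proof. exact: Tm_opnorm. Qed.
Let msw : Tm sw. Proof. exact: Tm_sqrt. Qed.
Let w0 z : 0 <= w z. Proof. exact: opnorm_ge0. Qed.
Let sw0 z : 0 <= sw z. Proof. exact: sqrtr_ge0. Qed.
Let sw2 z : sw z ^+ 2 = w z. Proof. exact: sqr_sqrtr. Qed.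

Lemma L1_opnorm_Psi : L1 w.
Proof.
have h : L1 (fun z => entsum (Psi z)).
  by apply: L1_sum => i; apply: L1_sum => j; exact: C1n.
apply: L1_le mw _ h; apply: aeTW => z _.
by rewrite ger0_norm// opnorm_le_entsum.
Qed.

Let w1 := L1_opnorm_Psi.

Lemma opnorm_P z : normc z = 1 -> opnorm (P z) = w z.
Proof. by move=> z1; rewrite opnormZ normcV z1 invr1 mul1r. Qed.

Lemma opnorm_U z : normc z = 1 -> opnorm (U z) ^+ 2 = w z.
Proof.
move=> z1; rewrite opnormZ opnorm_P// normcR ger0_norm ?invr_ge0// exprMn exprVn sw2.
have [->|w00] := eqVneq (w z) 0; first by rewrite expr0n mulr0.
by rewrite expr2 mulKf.
Qed.

Lemma sw_U z : (sw z)%:C%C *: U z = P z.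
Proof.
rewrite scalerA -rmorphM /=; have [s0|s0] := eqVneq (sw z) 0; last by rewrite mulfV// scale1r.
have : w z == 0 by rewrite -sw2 s0 expr0n.
rewrite s0 mul0r scale0r /P /w => /eqP wz0.
suff -> : Psi z = 0 by rewrite scaler0.
apply/matrixP => i j; rewrite mxE; apply/eqP; rewrite -normc_eq0 eq_le normc_ge0 andbT.
by rewrite -wz0 normc_le_opnorm.
Qed.

Lemma Cm_U i j : Cm (fun z => U z i j).
Proof.
have h := CmM (Cm_real (Tm_inv sw0 msw)) (CmM (Cm_expz (-1)) (mPsi i j)).
by apply: Cm_ext h => z _; rewrite !mxE exprN1.
Qed.

Let Uc (c : 'I_n) : C -> 'cV[C]_n := fun z => col c (U z).

Lemma frob2_colU z c : normc z = 1 -> frob2 (Uc c z) <= w z.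
Proof.
move=> z1; rewrite frob2_vnorm /Uc colE -opnorm_U//.
rewrite ler_pXn2r ?nnegrE ?vnorm_ge0 ?opnorm_ge0//.
by apply: le_trans (vnorm_mulmx _ _) _; rewrite vnorm_delta mulr1.
Qed.

Lemma L2M_Uc c : L2M (Uc c).
Proof.
apply: (L2M_le _ _ w1); last by apply: aeTW => z z1; exact: frob2_colU.
by move=> i j; apply: Cm_ext (Cm_U i c) => z _; rewrite [RHS]mxE.
Qed.

(** Encoding the smallest closed shift-invariant subspace as an intersection yields an induction
    principle: a property holds throughout once it defines such a subspace and holds for the columns
    of U. *)
Definition Wfac (x : C -> 'cV[C]_n) := forall K : (C -> 'cV[C]_n) -> Prop,
  csub K -> (forall x, K x -> K (shift 1 x)) -> (forall c, K (Uc c)) -> K x.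

Lemma csub_Wfac : csub Wfac.
Proof.
split.
- by move=> x xW; apply: (xW (@L2M R n 1)); [exact: csub_L2M|move=> y; exact: L2M_shift|exact: L2M_Uc].
- by move=> K cK sK UK; exact: cs_0 cK.
- by move=> x y xW yW K cK sK UK; apply: (cs_add cK); [exact: xW|exact: yW].
- by move=> c x xW K cK sK UK; apply: (cs_scale cK); exact: xW.
- by move=> u x uW xL ux K cK sK UK; by apply: (cs_lim cK _ xL ux) => k; apply: uW.
Qed.

Lemma shift_Wfac x : Wfac x -> Wfac (shift 1 x).
Proof. by move=> xW K cK sK UK; exact: (sK _ (xW K cK sK UK)). Qed.

Lemma Wfac_Uc c : Wfac (Uc c).
Proof. by move=> K _ _; apply. Qed.

Let L1_sw2 : L1 (fun z => sw z ^+ 2).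
Proof. by apply: L1_ext w1 => z _; rewrite sw2. Qed.

Lemma fourier_P i c (s : int) : s < 0 -> fourier (fun z => P z i c) s = 0.
Proof.
move=> s0; have := fourier_shift (fun z => Psi z i c) (-1) s.
rewrite (_ : fourier (fun z => z ^ (-1) * _) s = fourier (fun z => P z i c) s); last first.
  by apply: Tint_ext => z _; rewrite mxE exprN1.
move=> ->; rewrite opprK.
have [s1|s1] := eqVneq (s + 1) 0; first by rewrite s1; exact: PsiH.2.
by apply: PsiH.1.2; rewrite lt_neqAle s1/= lezD1.
Qed.

(** For the columns of U the weighted function is a column of Psi/z, which is analytic. Applied to
    wandering vectors, this gives the analyticity of the left factor. *)
Lemma Wfac_weighted x i (s : int) : Wfac x -> s < 0 ->
  fourier (fun z => (sw z)%:C%C * x z i 0) s = 0.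
Proof.
move=> xW s0; have [] := xW (wcoef0 sw (fun s => s < 0)); last by move=> _; apply.
- exact: csub_wcoef0.
- move=> y [yL y0]; split; first exact: L2M_shift.
  move=> j t t0; rewrite -(y0 j (t - 1)); last by rewrite subr_lt0 (lt_trans t0).
  by rewrite -fourier_shift; apply: Tint_ext => z _; rewrite mxE; congr (_ * _); ring.
- move=> c; split; first exact: L2M_Uc.
  move=> j t t0; rewrite -(fourier_P j c t0); apply: Tint_ext => z _.
  by rewrite -(sw_U z) mxE [in RHS]mxE.
Qed.

Let chi z : R := (w z == 0)%:R.

Lemma Tm_chi : Tm chi.
Proof.
rewrite /Tm /chi (_ : (fun t => _) = (fun t : R => if w (expi t) == 0 then 1 else 0)).
  apply: measurable_fun_ifT => //; apply: measurable_fun_eqr => //; exact: mw.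
by apply/funext => t; case: ifP.
Qed.

Lemma L1_chi : L1 (fun z => chi z ^+ 2).
Proof.
apply: L1_le (TmX 2 Tm_chi) _ (L1_cst 1); apply: aeTW => z _.
by rewrite /chi; case: eqP => _; rewrite ?expr1n ?expr0n ?normr1 ?normr0.
Qed.

(** Where Psi = 0 the columns of U are zero; expressed through coefficients against the indicator
    [chi], this property passes to limits. *)
Lemma Wfac_vanish x : Wfac x -> aeT (fun z => w z = 0 -> x z = 0).
Proof.
move=> xW; have [] := xW (wcoef0 chi (fun=> True)).
- exact: csub_wcoef0 Tm_chi L1_chi.
- move=> y [yL y0]; split; first exact: L2M_shift.
  move=> j t _; rewrite -(y0 j (t - 1) I).
  by rewrite -fourier_shift; apply: Tint_ext => z _; rewrite mxE; congr (_ * _); ring.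
- move=> c; split; first exact: L2M_Uc.
  move=> j t _; rewrite -[RHS](Tint_cst 0); apply: Tint_ext => z _.
  rewrite /chi; case: eqP => wz; last by rewrite mul0r mul0r.
  by rewrite /Uc mxE /U /sw wz sqrtr0 invr0 scale0r mxE mulr0 mul0r.
move=> xL x0.
have : aeT (fun z => forall i, (chi z)%:C%C * x z i 0 = 0).
  apply: aeT_forall => i; apply: FzeroP; split; last by move=> s; exact: x0.
  exact: weighted_C1 Tm_chi L1_chi _ _ xL.
apply: aeT_mono => z _ h wz; apply/matrixP => i j; rewrite ord1 mxE.
by have := h i; rewrite /chi wz eqxx mul1r.
Qed.

(** The weight turns divisibility by every z^N into the vanishing of all coefficients of |Psi|^{1/2}
    x; on the zero set of Psi, x vanishes already. *)
Lemma Wfac_pure x : Wfac x -> (forall s : nat, Wfac (shift (- s%:Z) x)) -> aeT (fun z => x z = 0).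
Proof.
move=> xW sxW; have xL := cs_D csub_Wfac xW.
have h : aeT (fun z => forall i, (sw z)%:C%C * x z i 0 = 0).
  apply: aeT_forall => i; apply: FzeroP; split; first exact: weighted_C1.
  move=> s; have [N sN] : exists N : nat, s < N%:Z.
    by exists `|s|%N.+1; apply: (le_lt_trans (ler_norm s)); rewrite -abszE ltz_nat.
  have := Wfac_weighted i (sxW N) (_ : s - N%:Z < 0); rewrite subr_lt0 => /(_ sN) <-.
  have := fourier_shift (fun z => (sw z)%:C%C * x z i 0) (- N%:Z) (s - N%:Z).
  rewrite opprK subrK => <-.
  by apply: Tint_ext => z _; rewrite mxE; congr (_ * _); ring.
apply: aeT2 h (Wfac_vanish xW) => z _ h1 h2.
have [wz|wz] := eqVneq (w z) 0; first exact: h2.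
have sz : sw z != 0 by rewrite -sqrf_eq0 sw2.
apply/matrixP => i j; rewrite ord1 mxE; apply/eqP; have /eqP := h1 i.
by rewrite mulf_eq0 => /orP[|//]; rewrite -[0]/(0%:C%C) (inj_eq (@complexI R)) (negbTE sz).
Qed.

(** The approximants take their values in the range of U(z), of dimension at most l. Shifts and
    linear combinations only change q, of which nothing but square integrability of U q is asked. *)
Lemma Wfac_approx x (e : R) : Wfac x -> 0 < e -> exists2 q : C -> 'cV[C]_n,
  L2M (fun z => U z *m q z) & hnorm (@L2ip R n 1) (x - (fun z => U z *m q z)) < e.
Proof.
move=> xW; have Hb := @L2_hilbert R n 1.
pose K (x : C -> 'cV[C]_n) := L2M x /\ forall e : R, 0 < e -> exists2 q : C -> 'cV[C]_n,
  L2M (fun z => U z *m q z) & hnorm (@L2ip R n 1) (x - (fun z => U z *m q z)) < e.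
suff [_ h] : K x by exact: h.
apply: xW.
- split.
  + by move=> y [].
  + split; first exact: L2M0.
    move=> d d0; have E : (fun z => U z *m 0) = (0 : C -> 'cV[C]_n).
      by apply/funext => z; exact: mulmx0.
    by exists (fun=> 0); rewrite E; [exact: L2M0|rewrite subrr (hnorm0 Hb)].
  + move=> a b [aL ha] [bL hb]; split; first exact: L2MD.
    move=> d d0; have d2 : 0 < d / 2 by rewrite divr_gt0.
    have [q qL qd] := ha _ d2; have [p pL pd] := hb _ d2.
    have E : (fun z => U z *m (q z + p z)) = (fun z => U z *m q z) + (fun z => U z *m p z).
      by apply/funext => z; exact: mulmxDr.
    exists (fun z => q z + p z); rewrite E; first exact: L2MD.
    rewrite opprD addrACA; apply: le_lt_trans (hnormD Hb _ _) _; do ?exact: L2MB.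
    by rewrite [d]splitr; exact: ltrD qd pd.
  + move=> c a [aL ha]; split; first exact: L2MZ.
    move=> d d0; have c1 : 0 < normc c + 1 by rewrite ltr_wpDl ?normc_ge0.
    have [q qL qd] := ha _ (divr_gt0 d0 c1).
    have E : (fun z => U z *m (c *: q z)) = c *: (fun z => U z *m q z).
      by apply/funext => z; exact: (esym (scalemxAr _ _ _)).
    exists (fun z => c *: q z); rewrite E; first exact: L2MZ.
    rewrite -scalerBr hnormZC; last exact: L2MB.
    move: qd; rewrite ltr_pdivlMr//; apply: le_lt_trans.
    rewrite mulrC; apply: ler_wpM2l; first exact: hnorm_ge0.
    by rewrite lerDl.
  + move=> u y uK yL uy; split => // d d0; have d2 : 0 < d / 2 by rewrite divr_gt0.
    have /cvgrPdist_lt/(_ _ d2)[N _ /(_ N (leqnn N))] := uy.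
    rewrite /= sub0r normrN ger0_norm ?hnorm_ge0// => uNy.
    have [uL hu] := uK N; have [q qL qd] := hu _ d2.
    exists q => //; have -> : y - (fun z => U z *m q z) = - (u N - y) + (u N - (fun z => U z *m q z)).
      by rewrite opprB addrA subrK.
    apply: le_lt_trans (hnormD Hb _ _) _; [exact/(h_DN Hb)/L2MB|exact: L2MB|].
    by rewrite (hnormN Hb); [rewrite [d]splitr; exact: ltrD uNy qd|exact: L2MB].
- move=> y [yL hy]; split; first exact: L2M_shift.
  move=> d d0; have [q qL qd] := hy _ d0.
  have E : (fun z => U z *m (z ^ 1 *: q z)) = shift 1 (fun z => U z *m q z).
    by apply/funext => z; rewrite /shift -scalemxAr.
  exists (fun z => z ^ 1 *: q z); rewrite E; first exact: L2M_shift.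
  by rewrite -shiftB hnorm_shift.
- move=> c; split; first exact: L2M_Uc.
  move=> d d0; have E : (fun z => U z *m delta_mx c 0) = Uc c by apply/funext => z; rewrite -colE.
  by exists (fun=> delta_mx c 0); rewrite E; [exact: L2M_Uc|rewrite subrr (hnorm0 Hb)].
Qed.

(** At a point z, l+1 orthonormal vectors cannot all be close to a space of dimension l: their
    squared distances to vectors of it sum to at least 1. Approximation in mean contradicts this. *)
Lemma wfamily_rank r (v : nat -> C -> 'cV[C]_n) : wfamily Wfac r v -> (r <= l)%N.
Proof.
move=> [wv vo]; rewrite leqNgt; apply/negP => lr.
have il (i : 'I_l.+1) : (i < r)%N by rewrite (leq_trans _ lr)// ltn_ord.
have vW (i : 'I_l.+1) : Wfac (v i) by have [] := wv i (il i).
(* With this choice the l+1 squared errors sum to at most (l+1)/(l+2)^2 < 1. *)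
pose e : R := l.+2%:R^-1.
have e0 : 0 < e by rewrite invr_gt0.
have /choice[q qP] : forall i : 'I_l.+1, exists q : C -> 'cV[C]_n,
    L2M (fun z => U z *m q z) /\ hnorm (@L2ip R n 1) (v i - (fun z => U z *m q z)) < e.
  by move=> i; have [q qL qe] := Wfac_approx (vW i) e0; exists q.
pose d (i : 'I_l.+1) z := v i z - U z *m q i z.
have dL i : L2M (d i) by apply: L2MB; [exact: (cs_D csub_Wfac (vW i))|exact: (qP i).1].
have dI i : mean (fun z => frob2 (d i z)) < e ^+ 2.
  have := (qP i).2; rewrite hnormE => h.
  rewrite -[ltLHS]sqr_sqrtr; last by apply: mean_ge0 => z; exact: frob2_ge0.
  by rewrite ltr_pXn2r ?nnegrE ?sqrtr_ge0 ?(ltW e0).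
have key : aeT (fun z => 1 <= \sum_i frob2 (d i z)).
  apply: aeT2 Psir vo => z _ rz oz.
  pose V1 : 'M[C]_(n, l.+1) := \matrix_(a, i) v i z a 0.
  pose Q : 'M[C]_(n, l.+1) := \matrix_(a, i) q i z a 0.
  have V1o : adj V1 *m V1 = 1%:M.
    apply/matrixP => i j; rewrite mxE [RHS]mxE -val_eqE /= eq_sym -(oz j i (il j) (il i)).
    by apply: eq_bigr => a _; rewrite big_ord1 !mxE mulrC.
  have rUQ : (\rank (U z *m Q) < l.+1)%N.
    rewrite ltnS (leq_trans (mxrankM_maxl _ _))//; apply: leq_trans rz.
    by apply: mxrankS; rewrite !scalemx_sub.
  (* On a vector annihilated by U Q the difference V1 - U Q acts as the isometry V1, so its norm is
     at least 1. *)
  have [y y0 UQy] := rank_lt_kernel rUQ.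
  have vy : 0 < vnorm y by rewrite lt_neqAle vnorm_ge0 andbT eq_sym vnorm_eq0.
  have V1y : vnorm (V1 *m y) = vnorm y.
    apply/eqP; rewrite -(@eqrXn2 _ 2) ?vnorm_ge0// -(inj_eq (@complexI R)) -!vdotxx.
    by rewrite vdot_adj mulmxA V1o mul1mx.
  have E1 : 1 <= opnorm (V1 - U z *m Q).
    rewrite -(ler_pM2r vy) mul1r; apply: le_trans (vnorm_mulmx _ _).
    by rewrite mulmxBl UQy subr0 V1y.
  apply: (@le_trans _ _ (frob2 (V1 - U z *m Q))).
    by apply: le_trans (opnorm_le_frob2 _); rewrite exprn_ege1.
  rewrite /frob2 exchange_big /=; apply: ler_sum => i _; apply: ler_sum => a _.
  rewrite big_ord1 le_eqVlt; apply/orP; left; apply/eqP; congr (normc _ ^+ 2).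
  rewrite /d.
  rewrite !mxE; congr (_ - _); apply: eq_bigr => b _.
  by rewrite !mxE.
have fL i : L1 (fun z => frob2 (d i z)) by exact: L2M_frob2.
have := mean_le (L1_cst 1) (L1_sum (index_enum _) xpredT fL) key.
rewrite mean_cst mean_sum// => h.
have : \sum_(i < l.+1) mean (fun z => frob2 (d i z)) <= \sum_(i < l.+1) e ^+ 2.
  by apply: ler_sum => i _; exact/ltW/dI.
rewrite sumr_const card_ord -mulr_natl => /(le_trans h).
rewrite /e exprVn ler_pdivlMr ?exprn_gt0// mul1r leNgt => /negP; apply.
by rewrite -natrX ltr_nat expnS expn1 mulSn ltn_addr.
Qed.

Theorem H1_factorization : exists (F : @mxfun R n l) (G : @mxfun R l n),
  [/\ HpM 2 F, Hp0M 2 G, aeT (fun z => Psi z = F z *m G z),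
    aeT (fun z => opnorm (F z) ^+ 2 <= opnorm (Psi z)) &
    aeT (fun z => opnorm (G z) ^+ 2 <= opnorm (Psi z))].
Proof.
have [r [v [rl fv vspan]]] := wandering_basis csub_Wfac shift_Wfac Wfac_pure wfamily_rank.
have vW j : (j < r)%N -> Wfac (v j) by move=> jr; have [] := fv.1 j jr.
have vL j : (j < r)%N -> L2M (v j) by move=> /vW/(cs_D csub_Wfac).
(* The inner dimension has to be l, so the r wandering vectors are padded with zero columns. *)
pose Vr z : 'M[C]_(n, l) := \matrix_(a, j) (if (j < r)%N then v j z a 0 else 0).
pose F : @mxfun R n l := fun z => (sw z)%:C%C *: Vr z.
pose G : @mxfun R l n := fun z => z *: (adj (Vr z) *m U z).
have VrE : aeT (fun z => adj (Vr z) *m Vr z = \matrix_(i, j) ((i == j) && (i < r)%N)%:R).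
  apply: aeT_mono fv.2 => z _ h; apply/matrixP => i j; rewrite mxE [RHS]mxE.
  have [ir|ir] := boolP (i < r)%N; last first.
    rewrite andbF big1// => a _; rewrite !mxE (negbTE ir) -[_^*%R]/(conjc 0) conjc0.
    by rewrite mul0r.
  have [jr|jr] := boolP (j < r)%N; last first.
    rewrite big1 => [|a _]; last by rewrite [Vr z a j]mxE (negbTE jr) mulr0.
    by case: eqP => // ij; rewrite -ij ir in jr.
  rewrite andbT -val_eqE /= eq_sym -(h j i jr ir).
  by apply: eq_bigr => a _; rewrite big_ord1 !mxE ir jr mulrC.
have Vr1 : aeT (fun z => opnorm (Vr z) <= 1).
  apply: aeT_mono VrE => z _ h; apply: opnorm_le => // y; rewrite mul1r.
  rewrite -(@ler_pXn2r _ 2) ?nnegrE ?vnorm_ge0// -lecR -!vdotxx vdot_adj mulmxA h.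
  rewrite vdotxx vnorm_sq rmorph_sum /= /vdot; apply: ler_sum => i _.
  rewrite mxE (bigD1 i)//= big1 ?addr0 => [|j ji]; last first.
    by rewrite mxE eq_sym (negbTE ji) mul0r.
  rewrite mxE eqxx/=; case: (i < r)%N; first by rewrite mul1r mulcJ.
  by rewrite mul0r conjc0 mulr0 lecR sqr_ge0.
(* The columns of U lie in the subspace, so the pointwise projection onto the wandering vectors
   fixes them. *)
have UE : aeT (fun z => U z = Vr z *m (adj (Vr z) *m U z)).
  have : aeT (fun z => forall c, Uc c z = wproj r v (Uc c) z).
    by apply: aeT_forall => c; apply: vspan; exact: Wfac_Uc.
  apply: aeT_mono => z _ h; apply/matrixP => a c.
  have := congr1 (fun A : 'cV[C]_n => A a 0) (h c); rewrite {1}/Uc mxE => ->.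
  rewrite mxE /wproj summxE.
  rewrite (big_ord_widen_cond l xpredT (fun j => (cdot (Uc c z) (v j z) *: v j z) a 0) rl)/=.
  rewrite big_mkcond /=; apply: eq_bigr => j _; rewrite [Vr z a j]mxE.
  case: ifP => jr; last by rewrite mul0r.
  rewrite mxE mulrC; congr (_ * _); rewrite mxE; apply: eq_bigr => b _.
  by rewrite big_ord1 mulrC !mxE jr.
have PFG : aeT (fun z => Psi z = F z *m G z).
  apply: aeT_mono UE => z z1 h.
  rewrite /F /G -scalemxAl -scalemxAr -h scalerA mulrC -scalerA sw_U /P.
  by rewrite scalerA mulfV ?scale1r// circ_neq0.
have mVr a j : Cm (fun z => Vr z a j).
  have [jr|jr] := boolP (j < r)%N.
    by apply: Cm_ext (vL j jr a 0).1 => z _; rewrite mxE jr.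
  by apply: Cm_ext (Cm_cst 0) => z _; rewrite mxE (negbTE jr).
exists F, G; split.
- apply/H2MP; split.
    move=> a j; apply: C2_le _ _ w1.
      by apply: Cm_ext (CmM (Cm_real msw) (mVr a j)) => z _; rewrite [RHS]mxE.
    apply: aeT_mono Vr1 => z _ h; rewrite mxE normcM normcR exprMn real_normK ?num_real// sw2.
    by rewrite ler_piMr// exprn_ile1 ?normc_ge0// (le_trans (normc_le_opnorm _ _ _) h).
  move=> a j s s0; have [jr|jr] := boolP (j < r)%N.
    rewrite -(Wfac_weighted a (vW j jr) s0); apply: Tint_ext => z _.
    by rewrite !mxE jr.
  rewrite -[RHS](Tint_cst 0); apply: Tint_ext => z _.
  by rewrite !mxE (negbTE jr) mulr0 mul0r.
(* The entries of V^* U have no coefficients of index < 0 because the vectors wander; the factor z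
   extends this to index 0. *)
- have GE j c (s : int) : s <= 0 -> fourier (fun z => G z j c) s = 0.
    move=> s0; have [jr|jr] := boolP (j < r)%N; last first.
      rewrite -[RHS](Tint_cst 0); apply: Tint_ext => z _.
      rewrite !mxE big1 ?mulr0 ?mul0r// => a _.
      by rewrite !mxE (negbTE jr) -[_^*%R]/(conjc 0) conjc0 mul0r.
    have s1 : s - 1 < 0 by rewrite subr_lt0 (le_lt_trans s0).
    rewrite -(wcoef_analytic fv (Ordinal jr) (Wfac_Uc c) s1) -fourier_shift.
    apply: Tint_ext => z _; rewrite mxE expr1z; congr (_ * _ * _).
    rewrite mxE; apply: eq_bigr => a _.
    by rewrite big_ord1 mulrC !mxE jr.
  split; last by move=> j c; exact: GE.
  apply/H2MP; split; last by move=> j c s s0; apply: GE; exact: ltW.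
  move=> j c; apply: C2_le _ _ w1.
    apply: Cm_ext (CmM Cm_id (Cm_sum (index_enum _) xpredT (fun a => CmM (CmJ (mVr a j)) (Cm_U a c)))) => z _.
    rewrite [RHS]mxE; congr (_ * _); rewrite [RHS]mxE; apply: eq_bigr => a _.
    by rewrite [X in _ = X * _]mxE [X in _ = Num.conj X * _]mxE.
  apply: aeT_mono Vr1 => z z1 h; rewrite mxE normcM z1 mul1r -opnorm_U//.
  rewrite ler_pXn2r ?nnegrE ?normc_ge0 ?opnorm_ge0//.
  apply: le_trans (normc_le_opnorm _ _ _) _; apply: le_trans (opnormM _ _) _.
  by rewrite opnorm_adj ler_piMl// opnorm_ge0.
- exact: PFG.
- apply: aeT_mono Vr1 => z _ h; rewrite opnormZ normcR exprMn real_normK ?num_real// sw2.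
  by rewrite ler_piMr// exprn_ile1// opnorm_ge0.
- apply: aeT_mono Vr1 => z z1 h; rewrite opnormZ z1 mul1r -/(w z) -opnorm_U//.
  rewrite ler_pXn2r ?nnegrE ?opnorm_ge0//; apply: le_trans (opnormM _ _) _.
  by rewrite opnorm_adj ler_piMl// opnorm_ge0.
Qed.

End Factorization.

(** * L^2 norms for the operator and trace norms, and essential suprema *)

Section Norms.
Context {R : realType}.
Local Notation C := (R[i]).

Definition N2 m k (nrm : 'M[C]_(m, k) -> R) (F : C -> 'M[C]_(m, k)) : R :=
  Num.sqrt (mean (fun z => nrm (F z) ^+ 2)).

Lemma N2_ge0 m k (nrm : 'M[C]_(m, k) -> R) F : 0 <= N2 nrm F.
Proof. exact: sqrtr_ge0. Qed.

Lemma N2_sq m k (nrm : 'M[C]_(m, k) -> R) F : N2 nrm F ^+ 2 = mean (fun z => nrm (F z) ^+ 2).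
Proof. by rewrite sqr_sqrtr//; apply: mean_ge0 => z; exact: sqr_ge0. Qed.

Lemma LpNorm2E m k (nrm : 'M[C]_(m, k) -> R) F : (forall A, 0 <= nrm A) ->
  L1 (fun z => nrm (F z) ^+ 2) -> LpNorm 2 nrm F = (N2 nrm F)%:E.
Proof.
move=> n0 FL; rewrite /LpNorm.
rewrite (_ : (fun t => _) = (fun t : R => (nrm (F (expi t)) ^+ 2)%:E)); last first.
  by apply/funext => t; rewrite powR_mulrn.
rewrite (@Tint_e_L1 _ (fun z => nrm (F z) ^+ 2))//; last by move=> z; exact: sqr_ge0.
by rewrite poweR_EFin powR12_sqrt//; apply: mean_ge0 => z; exact: sqr_ge0.
Qed.

Lemma LpNorm1E m k (nrm : 'M[C]_(m, k) -> R) F : (forall A, 0 <= nrm A) ->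
  L1 (fun z => nrm (F z)) -> LpNorm 1 nrm F = (mean (fun z => nrm (F z)))%:E.
Proof.
move=> n0 FL; rewrite /LpNorm.
rewrite (_ : (fun t => _) = (fun t : R => (nrm (F (expi t)))%:E)); last first.
  by apply/funext => t; rewrite powRr1.
rewrite (@Tint_e_L1 _ (fun z => nrm (F z)))// poweR_EFin invr1 powRr1//.
by apply: mean_ge0 => z.
Qed.

(** This is the inequality of the Hilbert space of 1 x 1 matrix functions. *)
Lemma mean_CauchySchwarz (a b : C -> R) : Tm a -> Tm b ->
  L1 (fun z => a z ^+ 2) -> L1 (fun z => b z ^+ 2) ->
  L1 (fun z => a z * b z) /\
  mean (fun z => a z * b z) <= Num.sqrt (mean (fun z => a z ^+ 2)) * Num.sqrt (mean (fun z => b z ^+ 2)).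
Proof.
move=> ma mb a2 b2.
have C2r (f : C -> R) : Tm f -> L1 (fun z => f z ^+ 2) -> C2 (fun z => (f z)%:C%C).
  move=> mf f2; split; first exact: Cm_real.
  by apply: L1_ext f2 => z _; rewrite normcR real_normK ?num_real.
have aL := sc_L2M (C2r _ ma a2); have bL := sc_L2M (C2r _ mb b2).
have ripE z : rip (sc (fun z => (a z)%:C%C) z) (sc (fun z => (b z)%:C%C) z) = a z * b z.
  by rewrite rip_cdot cdot11 !mxE Re_M /= mul0r subr0.
split; first by apply: L1_ext (rip_L1 aL bL) => z _; rewrite ripE.
have hE (f : C -> R) : hnorm (@L2ip R 1 1) (sc (fun z => (f z)%:C%C)) = Num.sqrt (mean (fun z => f z ^+ 2)).
  rewrite hnormE; congr Num.sqrt; apply: mean_ext => z _.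
  by rewrite /frob2 !big_ord1 mxE normcR real_normK ?num_real.
rewrite -!hE; apply: le_trans (h_CauchySchwarz (@L2_hilbert R 1 1) aL bL).
apply: le_trans (ler_norm _); rewrite le_eqVlt; apply/orP; left; apply/eqP.
by apply: mean_ext => z _; rewrite ripE.
Qed.

Section MatrixNorm.
Variables (m k : nat) (nrm : 'M[C]_(m, k) -> R) (c : R).
Hypothesis nrm0 : forall A, 0 <= nrm A.
Hypothesis nrmD : forall A B, nrm (A + B) <= nrm A + nrm B.
Hypothesis nrmZ : forall a A, nrm (a *: A) <= normc a * nrm A.
Hypothesis mnrm : forall F : C -> 'M[C]_(m, k), (forall i j, Cm (fun z => F z i j)) ->
  Tm (fun z => nrm (F z)).
Hypothesis c0 : 0 <= c.
Hypothesis nrm_frob2 : forall A, nrm A ^+ 2 <= c ^+ 2 * frob2 A.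

Lemma L2M_Cm (F : C -> 'M[C]_(m, k)) : L2M F -> forall i j, Cm (fun z => F z i j).
Proof. by move=> FL i j; exact: (FL i j).1. Qed.

Lemma N2_L1 F : L2M F -> L1 (fun z => nrm (F z) ^+ 2).
Proof.
move=> FL; apply: L1_le (TmX 2 (mnrm (L2M_Cm FL))) _ (L1Z (c ^+ 2) (L2M_frob2 FL)).
by apply: aeTW => z _; rewrite ger0_norm ?sqr_ge0.
Qed.

Lemma N2_hnorm F : L2M F -> N2 nrm F <= c * hnorm (@L2ip R m k) F.
Proof.
move=> FL; rewrite hnormE -[c](ger0_norm c0) -sqrtr_sqr -sqrtrM ?sqr_ge0// ler_wsqrtr//.
rewrite -mean_Z; last exact: L2M_frob2.
apply: mean_le; [exact: N2_L1|exact/L1Z/L2M_frob2|by apply: aeTW].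
Qed.

Lemma N2D F G : L2M F -> L2M G -> N2 nrm (F + G) <= N2 nrm F + N2 nrm G.
Proof.
move=> FL GL; rewrite -(@ler_pXn2r _ 2) ?nnegrE ?addr_ge0 ?N2_ge0// sqrrD !N2_sq.
have mF := mnrm (L2M_Cm FL); have mG := mnrm (L2M_Cm GL).
have [ab abI] := mean_CauchySchwarz mF mG (N2_L1 FL) (N2_L1 GL).
apply: (@le_trans _ _ (mean (fun z => nrm (F z) ^+ 2 + 2 * (nrm (F z) * nrm (G z)) + nrm (G z) ^+ 2))).
  apply: mean_le; first exact/N2_L1/L2MD.
    by apply: L1D (N2_L1 GL); apply: L1D (N2_L1 FL) _; exact: L1Z.
  apply: aeTW => z _; apply: (@le_trans _ _ ((nrm (F z) + nrm (G z)) ^+ 2)).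
    by rewrite ler_pXn2r ?nnegrE ?addr_ge0//; exact: nrmD.
  by rewrite sqrrD mulr_natl.
rewrite mean_D; [|by apply: L1D (N2_L1 FL) _; exact: L1Z|exact: N2_L1].
rewrite mean_D; [|exact: N2_L1|exact: L1Z].
by rewrite mean_Z// lerD2r lerD2l -(mulr_natl (_ * _)) ler_pM2l.
Qed.

Lemma N2Z (a : C) F : L2M F -> N2 nrm (a *: F) <= normc a * N2 nrm F.
Proof.
move=> FL; rewrite -[normc a](ger0_norm (normc_ge0 _)) -sqrtr_sqr -sqrtrM ?sqr_ge0// ler_wsqrtr//.
rewrite -mean_Z; last exact: N2_L1.
apply: mean_le; [exact/N2_L1/L2MZ|exact/L1Z/N2_L1|apply: aeTW => z _].
by rewrite -exprMn ler_pXn2r ?nnegrE ?mulr_ge0 ?normc_ge0//; exact: nrmZ.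
Qed.

End MatrixNorm.

Section OpTr.
Variables m k : nat.
Implicit Types F G : C -> 'M[C]_(m, k).

(** The factor [1 ^+ 2] matches the hypothesis [nrm_frob2], common to both norms. *)
Lemma opnorm_frob2_c (A : 'M[C]_(m, k)) : opnorm A ^+ 2 <= 1 ^+ 2 * frob2 A.
Proof. by rewrite expr1n mul1r opnorm_le_frob2. Qed.

Lemma trnorm_frob2_c (A : 'M[C]_(m, k)) : trnorm A ^+ 2 <= (minn m k)%:R ^+ 2 * frob2 A.
Proof.
apply: (@le_trans _ _ (((minn m k)%:R * opnorm A) ^+ 2)).
  by rewrite ler_pXn2r ?nnegrE ?mulr_ge0 ?trnorm_ge0 ?opnorm_ge0 ?trnorm_le_opnorm.
by rewrite exprMn ler_wpM2l ?sqr_ge0 ?opnorm_le_frob2.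
Qed.

Lemma L1_op2 F : L2M F -> L1 (fun z => opnorm (F z) ^+ 2).
Proof. apply: (@N2_L1 m k _ 1); [exact: Tm_opnorm|exact: opnorm_frob2_c]. Qed.
Lemma L1_tr2 F : L2M F -> L1 (fun z => trnorm (F z) ^+ 2).
Proof. apply: (@N2_L1 m k _ (minn m k)%:R); [exact: Tm_trnorm|exact: trnorm_frob2_c]. Qed.

Lemma N2opD F G : L2M F -> L2M G -> N2 (@opnorm R m k) (F + G) <= N2 (@opnorm R m k) F + N2 (@opnorm R m k) G.
Proof.
apply: (@N2D m k _ 1); [exact: opnorm_ge0|exact: opnormD|exact: Tm_opnorm|exact: opnorm_frob2_c].
Qed.
Lemma N2trD F G : L2M F -> L2M G -> N2 (@trnorm R m k) (F + G) <= N2 (@trnorm R m k) F + N2 (@trnorm R m k) G.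
Proof.
apply: (@N2D m k _ (minn m k)%:R); [exact: trnorm_ge0|exact: trnormD|exact: Tm_trnorm|exact: trnorm_frob2_c].
Qed.
Lemma N2opZ a F : L2M F -> N2 (@opnorm R m k) (a *: F) <= normc a * N2 (@opnorm R m k) F.
Proof.
apply: (@N2Z m k _ 1); [exact: opnorm_ge0|exact: opnormZ_le|exact: Tm_opnorm|exact: opnorm_frob2_c].
Qed.
Lemma N2trZ a F : L2M F -> N2 (@trnorm R m k) (a *: F) <= normc a * N2 (@trnorm R m k) F.
Proof.
apply: (@N2Z m k _ (minn m k)%:R); [exact: trnorm_ge0|exact: trnormZ_le|exact: Tm_trnorm|exact: trnorm_frob2_c].
Qed.
Lemma N2op_hnorm F : L2M F -> N2 (@opnorm R m k) F <= hnorm (@L2ip R m k) F.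
Proof.
move=> FL; rewrite -[leRHS]mul1r; apply: (@N2_hnorm m k _ 1) => //; [exact: Tm_opnorm|exact: opnorm_frob2_c].
Qed.
Lemma N2tr_hnorm F : L2M F -> N2 (@trnorm R m k) F <= (minn m k)%:R * hnorm (@L2ip R m k) F.
Proof.
apply: (@N2_hnorm m k _ (minn m k)%:R) => //; [exact: Tm_trnorm|exact: trnorm_frob2_c].
Qed.

Lemma hnorm_N2op F : L2M F -> L2ip F F <= (m * k)%:R * N2 (@opnorm R m k) F ^+ 2.
Proof.
move=> FL; rewrite N2_sq -mean_Z; last exact: L1_op2.
apply: mean_le; [exact: rip_L1|exact/L1Z/L1_op2|apply: aeTW => z _].
by rewrite rip_frob2 frob2_le.
Qed.

End OpTr.

Lemma trace_C1 m k (A : C -> 'M[C]_(m, k)) (B : C -> 'M[C]_(k, m)) : L2M A -> L2M B ->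
  C1 (fun z => \tr (A z *m B z)).
Proof.
move=> AL BL; have : C1 (fun z => \sum_i \sum_j A z i j * B z j i).
  by apply: C1_sum => i; apply: C1_sum => j; exact: C2M.
by apply: C1_ext => z _; apply: eq_bigr => i _; rewrite mxE.
Qed.

Lemma Tint_trace_le m k (A : C -> 'M[C]_(m, k)) (B : C -> 'M[C]_(k, m)) : L2M A -> L2M B ->
  normc (Tint (fun z => \tr (A z *m B z))) <= N2 (@trnorm R m k) A * N2 (@opnorm R k m) B.
Proof.
move=> AL BL.
have mA := Tm_trnorm (L2M_Cm AL); have mB := Tm_opnorm (L2M_Cm BL).
have [ab abI] := mean_CauchySchwarz mA mB (L1_tr2 AL) (L1_op2 BL).
apply: le_trans (normc_Tint_le (trace_C1 AL BL)) _; apply: le_trans abI.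
apply: mean_le => //; first exact/C1n/trace_C1.
by apply: aeTW => z _; exact: trace_le_trnorm.
Qed.

(** The circle has positive measure, so it is not a null set. *)
Lemma aeT_cst (P : Prop) : aeT (fun _ : C => P) -> P.
Proof.
move=> aP; apply: contrapT => nP.
have : mean (fun _ : C => 1 : R) <= mean (fun _ : C => 0 : R).
  by apply: mean_le; [exact: L1_cst|exact: L1_cst|apply: aeT_mono aP].
by rewrite !mean_cst ler10.
Qed.

(** The infimum that defines the essential supremum is attained: the countably many exceptional sets
    for the bounds r + 1/(n+1) have a null union. *)
Lemma esssup_le (g : C -> R) (r : R) : (esssup g <= r%:E)%E <-> aeT (fun z => g z <= r).
Proof.
split=> [gr|gr]; last first.
  by apply: ereal_inf_lbound; apply: (ae_muS _ gr) => t h /h; rewrite lee_fin.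
have h n : aeT (fun z => g z <= r + n.+1%:R^-1).
  have : (esssup g < (r + n.+1%:R^-1)%:E)%E.
    by apply: le_lt_trans gr _; rewrite lte_fin ltrDl invr_gt0.
  move=> /ereal_inf_lt[y yP yr]; apply: (ae_muS _ yP) => t p /p q.
  by rewrite -lee_fin (le_trans q (ltW yr)).
apply: aeT_mono (aeT_foralln h) => z _ zP; apply/ler_addgt0Pr => e e0.
have [N _ NP] := near_infty_natSinv_lt (PosNum e0).
by apply: le_trans (zP N) _; rewrite lerD2l ltW//; exact: (NP N (leqnn N)).
Qed.

Lemma esssup_ge0 (g : C -> R) : (forall z, 0 <= g z) -> (0 <= esssup g)%E.
Proof.
move=> g0; apply: le_ereal_inf_tmp => y yP; rewrite leNgt; apply/negP => y0.
apply: (@aeT_cst False); apply: (ae_muS _ yP) => t h /h gy.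
by have := lt_le_trans (le_lt_trans gy y0) (_ : (0 <= (g (expi t))%:E)%E); rewrite lee_fin ltxx => /(_ (g0 _)).
Qed.

Lemma esssup_fin (g : C -> R) : (forall z, 0 <= g z) -> (esssup g < +oo)%E ->
  exists2 r, 0 <= r & esssup g = r%:E.
Proof.
move=> g0 gf; have p := esssup_ge0 g0.
exists (fine (esssup g)); first exact: fine_ge0.
by rewrite fineK// ge0_fin_numE.
Qed.

Lemma LinfMP m k (F : C -> 'M[C]_(m, k)) :
  LinfM F <-> (forall i j, Cm (fun z => F z i j)) /\ exists M, aeT (fun z => opnorm (F z) <= M).
Proof.
split=> [FL|[mF [M FM]] i j]; last first.
  split; first exact: mF.
  apply: (@le_lt_trans _ _ M%:E); last exact: ltry.
  by apply/esssup_le; apply: aeT_mono FM => z _; apply: le_trans; exact: normc_le_opnorm.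
split=> [i j|]; first exact: (FL i j).1.
have h (ij : 'I_m * 'I_k) : exists r, aeT (fun z => normc (F z ij.1 ij.2) <= r).
  have [r _ rE] := esssup_fin (fun z => normc_ge0 (entry F ij.1 ij.2 z)) (FL ij.1 ij.2).2.
  by exists r; apply/esssup_le; rewrite -rE.
have /choice[r rP] := h.
exists (\sum_i \sum_j r (i, j)); apply: aeT_mono (aeT_forall rP) => z _ zr.
apply: le_trans (opnorm_le_entsum _) _; apply: ler_sum => i _; apply: ler_sum => j _.
exact: (zr (i, j)).
Qed.

Lemma L2M_LinfM m k (F : C -> 'M[C]_(m, k)) : LinfM F -> L2M F.
Proof.
move=> /LinfMP[mF [M FM]]; apply: (L2M_le mF _ (L1_cst ((m * k)%:R * M ^+ 2))).
apply: aeT_mono FM => z _ zM; apply: le_trans (frob2_le _) _.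
rewrite ler_wpM2l// ler_pXn2r ?nnegrE ?opnorm_ge0//.
exact: le_trans (opnorm_ge0 _) zM.
Qed.

Lemma L2M_LinfM_mul m p k (F : C -> 'M[C]_(m, p)) (G : C -> 'M[C]_(p, k)) :
  LinfM F -> L2M G -> L2M (fun z => F z *m G z).
Proof.
move=> /LinfMP[mF [M FM]] GL i j.
have : C2 (fun z => \sum_s F z i s * G z s j).
  apply: C2_sum => s; apply: (C2_bdd (M := M)) => //.
  by apply: aeT_mono FM => z _; apply: le_trans; exact: normc_le_opnorm.
by apply: C2_ext => z _; rewrite mxE.
Qed.

End Norms.

(** * Duality between trace and operator norms *)

Section Duality.
Context {R : realType}.
Local Notation C := (R[i]).
Local Notation adj A := (map_mx Num.conj (A^T)).

Section Selection.
Variables m k : nat.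
Implicit Types g : C -> 'M[C]_(m, k).
Local Notation N2op := (N2 (@opnorm R m k)).
Local Notation N2tr := (N2 (@trnorm R m k)).

Lemma cdot_tr (A B : 'M[C]_(m, k)) : cdot A B = \tr (A *m adj B).
Proof.
by rewrite /cdot /mxtrace; apply: eq_bigr => i _; rewrite mxE; apply: eq_bigr => j _; rewrite !mxE.
Qed.

Lemma rip_le (A B : 'M[C]_(m, k)) : `|rip A B| <= trnorm A * opnorm B.
Proof.
rewrite rip_cdot (le_trans (ler_Re_normc _))// cdot_tr -(opnorm_adj B).
exact: trace_le_trnorm.
Qed.

Lemma ripDl (A B D : 'M[C]_(m, k)) : rip (A + B) D = rip A D + rip B D.
Proof. by rewrite !rip_cdot cdotDl Re_D. Qed.

Lemma ripC (A B : 'M[C]_(m, k)) : rip A B = rip B A.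
Proof. by rewrite !rip_cdot -cdotJ Re_J. Qed.

Lemma ripZl (a : R) (A B : 'M[C]_(m, k)) : rip (a%:C%C *: A) B = a * rip A B.
Proof. by rewrite !rip_cdot cdotZl Re_M /= mul0r subr0. Qed.

(** The matrix (B x) x^* / |B x| of rank one has trace norm at most 1 and pairs with B to |B x|; x
    comes from the supremum that defines [opnorm]. *)
Lemma opnorm_near_attained (B : 'M[C]_(m, k)) (e : R) : 0 < e ->
  exists2 Y : 'M[C]_(m, k), trnorm Y <= 1 & opnorm B - e <= rip Y B.
Proof.
move=> e0; have [_ [x /= x1 <-] xe] := sup_adherent e0 (opnorm_has_sup B).
have [Bx0|Bx0] := eqVneq (B *m x) 0.
  exists 0; first by apply: le_trans (trnorm_le_opnorm _) _; rewrite opnorm0 mulr0.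
  by rewrite rip_cdot cdot0l /=; apply: ltW; rewrite Bx0 vnorm0 in xe.
have nB : vnorm (B *m x) != 0 by rewrite vnorm_eq0.
pose a := (vnorm (B *m x))^-1.
exists (a%:C%C *: ((B *m x) *m adj x)).
  apply: trnorm_le => W W1; apply: le_trans (ler_norm _) _; apply: le_trans (ler_Re_normc _) _.
  rewrite -scalemxAl linearZ /= normcM normcR ger0_norm ?invr_ge0 ?vnorm_ge0//.
  rewrite mulrC ler_pdivrMr ?lt_neqAle 1?eq_sym ?nB ?vnorm_ge0// mul1r.
  rewrite -mulmxA mxtrace_mulC.
  have -> : \tr (adj x *m W *m (B *m x)) = vdot (W *m (B *m x)) x.
    rewrite -mulmxA /mxtrace big_ord1 mxE /vdot; apply: eq_bigr => i _.
    by rewrite !mxE mulrC.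
  apply: le_trans (CauchySchwarz_vdot _ _) _; apply: (@le_trans _ _ (1 * vnorm (B *m x) * 1)).
    by rewrite ler_pM ?vnorm_ge0// (le_trans (vnorm_mulmx _ _))// ler_wpM2r ?vnorm_ge0.
  by rewrite mul1r mulr1.
have -> : rip (a%:C%C *: (B *m x *m adj x)) B = vnorm (B *m x); last exact: ltW.
rewrite ripZl rip_cdot.
have -> : cdot (B *m x *m adj x) B = vdot (B *m x) (B *m x).
  rewrite /cdot /vdot; apply: eq_bigr => i _.
  rewrite [X in _ * conjc X]mxE rmorph_sum mulr_sumr; apply: eq_bigr => j _ /=.
  by rewrite !mxE big_ord1 !mxE rmorphM /= mulrAC -mulrA.
by rewrite vdotxx /= expr2 mulKf.
Qed.

Lemma trnorm_entsum_rip (Y D : 'M[C]_(m, k)) : trnorm Y <= 1 -> `|rip Y D| <= entsum D.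
Proof.
move=> Y1; apply: le_trans (rip_le _ _) _; rewrite -[leRHS]mul1r.
by rewrite ler_pM ?trnorm_ge0 ?opnorm_ge0// opnorm_le_entsum.
Qed.

(* A nearly norming matrix is chosen for the value of [g] rounded to a countable grid, so
   that no measurable selection theorem is needed. *)
Lemma near_dual_field g (e : R) : L2M g -> 0 < e ->
  exists Y, [/\ L2M Y, N2tr Y <= N2op g & N2op g ^+ 2 - e <= L2ip Y g].
Proof.
move=> gL e0.
have mg := L2M_Cm gL.
have mop := Tm_opnorm mg.
have opL : L1 (fun z => opnorm (g z)).
  apply: L1_le mop _ (L1D (L1_cst 1) (L1_op2 gL)); apply: aeTW => z _.
  rewrite ger0_norm ?opnorm_ge0//; have := sqr_ge0 (opnorm (g z) - 1).
  by rewrite sqrrB expr1n mulr1 mulr2n; have := sqr_ge0 (opnorm (g z)); lra.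
pose c := mean (fun z => opnorm (g z)).
have c0 : 0 <= c by apply: mean_ge0 => z; exact: opnorm_ge0.
(* Per unit of |g| the error is 1/(N+1) for near attainment plus twice the rounding error, itself at
   most 2 m k/(N+1): it enters once in the pairing and once in the norm. *)
pose K := 2 * ((m * k)%:R * 2) + 1 : R.
have K0 : 0 < K by rewrite ltr_wpDl// !mulr_ge0.
have [N NP] : exists N : nat, N.+1%:R^-1 < e / (K * (c + 1)).
  have d0 : 0 < e / (K * (c + 1)) by rewrite divr_gt0// mulr_gt0// ltr_wpDl.
  have [N _ NP] := near_infty_natSinv_lt (PosNum d0).
  by exists N; exact: (NP N (leqnn N)).
have n0 : 0 < N.+1%:R^-1 :> R by rewrite invr_gt0.
have /choice[y yP] : forall B : 'M[(int * int)%type]_(m, k), exists Y : 'M[C]_(m, k),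
    trnorm Y <= 1 /\ opnorm (@unrnd R m k N B) - N.+1%:R^-1 <= rip Y (@unrnd R m k N B).
  by move=> B; have [Y] := opnorm_near_attained (@unrnd R m k N B) n0; exists Y.
(* Scaling by |g(z)| bounds the trace norm of Y by |g| and makes the pairing close to |g|^2, as for
   a norming functional in L^2. *)
pose Y z := (opnorm (g z))%:C%C *: y (rnd N (g z)).
have Y1 z : trnorm (Y z) <= opnorm (g z).
  apply: le_trans (trnormZ_le _ _) _; rewrite normcR ger0_norm ?opnorm_ge0//.
  by rewrite ler_piMr ?opnorm_ge0// (yP _).1.
have mY i j : Cm (fun z => Y z i j).
  have my : Cm (fun z => y (rnd N (g z)) i j).
    split; first exact: (Tm_rounded (fun B => complex.Re (y B i j)) N mg).
    exact: (Tm_rounded (fun B => complex.Im (y B i j)) N mg).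
  by apply: Cm_ext (CmM (Cm_real mop) my) => z _; rewrite [RHS]mxE.
have Yop z : opnorm (Y z) ^+ 2 <= opnorm (g z) ^+ 2.
  rewrite ler_pXn2r ?nnegrE; [|by []|exact: opnorm_ge0|exact: opnorm_ge0].
  exact: le_trans (opnorm_le_trnorm _) (Y1 z).
have YL : L2M Y.
  apply: (L2M_le mY _ (L1Z (m * k)%:R (L1_op2 gL))); apply: aeTW => z _.
  apply: le_trans (frob2_le _) _; apply: ler_wpM2l; first exact: ler0n.
  exact: Yop.
exists Y; split => //.
  rewrite ler_wsqrtr// mean_le//; [exact: L1_tr2|exact: L1_op2|].
  by apply: aeTW => z _; rewrite ler_pXn2r ?nnegrE ?opnorm_ge0 ?trnorm_ge0.
have key z : opnorm (g z) ^+ 2 - K * N.+1%:R^-1 * opnorm (g z) <= rip (Y z) (g z).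
  rewrite ripZl expr2 -mulrBl mulrC ler_wpM2l ?opnorm_ge0//.
  have [t1 t2] := yP (rnd N (g z)).
  set B := @unrnd R m k N (rnd N (g z)) in t2 *.
  have E : rip (y (rnd N (g z))) (g z) = rip (y (rnd N (g z))) B + rip (y (rnd N (g z))) (g z - B).
    by rewrite ripC -{1}(subrK B (g z)) addrC ripDl !(ripC _ (y _)).
  have h1 := trnorm_entsum_rip (g z - B) t1.
  have h2 := entsum_rnd N (g z).
  have h3 : opnorm (g z) <= opnorm B + entsum (g z - B).
    rewrite -{1}(subrK B (g z)) addrC (le_trans (opnormD _ _))// lerD2l.
    exact: opnorm_le_entsum.
  rewrite E; move: h1; rewrite ler_norml => /andP[h1 _].
  rewrite -/B mulrA in h2.
  move: t2 h1 h2 h3; rewrite /K.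
  by move: (N.+1%:R^-1) (m * k)%:R (rip _ B) (rip _ (g z - B)) (entsum _) (opnorm B) (opnorm (g z)) => *; lra.
apply: (@le_trans _ _ (mean (fun z => opnorm (g z) ^+ 2 - K * N.+1%:R^-1 * opnorm (g z)))).
  rewrite mean_B; [|exact: L1_op2|exact: L1Z].
  rewrite mean_Z// N2_sq lerD2l lerN2 -/c.
  move: NP; rewrite ltr_pdivlMr; last by rewrite mulr_gt0// ltr_wpDl.
  move=> NP; apply: le_trans (ltW NP); rewrite -mulrA mulrCA.
  apply: ler_wpM2l; first exact: ltW.
  by apply: ler_wpM2l; [exact: ltW|rewrite lerDl].
apply: mean_le; [|exact: rip_L1|exact: aeTW].
by apply: L1B; [exact: L1_op2|exact: L1Z].
Qed.

(** The L^2 operator norm is recovered from pairings with the ball of radius r in trace norm: a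
    nearly norming Y is rescaled to that radius, with arbitrarily small error. *)
Lemma N2op_dual g (r c : R) : L2M g -> 0 <= r ->
  (forall Y, L2M Y -> N2tr Y <= r -> L2ip Y g <= c) -> r * N2op g <= c.
Proof.
move=> gL r0 H.
have Hb := @L2_hilbert R m k.
have [M0|M0] := eqVneq (N2op g) 0.
  rewrite M0 mulr0; have := H 0 (@L2M0 _ _ _).
  have -> : N2tr 0 = 0.
    rewrite /N2 (_ : (fun z => _) = (fun=> 0)) ?mean_cst ?sqrtr0//.
    apply/funext => z; apply/eqP; rewrite expf_eq0 /= eq_le trnorm_ge0 andbT.
    by apply: le_trans (trnorm_le_opnorm _) _; rewrite opnorm0 mulr0.
  have -> : L2ip 0 g = 0; last exact.
  by rewrite L2ip_Tint (@Tint_ext _ _ (fun=> 0)) ?Tint_cst// => z _; exact: cdot0l.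
have Mp : 0 < N2op g by rewrite lt_neqAle eq_sym M0 N2_ge0.
apply/ler_addgt0Pr => e e0.
have [d d0 dE] : exists2 d, 0 < d & r / N2op g * d <= e.
  exists (e * N2op g / (r + 1)); first by rewrite divr_gt0 ?mulr_gt0// ltr_wpDl.
  have r1 : 0 < r + 1 by rewrite ltr_wpDl.
  have -> : r / N2op g * (e * N2op g / (r + 1)) = r * e / (r + 1).
    by field; rewrite M0 gt_eqF.
  by rewrite ler_pdivrMr// mulrC ler_pM2l// lerDl.
have [Y [YL Yg Yd]] := near_dual_field gL d0.
have a0 : 0 <= r / N2op g by rewrite divr_ge0// ltW.
have := H ((r / N2op g)%:C%C *: Y) (L2MZ _ YL).
rewrite (h_ipZl Hb)// => h.
have {h} : r / N2op g * L2ip Y g <= c.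
  apply: h; apply: le_trans (N2trZ _ YL) _; rewrite normcR ger0_norm//.
  by rewrite -mulrA ler_piMr// mulrC ler_pdivrMr// mul1r.
have : r / N2op g * (N2op g ^+ 2 - d) <= r / N2op g * L2ip Y g by rewrite ler_wpM2l.
rewrite mulrBr; have -> : r / N2op g * N2op g ^+ 2 = r * N2op g by field.
move=> h1 h2; have := le_trans h1 h2; rewrite lerBlDr => h3; apply: le_trans h3 _.
by rewrite lerD2l.
Qed.

Lemma N2tr_0 : N2tr 0 = 0.
Proof.
rewrite /N2 (_ : (fun z => _) = (fun=> 0)) ?mean_cst ?sqrtr0//.
apply/funext => z; apply/eqP; rewrite expf_eq0 /= eq_le trnorm_ge0 andbT.
by apply: le_trans (trnorm_le_opnorm _) _; rewrite opnorm0 mulr0.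
Qed.

Definition annihilator (W : (C -> 'M[C]_(m, k)) -> Prop) g :=
  L2M g /\ forall H, W H -> L2ip g H = 0.

(* The element of least norm of { X - H - Y : H in W, |Y| <= r } defines a functional
   separating X from W + { |Y| <= r }. *)
Lemma approx_dual_element (X : C -> 'M[C]_(m, k)) W (r S : R) : csub W -> L2M X ->
  0 <= r -> r < S -> (forall H, W H -> S <= N2tr (X - H)) ->
  exists g, [/\ annihilator W g, N2op g <= 1 & r <= L2ip X g].
Proof.
move=> cW XL r0 rS XS; have Hb := @L2_hilbert R m k.
have WL := cs_D cW.
pose K V := exists H Y, [/\ W H, L2M Y, N2tr Y <= r & V = X - H - Y].
have KL V : K V -> L2M V.
  by move=> [H [Y [WH YL _ ->]]]; apply: (h_DB Hb) => //; apply: (h_DB Hb) => //; exact: WL.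
have K0 H Y : W H -> L2M Y -> N2tr Y <= r -> K (X - H - Y) by move=> *; exists H, Y.
have Y0 : N2tr 0 <= r by rewrite N2tr_0.
have [] := min_norm_variational Hb KL.
- by exists (X - 0 - 0); apply: K0 => //; [exact: cs_0 cW|exact: L2M0].
- move=> s _ _ /andP[s0 s1] [H1 [Y1 [WH1 YL1 Yr1 ->]]] [H2 [Y2 [WH2 YL2 Yr2 ->]]].
  exists ((1 - s)%:C%C *: H1 + s%:C%C *: H2), ((1 - s)%:C%C *: Y1 + s%:C%C *: Y2).
  have sc0 : 0 <= 1 - s by rewrite subr_ge0.
  split.
  + by apply: (cs_add cW); exact: (cs_scale cW).
  + by apply: L2MD; exact: L2MZ.
  + apply: le_trans (N2trD (L2MZ _ YL1) (L2MZ _ YL2)) _.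
    have h1 := N2trZ (1 - s)%:C%C YL1; have h2 := N2trZ s%:C%C YL2.
    rewrite normcR ger0_norm// in h1; rewrite normcR ger0_norm// in h2.
    apply: le_trans (lerD h1 h2) _.
    have -> : r = (1 - s) * r + s * r by ring.
    exact: (lerD (ler_wpM2l sc0 Yr1) (ler_wpM2l s0 Yr2)).
  + apply/esym; have {1}-> : X = (1 - s)%:C%C *: X + s%:C%C *: X.
      by rewrite -scalerDl -rmorphD subrK rmorph1 scale1r.
    by rewrite !scalerBr !opprD (addrACA _ (s%:C%C *: X)) (addrACA (_ - _)).
move=> u [g [Ku gL ug gmin]].
have uL i : L2M (u i) := KL _ (Ku i).
(* Every V in the convex set has trace norm at least S - r, since V + Y = X - H with Y of trace norm
   at most r; hence the limit g is not zero. *)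
have g0 : S - r <= (minn m k)%:R * hnorm (@L2ip R m k) g.
  have l : (fun i => (minn m k)%:R * hnorm (@L2ip R m k) (u i)) @ \oo -->
      (minn m k)%:R * hnorm (@L2ip R m k) g.
    by apply: cvgM; [exact: cvg_cst|exact: (hlim_hnorm Hb)].
  apply: (ler_cvg_to (cvg_cst (S - r)) l); near=> i.
  apply: le_trans (N2tr_hnorm (uL i)).
  have [H [Y [WH YL Yr E]]] := Ku i.
  rewrite lerBlDr; apply: le_trans (XS H WH) _.
  have -> : X - H = u i + Y by rewrite E subrK.
  by apply: le_trans (N2trD (uL i) YL) _; rewrite lerD2l.
have gg : 0 < L2ip g g.
  rewrite lt_neqAle (h_ip_ge0 Hb)// andbT eq_sym; apply/eqP => g00.
  by move: g0; rewrite /hnorm g00 sqrtr0 mulr0 subr_le0 leNgt rS.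
have M0 : 0 < N2op g.
  rewrite lt_neqAle N2_ge0 andbT eq_sym; apply/eqP => M0.
  by have := hnorm_N2op gL; rewrite M0 expr0n mulr0 leNgt gg.
(* The variational inequality reads |g|^2 <= <g, X - H - Y>, and the nonnegative left side is
   dropped. *)
have gX H Y : W H -> L2M Y -> N2tr Y <= r -> L2ip g H + L2ip g Y <= L2ip g X.
  move=> WH YL Yr; have := le_trans (ltW gg) (gmin _ (K0 H Y WH YL Yr)).
  have HL := WL _ WH.
  rewrite (h_ipBr Hb)//; last exact: (h_DB Hb).
  by rewrite (h_ipBr Hb)// subr_ge0 lerBrDr addrC.
have gH H : W H -> L2ip g H = 0.
  move=> WH; have HL := WL _ WH; apply: contrapT => /eqP gH0.
  (* For this t one has <g, t H> = <g, X> + 1, beyond the bound just obtained. *)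
  pose t := (L2ip g X + 1) / L2ip g H.
  have := gX (t%:C%C *: H) 0 (cs_scale cW _ WH) (@L2M0 _ _ _) Y0.
  have -> : L2ip g 0 = 0 by rewrite (h_ipC Hb)//; [rewrite -(scale0r g) -(rmorph0 (real_complex R)) (h_ipZl Hb)// mul0r|exact: L2M0].
  by rewrite (h_ipZr Hb)// addr0 /t divfK// gerDl ler10.
have rM : r * N2op g <= L2ip g X.
  apply: N2op_dual => // Y YL Yr; rewrite (h_ipC Hb)//.
  have := gX 0 Y (cs_0 cW) YL Yr.
  by rewrite gH ?add0r//; exact: cs_0 cW.
exists (((N2op g)^-1)%:C%C *: g); split.
- split; first exact: L2MZ.
  by move=> H WH; rewrite (h_ipZl Hb) ?gH ?mulr0//; exact: WL.
- apply: le_trans (N2opZ _ gL) _; rewrite normcR ger0_norm ?invr_ge0 ?N2_ge0//.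
  by rewrite mulVf// gt_eqF.
- by rewrite (h_ipZr Hb)// (h_ipC Hb)// mulrC ler_pdivlMr.
Unshelve. all: by end_near. Qed.

(** The functionals that reach r_n, with r_n increasing to S, form decreasing convex sets, bounded
    in the Hilbert norm because the norms are equivalent. A limit of near-minimal elements reaches S
    itself, where weak compactness of the unit ball would otherwise be invoked. *)
Lemma dual_element (X : C -> 'M[C]_(m, k)) W (S : R) : csub W -> L2M X -> 0 < S ->
  (forall H, W H -> S <= N2tr (X - H)) ->
  exists g, [/\ annihilator W g, N2op g <= 1 & S <= L2ip X g].
Proof.
move=> cW XL S0 XS; have Hb := @L2_hilbert R m k; have WL := cs_D cW.
pose r n := S - S * n.+1%:R^-1.
have r0 n : 0 <= r n.
  by rewrite subr_ge0 ler_piMr ?(ltW S0)// invf_le1// ler1n.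
have rS n : r n < S by rewrite ltrBlDr ltrDl mulr_gt0// invr_gt0.
pose K n g := [/\ annihilator W g, N2op g <= 1 & r n <= L2ip X g].
have [] := @nested_convex _ _ _ _ Hb K ((m * k)%:R).
- by move=> n x [[]].
- move=> a b x ab [h1 h2 h3]; split => //; apply: le_trans h3.
  by rewrite lerD2l lerN2 ler_pM2l// lef_pV2 ?posrE// ler_nat.
- move=> n x y [[xL xW] x1 xr] [[yL yW] y1 yr].
  have xyL := L2MD xL yL; split.
  + split; first exact: L2MZ.
    move=> H WH; have HL := WL _ WH; rewrite (h_ipZl Hb)// (h_ipDl Hb)//.
    by rewrite xW// yW// addr0 mulr0.
  + apply: le_trans (N2opZ _ xyL) _; rewrite normcR ger0_norm ?invr_ge0//.
    have := N2opD xL yL; rewrite mulrC ler_pdivrMr// => h; apply: le_trans h _.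
    by rewrite mul1r; exact: (lerD x1 y1).
  + rewrite (h_ipZr Hb)// (h_ipDr Hb)//.
    by rewrite mulrC ler_pdivlMr// mulr_natr; exact: (lerD xr yr).
- move=> n; have [g [gW g1 gr]] := approx_dual_element cW XL (r0 n) (rS n) XS.
  exists g => //; apply: le_trans (hnorm_N2op gW.1) _.
  by rewrite ler_piMr// expr_le1// N2_ge0.
move=> u [g [Ku gL ug _]].
have uL n : L2M (u n) by have [[]] := Ku n.
exists g; split.
- split=> // H WH; have HL := WL _ WH.
  have l := hlim_ip Hb uL gL HL ug.
  rewrite -(cvg_lim (@norm_hausdorff _ _) l).
  rewrite (_ : (fun n => _) = (fun=> 0)) ?lim_cst//.
  by apply/funext => n; have [[_ ->]] := Ku n.
- rewrite -[leRHS]addr0.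
  have l : (fun n => 1 + hnorm (@L2ip R m k) (u n - g)) @ \oo --> (1 + 0 : R).
    by apply: cvgD; [exact: cvg_cst|exact: ug].
  apply: (ler_cvg_to (cvg_cst (N2op g)) l); near=> n.
  have {1}-> : g = u n + - (u n - g) by rewrite opprB addrC subrK.
  have duL : L2M (u n - g) by exact: L2MB.
  apply: le_trans (N2opD (uL n) (h_DN Hb duL)) _; apply: lerD; first by have [] := Ku n.
  by rewrite -(hnormN Hb duL); apply: N2op_hnorm; exact: (h_DN Hb duL).
- have l := hlim_ip Hb uL gL XL ug.
  have l2 : r @ \oo --> S - S * 0.
    apply: cvgB; first exact: cvg_cst.
    by apply: cvgM; [exact: cvg_cst|exact: cvg_harmonic].
  rewrite (h_ipC Hb)// -[leLHS]subr0 -(mulr0 S).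
  apply: (ler_cvg_to l2 l); near=> n.
  by rewrite (h_ipC Hb)//; have [] := Ku n.
Unshelve. all: by end_near. Qed.

End Selection.

(** G is the pointwise adjoint of a functional g that annihilates H^2: for s <= 0, the pairing of g
    with z^{-s} E_{ji} is the coefficient of index s of the entry (i, j) of G. *)
Lemma H20_duality n l (X : @mxfun R n l) (S : R) : L2M X -> 0 < S ->
  (forall H, H2M H -> S <= N2 (@trnorm R n l) (X - H)) ->
  exists G : @mxfun R l n, [/\ Hp0M 2 G, N2 (@opnorm R l n) G <= 1 &
    S <= complex.Re (Tint (fun z => \tr (X z *m G z)))].
Proof.
move=> XL S0 XS; have [g [[gL gW] g1 gS]] := dual_element (@csub_H2M R n l) XL S0 XS.
have Hb := @L2_hilbert R n l.
pose G : @mxfun R l n := fun z => adj (g z).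
have GE i j z : G z i j = conjc (g z j i) by rewrite !mxE.
have GL : L2M G by move=> i j; apply: C2_ext (C2J (gL j i)) => z _; rewrite GE.
have Gs i j (s : int) : s <= 0 -> fourier (fun z => G z i j) s = 0.
  move=> s0; have dH : H2M (@deltaf R n l (- s) j i).
    have -> : - s = `|- s|%N%:Z by rewrite gez0_abs// oppr_ge0.
    by apply: (H2M_shift _ (x := fun=> delta_mx j i)); exact: H2M_cst.
  have dL : L2M (@deltaf R n l (- s) j i) := dH.1.
  have <- : Tint (fun z => cdot (@deltaf R n l (- s) j i z) (g z)) = 0.
    apply: (Tint_cdot0P dL gL) => c; rewrite (h_ipC Hb (L2MZ c dL) gL).
    exact: (gW _ (cs_scale (@csub_H2M R n l) c dH)).
  apply: Tint_ext => z _; rewrite GE /deltaf cdotZl mulrC; congr (_ * _).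
  rewrite -cdotJ; congr conjc; rewrite /cdot (bigD1 j)//= (bigD1 i)//= !mxE !eqxx conjc1 mulr1.
  rewrite big1 ?addr0; last by move=> i' ii; rewrite mxE (negbTE ii) andbF conjc0 mulr0.
  rewrite big1 ?addr0// => j' jj; apply: big1 => i' _.
  by rewrite mxE (negbTE jj) conjc0 mulr0.
exists G; split.
- split; last by move=> i j; exact: Gs.
  by apply/H2MP; split=> // i j s /ltW; exact: Gs.
- rewrite (_ : N2 _ G = N2 (@opnorm R n l) g)//; congr Num.sqrt; apply: mean_ext => z _.
  by rewrite opnorm_adj.
- apply: le_trans gS _; rewrite L2ip_Tint le_eqVlt; apply/orP; left; apply/eqP.
  by congr complex.Re; apply: Tint_ext => z _; exact: cdot_tr.
Qed.

End Duality.

(** * The trace pairing of H^2 with H^2_0 *)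

Section HardyPairing.
Context {R : realType}.
Local Notation C := (R[i]).
Local Notation N2op := (N2 (@opnorm R _ _)).
Local Notation N2tr := (N2 (@trnorm R _ _)).

Lemma LpNorm2_op m k (F : @mxfun R m k) : L2M F -> LpNorm 2 (@opnorm R m k) F = (N2op F)%:E.
Proof. by move=> FL; apply: LpNorm2E; [exact: opnorm_ge0|exact: L1_op2]. Qed.

Lemma LpNorm2_tr m k (F : @mxfun R m k) : L2M F -> LpNorm 2 (@trnorm R m k) F = (N2tr F)%:E.
Proof. by move=> FL; apply: LpNorm2E; [exact: trnorm_ge0|exact: L1_tr2]. Qed.

Lemma Hp0M2P m k (G : @mxfun R m k) : Hp0M 2 G ->
  L2M G /\ forall i j (s : int), s <= 0 -> fourier (fun z => G z i j) s = 0.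
Proof.
move=> [[/LpM2P GL Ga] G0]; split=> // i j s; rewrite le_eqVlt => /orP[/eqP ->|s0].
  exact: G0.
exact: Ga.
Qed.

Lemma Tint_H2_H20 m k (H : @mxfun R m k) (G : @mxfun R k m) : H2M H -> Hp0M 2 G ->
  Tint (fun z => \tr (H z *m G z)) = 0.
Proof.
move=> [HL Ha] /Hp0M2P[GL Gs].
transitivity (Tint (fun z => \sum_i \sum_j H z i j * G z j i)).
  by apply: Tint_ext => z _; apply: eq_bigr => i _; rewrite mxE.
rewrite Tint_sum => [|i]; last by apply: C1_sum => j; exact: C2M.
apply: big1 => i _; rewrite Tint_sum => [|j]; last exact: C2M.
by apply: big1 => j _; apply: fourier_H2_H20 => // s; [exact: Ha|exact: Gs].
Qed.

Lemma H2M_Hinf_mul m p k (F : @mxfun R m p) (G : @mxfun R p k) : HinfM F -> H2M G ->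
  H2M (fun z => F z *m G z).
Proof.
move=> [FI Fa] [GL Ga]; split; first exact: L2M_LinfM_mul.
move=> i j s s0; have FL := L2M_LinfM FI.
transitivity (fourier (fun z => \sum_t F z i t * G z t j) s).
  by apply: Tint_ext => z _; rewrite mxE.
transitivity (\sum_t fourier (fun z => F z i t * G z t j) s).
  rewrite /fourier -Tint_sum => [|t]; last by apply: C1_expz; exact: C2M.
  by apply: Tint_ext => z _; rewrite mulr_suml.
apply: big1 => t _.
(* [fourier_mul_H2_H20] wants a second factor in H^2_0; multiplying G by z provides it and raises
   the index to s + 1 <= 0. *)
transitivity (fourier (fun z => F z i t * (z ^ 1 * G z t j)) (s + 1)).
  apply: Tint_ext => z z1; rewrite opprD expfzDr ?circ_neq0//.
  have -> : z ^ (-1) = z^-1 by rewrite exprN1.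
  have z0 := circ_neq0 z1; rewrite expr1z; move: (z ^ (- s)) (F z i t) (G z t j) => w f g.
  by field.
apply: fourier_mul_H2_H20 => //.
- by move=> r; exact: Fa.
- exact: C2_expz.
- by move=> r r0; rewrite fourier_shift; apply: Ga; rewrite subr_lt0 (le_lt_trans r0).
- by rewrite lezD1.
Qed.

Lemma qnorm_ge m k (X : @mxfun R m k) (c : R) : L2M X ->
  (forall H, H2M H -> c <= N2tr (X - H)) -> (c%:E <= qnorm m k X)%E.
Proof.
move=> XL h; apply: le_ereal_inf_tmp => _ [H /H2MP HH <-].
have E : LpNorm 2 (@trnorm R m k) (mfsub X H) = (N2tr (X - H))%:E.
  by apply: LpNorm2_tr; exact: L2MB XL HH.1.
by rewrite E lee_fin; exact: h.
Qed.

Lemma qnorm_le m k (X H : @mxfun R m k) : L2M X -> H2M H -> (qnorm m k X <= (N2tr (X - H))%:E)%E.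
Proof.
move=> XL HH; apply: ereal_inf_lbound; exists H; first exact/H2MP.
by apply: LpNorm2_tr; exact: L2MB XL HH.1.
Qed.

(** Subtracting an element of H^2 from X leaves the integral unchanged, so every representative of
    the coset bounds it. *)
Lemma Tint_le_qnorm m k (X : @mxfun R m k) (G : @mxfun R k m) : L2M X -> Hp0M 2 G -> N2op G <= 1 ->
  ((normc (Tint (fun z => \tr (X z *m G z))))%:E <= qnorm m k X)%E.
Proof.
move=> XL GH G1; apply: qnorm_ge => // H HH.
have [GL _] := Hp0M2P GH; have XHL := L2MB XL HH.1.
have -> : Tint (fun z => \tr (X z *m G z)) = Tint (fun z => \tr ((X - H) z *m G z)).
  rewrite -[LHS]subr0 -(Tint_H2_H20 HH GH) -TintB; [|exact: trace_C1|exact: (trace_C1 HH.1 GL)].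
  by apply: Tint_ext => z _; rewrite -raddfB -mulmxBl.
apply: le_trans (Tint_trace_le XHL GL) _.
by rewrite ler_piMr// N2_ge0.
Qed.

End HardyPairing.

(** * The order of a very badly approximable function *)

Section OrderOfPhi.
Context {R : realType}.
Local Notation C := (R[i]).
Local Notation N2op := (N2 (@opnorm R _ _)).
Local Notation N2tr := (N2 (@trnorm R _ _)).

Lemma mfsub0 m k (F : @mxfun R m k) : mfsub F (@mf0 R m k) = F.
Proof. by apply/funext => z; exact: subr0. Qed.

Lemma sing0 m k (A : 'M[C]_(m, k)) : sing 0 A = opnorm A.
Proof.
apply/eqP; rewrite eq_le -[in X in _ <= X](subr0 A) sing_le ?mxrank0//=.
apply: le_sing => B; rewrite leqn0 mxrank_eq0 => /eqP ->.
by rewrite subr0.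
Qed.

Lemma sing_le_opnorm m k j (A : 'M[C]_(m, k)) : sing j A <= opnorm A.
Proof. by rewrite -[in X in _ <= X](subr0 A) sing_le ?mxrank0. Qed.

Lemma Omega_le n (Phi : @mxfun R n n) i j : (i <= j)%N -> Omega n Phi j `<=` Omega n Phi i.
Proof.
move=> /subnK <-; elim: (j - i)%N => [|d IH] //.
by rewrite addSn => F [/IH].
Qed.

(** Each of F and G competes with the other at stage j, so the levels do not depend on the
    approximant that [xget] selects. At stage 0 the minimized norm is [opnorm], which coincides with
    [sing 0]. *)
Lemma Omega_LinfNorm n (Phi F G : @mxfun R n n) q j : (j <= q)%N ->
  Omega n Phi q F -> Omega n Phi q G ->
  LinfNorm (sing j) (mfsub Phi F) = LinfNorm (sing j) (mfsub Phi G).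
Proof.
move=> jq /(Omega_le jq) Fj /(Omega_le jq) Gj; apply/eqP; rewrite eq_le.
case: j {jq} Fj Gj => [|j] [HF minF] [HG minG].
  have E H : LinfNorm (sing 0) (mfsub Phi H) = LinfNorm (@opnorm R n n) (mfsub Phi H).
    by congr esssup; apply/funext => z; exact: sing0.
  rewrite !E; apply/andP; split; [exact: (minF G HG)|exact: (minG F HF)].
apply/andP; split; [exact: (minF G HG)|exact: (minG F HF)].
Qed.

Section FixedSymbol.
Variables (n : nat) (Phi : @mxfun R n n).
Hypothesis PhiL : LinfM Phi.
Hypothesis vba : very_badly_approximable n Phi.
(** The levels are the essential suprema of s_j(Phi) itself, because 0 is superoptimal and may stand
    in for the approximant selected in [tsv]; they are finite because Phi is bounded. *)
Lemma sing_levels : exists tau : nat -> R, [/\ forall j, 0 <= tau j,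
  forall j, (j < n)%N -> tsv n Phi j = (tau j)%:E &
  forall j, aeT (fun z => sing j (Phi z) <= tau j)].
Proof.
have [_ [M PM]] := (LinfMP Phi).1 PhiL.
have h j : exists r, 0 <= r /\ LinfNorm (sing j) Phi = r%:E.
  have [r r0 rE] := @esssup_fin R (fun z => sing j (Phi z)) (fun z => sing_ge0 j (Phi z))
    (le_lt_trans ((esssup_le _ M).2 (aeT_mono (fun z _ => le_trans (sing_le_opnorm j (Phi z))) PM)) (ltry M)).
  by exists r.
have /choice[tau tauP] := h; exists tau; split.
- by move=> j; have [] := tauP j.
- move=> j jn; rewrite -(tauP j).2 -[in RHS](mfsub0 Phi).
  apply: (@Omega_LinfNorm _ _ _ _ n.-1) => //; first by rewrite -ltnS (ltn_predK jn).
  by apply: xgetPex; exists (@mf0 R n n).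
- by move=> j; apply/esssup_le; rewrite -(tauP j).2.
Qed.

Variable tau : nat -> R.
Hypothesis tau0 : forall j, 0 <= tau j.
Hypothesis tauE : forall j, (j < n)%N -> tsv n Phi j = (tau j)%:E.
Hypothesis tau_ge : forall j, aeT (fun z => sing j (Phi z) <= tau j).
Let S : R := \sum_(j < n) tau j.

Lemma tsv_sum l : (l <= n)%N -> (\sum_(j < l) tsv n Phi j)%E = (\sum_(j < l) tau j)%:E.
Proof.
move=> ln; rewrite -sumEFin; apply: eq_bigr => j _; rewrite tauE//.
exact: leq_trans (ltn_ord j) ln.
Qed.

Lemma sum_sing_le l : aeT (fun z => \sum_(j < l) sing j (Phi z) <= \sum_(j < l) tau j).
Proof.
apply: aeT_mono (aeT_forall (fun j : 'I_l => tau_ge j)) => z _ h.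
by apply: ler_sum => j _; exact: h.
Qed.

Lemma sum_tau_split l : (l <= n)%N -> S = \sum_(j < l) tau j + \sum_(l <= j < n) tau j.
Proof.
move=> ln; rewrite /S -[LHS](big_mkord predT tau) (big_cat_nat (n := l))//=.
by rewrite big_mkord.
Qed.

Lemma sum_tau_le l : (l <= n)%N -> \sum_(j < l) tau j <= S.
Proof. by move=> ln; rewrite (sum_tau_split ln) lerDl sumr_ge0. Qed.

Lemma S_ge0 : 0 <= S. Proof. exact: sumr_ge0. Qed.

Lemma trnorm_Phi : aeT (fun z => trnorm (Phi z) <= S).
Proof. by apply: aeT_mono (sum_sing_le n) => z _; rewrite /trnorm minnn. Qed.

Lemma Psi_C1 (Psi : @mxfun R n n) : Hp0M 1 Psi -> forall i j, C1 (fun z => Psi z i j).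
Proof. by move=> [[PL _] _] i j; exact/inLp1P/PL. Qed.

Lemma tr_C1 (F Psi : @mxfun R n n) : LinfM F -> Hp0M 1 Psi -> C1 (fun z => \tr (F z *m Psi z)).
Proof.
move=> /LinfMP[mF [M FM]] PH; have : C1 (fun z => \sum_i \sum_j F z i j * Psi z j i).
  apply: C1_sum => i; apply: C1_sum => j; apply: (C1_bdd (M := M)) => //; last exact: Psi_C1.
  by apply: aeT_mono FM => z _; apply: le_trans; exact: normc_le_opnorm.
by apply: C1_ext => z _; apply: eq_bigr => i _; rewrite mxE.
Qed.

Lemma calA_I l (Psi : @mxfun R n n) : calA n l Psi -> mean (fun z => opnorm (Psi z)) <= 1.
Proof.
move=> [PH [P1 _]]; rewrite -lee_fin -LpNorm1E//; first exact: opnorm_ge0.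
exact: L1_opnorm_Psi.
Qed.

Lemma calA_bound l (F Psi : @mxfun R n n) (c : R) : calA n l Psi -> LinfM F -> 0 <= c ->
  aeT (fun z => normc (\tr (F z *m Psi z)) <= c * opnorm (Psi z)) ->
  normc (Tint (fun z => \tr (F z *m Psi z))) <= c.
Proof.
move=> PA FL c0 h; have PH := PA.1; have oL := L1_opnorm_Psi PH.
apply: le_trans (normc_Tint_le (tr_C1 FL PH)) _.
apply: (@le_trans _ _ (c * mean (fun z => opnorm (Psi z)))); last first.
  by rewrite ler_piMr// (calA_I PA).
by rewrite -mean_Z//; apply: mean_le => //; [exact/C1n/tr_C1|exact: L1Z].
Qed.

Lemma calA_le l (Psi : @mxfun R n n) : calA n l Psi ->
  normc (Tint (fun z => \tr (Phi z *m Psi z))) <= \sum_(j < l) tau j.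
Proof.
move=> PA; apply: (calA_bound PA PhiL); first exact: sumr_ge0.
have [_ [_ rP]] := PA.
apply: aeT2 (sum_sing_le l) (rP : aeT (fun z => (\rank (Psi z) <= l)%N)) => z _ h r.
by apply: le_trans (trace_le_sing _ r) _; rewrite ler_wpM2r ?opnorm_ge0.
Qed.

Lemma sigma_le l : (sigma_k n l Phi <= (\sum_(j < l) tau j)%:E)%E.
Proof. by apply: ge_ereal_sup => _ [Psi PA <-]; rewrite lee_fin calA_le. Qed.

Lemma calA_factor l (Psi : @mxfun R n n) : calA n l Psi -> exists (F : @mxfun R n l) (G : @mxfun R l n),
  [/\ HpM 2 F, Hp0M 2 G, aeT (fun z => Psi z = F z *m G z), N2op F <= 1 & N2op G <= 1].
Proof.
move=> PA; have [PH [_ rP]] := PA; have oL := L1_opnorm_Psi PH.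
have [F [G [FH GH PFG Fo Go]]] := H1_factorization PH rP.
have FL := ((H2MP F).1 FH).1; have [GL _] := Hp0M2P GH.
exists F, G; split=> //.
  rewrite -(@ler_pXn2r _ 2) ?nnegrE ?N2_ge0// N2_sq expr1n.
  by apply: le_trans (calA_I PA); apply: mean_le => //; exact: L1_op2.
rewrite -(@ler_pXn2r _ 2) ?nnegrE ?N2_ge0// N2_sq expr1n.
by apply: le_trans (calA_I PA); apply: mean_le => //; exact: L1_op2.
Qed.

Lemma Tint_factor l (A Psi : @mxfun R n n) (F : @mxfun R n l) (G : @mxfun R l n) :
  LinfM A -> Hp0M 1 Psi -> L2M F -> L2M G -> aeT (fun z => Psi z = F z *m G z) ->
  Tint (fun z => \tr (A z *m Psi z)) = Tint (fun z => \tr (mfmul A F z *m G z)).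
Proof.
move=> AL PH FL GL E; apply: Tint_ae_eq; first exact/C1_Cm/tr_C1.
  by apply: C1_Cm; apply: trace_C1 => //; exact: L2M_LinfM_mul.
by apply: aeT_mono E => z _ ->; rewrite mulmxA.
Qed.

(** Factoring Psi reduces the pairing of H^infty with H^1_0 to that of [F *m F1], which is in H^2,
    with G in H^2_0. *)
Lemma Tint_Hinf_H1 l (F Psi : @mxfun R n n) : HinfM F -> calA n l Psi ->
  Tint (fun z => \tr (F z *m Psi z)) = 0.
Proof.
move=> FH PA; have [F1 [G [/H2MP F1H GH E _ _]]] := calA_factor PA.
rewrite (Tint_factor FH.1 PA.1 F1H.1 (Hp0M2P GH).1 E).
by apply: Tint_H2_H20 => //; exact: H2M_Hinf_mul.
Qed.

Lemma LinfMB (F G : @mxfun R n n) : LinfM F -> LinfM G -> LinfM (mfsub F G).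
Proof.
move=> /LinfMP[mF [M FM]] /LinfMP[mG [N GN]]; apply/LinfMP; split.
  move=> i j; apply: Cm_ext (CmD (mF i j) (CmM (Cm_cst (-1)) (mG i j))) => z _.
  by rewrite !mxE mulN1r.
exists (M + N); apply: aeT2 FM GN => z _ h1 h2.
by apply: le_trans (opnormD _ _) _; rewrite opnormN lerD.
Qed.

(** Since Psi annihilates H^infty, Phi may be replaced by Phi - F before trace duality is
    applied. *)
Lemma sigma_le_dist l : (sigma_k n l Phi <= distS1 n Phi)%E.
Proof.
apply: ge_ereal_sup => _ [Psi PA <-]; apply: le_ereal_inf_tmp => _ [F FH <-].
have DL := LinfMB PhiL FH.1.
have -> : Tint (fun z => \tr (Phi z *m Psi z)) = Tint (fun z => \tr (mfsub Phi F z *m Psi z)).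
  rewrite -[LHS]subr0 -(Tint_Hinf_H1 FH PA) -TintB; [|exact: tr_C1 PhiL PA.1|exact: tr_C1 FH.1 PA.1].
  by apply: Tint_ext => z _; rewrite -raddfB -mulmxBl.
have [fin|] := ltP (LinfNorm (@trnorm R n n) (mfsub Phi F)) +oo%E; last by rewrite leye_eq => /eqP ->; exact: leey.
have [r r0 rE] := esssup_fin (fun z => trnorm_ge0 (mfsub Phi F z)) fin.
rewrite /LinfNorm rE lee_fin; apply: (calA_bound PA DL r0).
have : aeT (fun z => trnorm (mfsub Phi F z) <= r) by apply/esssup_le; rewrite rE.
apply: aeT_mono => z _ h; apply: le_trans (trace_le_trnorm _ _) _.
by rewrite ler_wpM2r ?opnorm_ge0.
Qed.

Lemma mf0_HinfM m k : HinfM (@mf0 R m k).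
Proof.
split; last by move=> i j; exact: (@H2M_cst R m k 0).2.
apply/LinfMP; split; first by move=> i j; exact: Cm_cst.
by exists 0; apply: aeTW => z _; rewrite opnorm0.
Qed.

Lemma dist_le : (distS1 n Phi <= S%:E)%E.
Proof.
apply: ge_ereal_inf; exists (LinfNorm (@trnorm R n n) Phi); last exact/esssup_le/trnorm_Phi.
by exists (@mf0 R n n); [exact: mf0_HinfM|rewrite mfsub0].
Qed.

Lemma mfmul_L2M l (F : @mxfun R n l) : L2M F -> L2M (mfmul Phi F).
Proof. exact: L2M_LinfM_mul. Qed.

Lemma qnorm_Phi_le l (F : @mxfun R n l) : L2M F -> (qnorm n l (mfmul Phi F) <= (S * N2op F)%:E)%E.
Proof.
move=> FL; have PFL := mfmul_L2M FL.
apply: le_trans (qnorm_le PFL (cs_0 (@csub_H2M R n l))) _.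
rewrite subr0 lee_fin -(@ler_pXn2r _ 2) ?nnegrE ?mulr_ge0 ?S_ge0 ?N2_ge0// exprMn !N2_sq.
rewrite -mean_Z; last exact: L1_op2.
apply: mean_le; [exact: L1_tr2|exact/L1Z/L1_op2|].
apply: aeT_mono trnorm_Phi => z _ h; rewrite -exprMn.
rewrite ler_pXn2r ?nnegrE ?mulr_ge0 ?S_ge0 ?opnorm_ge0 ?trnorm_ge0//.
by apply: le_trans (trnorm_mulmxr _ _) _; rewrite ler_wpM2r ?opnorm_ge0.
Qed.

Lemma Hk_norm_le l : (Hk_norm n l Phi <= S%:E)%E.
Proof.
apply: ge_ereal_sup => _ [F [/H2MP[FL _] F1] <-].
apply: le_trans (qnorm_Phi_le FL) _; rewrite lee_fin ler_piMr ?S_ge0//.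
by move: F1; rewrite LpNorm2_op// lee_fin.
Qed.

Lemma sigma_le_Hk_norm l : (sigma_k n l Phi <= Hk_norm n l Phi)%E.
Proof.
apply: ge_ereal_sup => _ [Psi PA <-].
have [F [G [FH GH E F1 G1]]] := calA_factor PA; have [FL _] := (H2MP F).1 FH.
rewrite (Tint_factor PhiL PA.1 FL (Hp0M2P GH).1 E).
apply: le_trans (Tint_le_qnorm (mfmul_L2M FL) GH G1) _.
apply: ereal_sup_ubound; exists F => //; split=> //.
by rewrite LpNorm2_op// lee_fin.
Qed.

Lemma attains_sum_order l : (1 <= l <= n)%N -> attains_sum n l Phi ->
  [/\ forall j, (l <= j < n)%N -> tau j = 0, sigma_k n l Phi = S%:E & order_cond n l Phi].
Proof.
move=> /andP[l1 ln] [Psi [PA /= [Im0 ReS]]].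
have TS : Tint (fun z => \tr (Phi z *m Psi z)) = S%:C%C.
  apply/eqP; rewrite eq_complex /= Im0 eqxx andbT; apply/eqP.
  by apply: EFin_inj; rewrite ReS (tsv_sum (leqnn n)).
have nTS : normc (Tint (fun z => \tr (Phi z *m Psi z))) = S by rewrite TS normcR ger0_norm ?S_ge0.
have SE : \sum_(j < l) tau j = S.
  by apply/eqP; rewrite eq_le sum_tau_le// -nTS calA_le.
have sS : sigma_k n l Phi = S%:E.
  apply/eqP; rewrite eq_le -{1}SE sigma_le/=.
  by apply: ereal_sup_ubound; exists Psi => //; rewrite nTS.
have HkS : Hk_norm n l Phi = S%:E.
  by apply/eqP; rewrite eq_le Hk_norm_le/= -sS sigma_le_Hk_norm.
split => //.
  move=> j /andP[lj jn]; have := sum_tau_split ln; rewrite SE => /eqP.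
  rewrite -subr_eq0 opprD addrA subrr sub0r oppr_eq0 big_nat_cond psumr_eq0 => [|i _]; last exact: tau0.
  move=> /allP/(_ j); rewrite mem_index_iota lj jn => /(_ isT) /=.
  by move=> /eqP.
split; last by apply/eqP; rewrite eq_le sigma_le_dist sS dist_le.
have [F [G [FH GH E F1 G1]]] := calA_factor PA; have [FL _] := (H2MP F).1 FH.
have qge := Tint_le_qnorm (mfmul_L2M FL) GH G1.
rewrite -(Tint_factor PhiL PA.1 FL (Hp0M2P GH).1 E) nTS in qge.
have qle := qnorm_Phi_le FL.
(* When S = 0 the factor F may be zero, but every nonzero function is then maximizing; a nonzero
   constant is taken. *)
have [S00|S00] := eqVneq S 0.
  pose c : @mxfun R n l := fun=> const_mx 1.
  have cH : H2M c := H2M_cst _.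
  exists c; rewrite LpNorm2_op; last exact: cH.1.
  split; first exact/H2MP.
  have i0 : 'I_n by exists 0%N; apply: leq_trans ln.
  have j0 : 'I_l by exists 0%N.
  have c1 : 1 <= opnorm (const_mx 1 : 'M[C]_(n, l)).
    by have := normc_le_opnorm (const_mx 1 : 'M[C]_(n, l)) i0 j0; rewrite mxE normc1.
  split.
    have -> : N2op c = opnorm (const_mx 1 : 'M[C]_(n, l)).
      by rewrite /N2 /c (mean_cst (opnorm (const_mx 1 : 'M[C]_(n, l)) ^+ 2)) sqrtr_sqr ger0_norm ?opnorm_ge0.
    by rewrite eqe gt_eqF// (lt_le_trans ltr01 c1).
  rewrite HkS S00 mul0e; apply/eqP; rewrite eq_le.
  have := qnorm_Phi_le cH.1; rewrite S00 mul0r => ->/=.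
  by apply: qnorm_ge => [|H _]; [apply: mfmul_L2M; exact: cH.1|exact: N2_ge0].
have Sp : 0 < S by rewrite lt_neqAle eq_sym S00 S_ge0.
(* The chain S <= |coset of Phi F| <= S |F| <= S forces |F| = 1. *)
have F1' : N2op F = 1.
  apply/eqP; rewrite eq_le F1 /=; have := le_trans qge qle; rewrite lee_fin.
  by rewrite ler_pMr.
exists F; rewrite LpNorm2_op// F1' HkS mule1; split=> //; split.
  by rewrite eqe oner_eq0.
by apply/eqP; rewrite eq_le qge andbT; move: qle; rewrite F1' mulr1.
Qed.

Lemma product_calA l (F : @mxfun R n l) (G : @mxfun R l n) : H2M F -> Hp0M 2 G ->
  N2op F <= 1 -> N2op G <= 1 -> calA n l (mfmul F G).
Proof.
move=> [FL Fa] /Hp0M2P[GL Gs] F1 G1.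
have mC i j : C1 (fun z => mfmul F G z i j).
  have : C1 (fun z => \sum_t F z i t * G z t j) by apply: C1_sum => t; exact: C2M.
  by apply: C1_ext => z _; rewrite mxE.
have f0 i j (s : int) : s <= 0 -> fourier (fun z => mfmul F G z i j) s = 0.
  move=> s0; transitivity (\sum_t fourier (fun z => F z i t * G z t j) s).
    rewrite /fourier -Tint_sum => [|t]; last by apply: C1_expz; exact: C2M.
    by apply: Tint_ext => z _; rewrite mxE mulr_suml.
  by apply: big1 => t _; apply: fourier_mul_H2_H20 => // r; [exact: Fa|exact: Gs].
have H1 : Hp0M 1 (mfmul F G).
  split; last by move=> i j; exact: f0.
  by split=> [i j|i j s s0]; [exact: ((inLp1P _).2 (mC i j))|exact: (f0 i j s (ltW s0))].
split=> //; split; last first.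
  have : aeT (fun z => (\rank (mfmul F G z) <= l)%N) by apply: aeTW => z _; exact: mulmx_max_rank.
  exact.
rewrite LpNorm1E; [|exact: opnorm_ge0|exact: L1_opnorm_Psi].
rewrite lee_fin.
have [ab abI] := mean_CauchySchwarz (Tm_opnorm (L2M_Cm FL)) (Tm_opnorm (L2M_Cm GL)) (L1_op2 FL) (L1_op2 GL).
apply: (@le_trans _ _ (mean (fun z => opnorm (F z) * opnorm (G z)))).
  by apply: mean_le => //; [exact: L1_opnorm_Psi|apply: aeTW => z _; exact: opnormM].
apply: le_trans abI _; rewrite -[leRHS]mulr1.
by apply: ler_pM; [exact: N2_ge0|exact: N2_ge0|exact: F1|exact: G1].
Qed.

Lemma maxvec_attains_sum l : (l <= n)%N -> Hk_has_maxvec n l Phi -> sigma_k n l Phi = S%:E ->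
  attains_sum n l Phi.
Proof.
move=> ln [F [/H2MP FH [F0 qF]]] sS; have FL := FH.1.
(* A lower bound on the real part is enough: the modulus of the integral is at most S, so the
   integral is real and equal to S. *)
suff [Psi PA PS] : exists2 Psi, calA n l Psi & S <= complex.Re (Tint (fun z => \tr (Phi z *m Psi z))).
  have wS := le_trans (calA_le PA) (sum_tau_le ln).
  pose w := Tint (fun z => \tr (Phi z *m Psi z)); rewrite -/w in PS wS.
  have := normc_sq w; have := ler_Re_normc w; rewrite ger0_norm ?(le_trans S_ge0 PS)// => Rw wE.
  have ES : complex.Re w = S by apply/eqP; rewrite eq_le PS (le_trans Rw wS).
  have nE : normc w = S by apply/eqP; rewrite eq_le wS -{1}ES Rw.
  exists Psi; split => //; rewrite (tsv_sum (leqnn n)); split; last exact: (congr1 EFin ES).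
  move: wE; rewrite nE ES -[LHS]addr0 => /addrI/esym/eqP; rewrite sqrf_eq0 => /eqP.
  exact.
have HkS : Hk_norm n l Phi = S%:E.
  by apply/eqP; rewrite eq_le Hk_norm_le/= -sS sigma_le_Hk_norm.
(* [H20_duality] asks for a positive bound; for S = 0 the zero function attains the sum. *)
have [S00|S00] := eqVneq S 0.
  have [z1 z2] : H2M (0 : @mxfun R n l) /\ L2M (0 : @mxfun R l n).
    by split; [exact: cs_0 (@csub_H2M R n l)|exact: L2M0].
  exists (mfmul (0 : @mxfun R n l) (0 : @mxfun R l n)).
    have N0 a b : N2op (0 : @mxfun R a b) <= 1.
      by apply: le_trans (N2op_hnorm (@L2M0 _ _ _)) _; rewrite (hnorm0 (@L2_hilbert R a b)).
    apply: product_calA => //.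
    have h0 : H2M (fun=> 0 : 'M[C]_(l, n)) := H2M_cst _.
    split; first exact/H2MP.
    move=> i j; rewrite /fourier -[RHS](Tint_cst 0); apply: Tint_ext => z _.
    by rewrite /entry mxE mul0r.
  rewrite S00 (_ : Tint _ = 0)//= -[RHS](Tint_cst 0); apply: Tint_ext => z _.
  by rewrite /mfmul mul0mx mulmx0 mxtrace0.
have Sp : 0 < S by rewrite lt_neqAle eq_sym S00 S_ge0.
move: F0 qF; rewrite LpNorm2_op// HkS -EFinM eqe => F0 qF.
set a := N2op F in F0 qF.
have a0 : 0 < a by rewrite lt_neqAle eq_sym F0 N2_ge0.
have PFL := mfmul_L2M FL.
(* Maximality of F says that the distance from Phi F to H^2 is S |F|, and duality provides a G that
   attains this distance. *)
have [H HH|G [GH G1 GS]] := H20_duality PFL (mulr_gt0 Sp a0).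
  by rewrite -lee_fin -qF; exact: qnorm_le.
have GL := (Hp0M2P GH).1.
pose F' : @mxfun R n l := (a^-1)%:C%C *: F.
have F'H : H2M F' := cs_scale (@csub_H2M R n l) _ FH.
have F'1 : N2op F' <= 1.
  apply: le_trans (N2opZ _ FL) _; rewrite normcR ger0_norm ?invr_ge0 ?(ltW a0)//.
  by rewrite -/a mulVf.
exists (mfmul F' G); first exact: product_calA.
have -> : Tint (fun z => \tr (Phi z *m mfmul F' G z)) =
    (a^-1)%:C%C * Tint (fun z => \tr (mfmul Phi F z *m G z)).
  rewrite -TintZ; last exact: trace_C1.
  apply: Tint_ext => z _; rewrite -mxtraceZ; congr (\tr _).
  by rewrite -[mfmul F' G z]/(((a^-1)%:C%C *: F z) *m G z) -scalemxAl -scalemxAr mulmxA.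
by rewrite Re_M /= mul0r subr0 mulrC ler_pdivlMr.
Qed.

End FixedSymbol.
End OrderOfPhi.

Theorem theorem4p13 (R : realType) (n : nat) (Phi : @mxfun R n n) (k : nat) :
  (1 < n)%N ->
  LinfM Phi ->
  admissible n Phi ->
  very_badly_approximable n Phi ->
  (1 <= k <= n)%N ->
  (attains_sum n k Phi /\ (forall l, (1 <= l < k)%N -> ~ attains_sum n l Phi))
  <->
  [/\ has_order n k Phi,
      (forall j, (k <= j < n)%N -> tsv n Phi j = 0%E) &
      sigma_k n k Phi = (\sum_(j < k) tsv n Phi j)%E].
Proof.
move=> n1 PhiL _ vba /andP[k1 kn]; have [tau [tau0 tauE tau_ge]] := sing_levels PhiL vba.
have attO := attains_sum_order PhiL tau0 tauE tau_ge.
have maxA := maxvec_attains_sum PhiL tau0 tauE tau_ge.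
have lrange l : (1 <= l < k)%N -> (1 <= l <= n)%N.
  by move=> /andP[-> /ltnW lk]; exact: leq_trans lk kn.
have sumE : (forall j, (k <= j < n)%N -> tau j = 0) -> \sum_(j < n) tau j = \sum_(j < k) tau j.
  move=> z; rewrite (sum_tau_split tau kn) [X in _ + X]big_nat_cond.
  by rewrite [X in _ + X]big1 ?addr0// => j /andP[/z].
have kk : (1 <= k <= n)%N by rewrite k1.
(* The order condition at l makes sigma_l the distance from Phi to H^infty, which equals sigma_k = S
   because the sum is attained at k; the maximizing vector at l then yields attainment at l. *)
have uniq_sigma l : (1 <= l < k)%N -> order_cond n l Phi -> attains_sum n k Phi -> attains_sum n l Phi.
  move=> lk [mv so] /(attO _ kk)[_ sk [_ dk]].
  have /andP[_ ln] := lrange l lk.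
  by apply: (maxA _ ln mv); rewrite so -dk sk.
split=> [[ak nl]|[[_ [mv so] nl] tsv0 sk]].
  have [t0 sk ok] := attO _ kk ak.
  split; first by split=> // l lk ol; exact: (nl l lk (uniq_sigma l lk ol ak)).
  - by move=> j /[dup] jk /andP[_ jn]; rewrite tauE// t0.
  - by rewrite sk (tsv_sum tauE kn) sumE.
have t0 j : (k <= j < n)%N -> tau j = 0.
  by move=> /[dup] jk /andP[_ jn]; apply: EFin_inj; rewrite -tauE// tsv0.
split; first by apply: (maxA _ kn mv); rewrite sk (tsv_sum tauE kn) sumE.
move=> l lk al; have [_ _ ol] := attO _ (lrange l lk) al.
exact: (nl l lk ol).
Qed.
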